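(* Let $\sigma=\iota\to\cdots\to\iota\to\iota$ be a first-order type and $(D^\sigma,\sqsubseteq_{ext},\sqsubseteq_{st},\bot)$ the corresponding domain of any f-model. Then: (i) for $a,b\in\mathrm{fin}^\sigma$ the glb of $a,b$ w.r.t. $\sqsubseteq_{st}$ in $D^\sigma$ exists and is given by $\mathrm{trace}(a\sqcap_{st}b)=\mathrm{trace}(a)\cap\mathrm{trace}(b)$; (ii) for $a,b\in\mathrm{fin}^\sigma$ which are $\sqsubseteq_{st}$-compatible in $D^\sigma$, the lub w.r.t. $\sqsubseteq_{st}$ in $D^\sigma$ exists, is given by $\mathrm{trace}(a\sqcup_{st}b)=\mathrm{trace}(a)\cup\mathrm{trace}(b)$, is taken pointwise ($(a\sqcup_{st}b)\,x_1\ldots x_n=a\,x_1\ldots x_n\sqcup b\,x_1\ldots x_n$), and is also the lub w.r.t. $\sqsubseteq_{ext}$; (iii) hence the distributive law $a\sqcap_{st}(b\sqcup_{st}c)=(a\sqcap_{st}b)\sqcup_{st}(a\sqcap_{st}c)$ holds for finite $a,b,c$ with $b,c$ stably compatible. Moreover, if $D^\sigma$ contains a denotation for every infinite game term of type $\sigma$, then $D^\sigma$ is the domain of type $\sigma$ of the greatest f-model, statements (i)–(iii) hold for all elements $a,b,c\in D^\sigma$, and $(D^\sigma,\sqsubseteq_{ext},\sqsubseteq_{st},\bot)$ is a bidomain.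
   Context: PCF: types $\iota$, $\sigma\to\tau$; constants integers, $\mathrm{succ},\mathrm{pred}$, $\mathrm{if\ then\ else}$ (testing for $0$); terms $\Omega^\sigma$, variables, $\lambda$, application, $\mathbf{Y}$; usual reductions. $M\sqsubseteq_{obs}N$ iff for all contexts $P[\ ]$ with $P[M],P[N]$ closed of type $\iota$, $P[M]\to^*n$ implies $P[N]\to^*n$; $\equiv$ the induced equivalence. Finite projections $FP^\iota_i=\lambda x.\,\mathrm{if}\ x\ \mathrm{then}\ 0\ \mathrm{else}\ \ldots\ \mathrm{if}\ \mathrm{pred}^ix\ \mathrm{then}\ i\ \mathrm{else}\ \Omega$, $FP^{\sigma\to\tau}_i=\lambda f.\lambda x.FP^\tau_i(f(FP^\sigma_ix))$. $\mathrm{fin}^\sigma_i=\{[FP^\sigma_iM]_\equiv : M \text{ closed of type }\sigma\}$, $\mathrm{fin}^\sigma=\bigcup_i\mathrm{fin}^\sigma_i$, partially ordered by $\sqsubseteq_{obs}$. An ideal of $\mathrm{fin}^\sigma$ is a nonempty, directed, downward closed subset; $I(\mathrm{fin}^\sigma)$ is the set of ideals. Application of ideals: $f\,d=\downarrow\{f'd' : f'\in f,d'\in d\}$ with $f'd'=[MN]_\equiv$ for $M\in f',N\in d'$; finite $a$ is identified with $\downarrow\{a\}$. An f-model is a family $D^\sigma\subseteq I(\mathrm{fin}^\sigma)$, ordered by inclusion $\sqsubseteq_{ext}$, closed under application and containing the denotation $\downarrow\{[FP^\sigma_iM]_\equiv:i\ge0\}$ of every closed term $M:\sigma$; the greatest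 f-model takes all ideals. Elements of function types are identified with functions. $\sqcap_{ext}$ is glb w.r.t. $\sqsubseteq_{ext}$. Stable order: on $D^\iota$ equal to $\sqsubseteq_{ext}$; $f\sqsubseteq_{st}g$ in $D^{\sigma\to\tau}$ iff for all $x,y\in\mathrm{fin}^\sigma$ with $x\sqsubseteq_{st}y$, $f\,x=f\,y\sqcap_{ext}g\,x$. Traces: for $f\in D^{\sigma_1\to\cdots\to\sigma_n\to\iota}$ with $f\,x_1\ldots x_n=j$ an integer there is a $\sqsubseteq_{st}$-least vector $(y_1,\ldots,y_n)$ of finite elements with $y_k\sqsubseteq_{st}x_k$ and $f\,y_1\ldots y_n=j$; $y_1\mapsto\cdots\mapsto y_n\mapsto j$ is then a token of $f$, and $\mathrm{trace}(f)$ is the set of all tokens. Game terms (case-terms $\lambda x_1\ldots x_n.\,m$, $\Omega$, or $\lambda x_1\ldots x_n.\,\mathrm{case}_i(y\,M_1\ldots M_m)N_0\ldots N_i$ with $\mathrm{case}_i\,M\,N_0\ldots N_i$ equivalent to $\mathrm{if}\ M\ \mathrm{then}\ N_0\ \ldots\ \mathrm{if}\ \mathrm{pred}^iM\ \mathrm{then}\ N_i\ \mathrm{else}\ \Omega$) are ordered by $\sqsubseteq_{syn}$ (replacing $\Omega$'s by terms, and $\mathrm{case}_i\sqsubseteq\mathrm{case}_j$ for $i\le j$ componentwise). An infinite game term is an ideal of game terms under $\sqsubseteq_{syn}$; its denotation is the lub of the denotations of its members, if it exists. Bidomain: $(D,\sqsubseteq_{ext},\sqsubseteq_{st},\bot)$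 is a bicpo if (1) $(D,\sqsubseteq_{ext},\bot)$ is a cpo with a continuous glb function $\sqcap_{ext}$; (2) $(D,\sqsubseteq_{st},\bot)$ is a cpo, $a\sqsubseteq_{st}b$ implies $a\sqsubseteq_{ext}b$, and $\sqsubseteq_{st}$-directed sets have equal $\sqsubseteq_{st}$- and $\sqsubseteq_{ext}$-lubs; (3) $\sqcap_{ext}$ is $\sqsubseteq_{st}$-monotone; (4) for $\sqsubseteq_{st}$-directed $S,S'$, if for all $a\in S,a'\in S'$ there are $b\in S,b'\in S'$ with $a\sqsubseteq_{ext}b$, $a'\sqsubseteq_{ext}b'$, $b\sqsubseteq_{st}b'$, then $\bigsqcup_{ext}S\sqsubseteq_{st}\bigsqcup_{ext}S'$. It is distributive if $(D,\sqsubseteq_{st})$ is bounded complete, satisfies $a\sqcap_{st}(b\sqcup_{st}c)=(a\sqcap_{st}b)\sqcup_{st}(a\sqcap_{st}c)$ for stably compatible $b,c$, and $\sqsubseteq_{st}$-lubs of compatible pairs are also $\sqsubseteq_{ext}$-lubs. A bidomain is a distributive bicpo with a $\sqsubseteq_{st}$-increasing sequence $(\psi_i)$ of $\sqsubseteq_{ext}$- and $\sqsubseteq_{st}$-continuous maps with $\psi_i\sqsubseteq_{st}\mathrm{id}$, $\psi_i\circ\psi_i=\psi_i$, $\psi_i(D)$ finite and $\bigsqcup_{st}\psi_i=\mathrm{id}$.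
   Formalization: The stable order at σ→τ also requires f x ⊑_st g x (Berry's definition), besides f x = f y ⊓_ext g x; with the equation alone (i) fails at ι→ι→ι for λx y. if y then 0 else Ω and λx y. 0. *)

(* Defs.v *)
From Stdlib Require List.
From mathcomp Require Import all_boot.
From mathcomp Require Import boolp classical_sets cardinality.

Set Implicit Arguments.
Unset Strict Implicit.
Unset Printing Implicit Defensive.

Local Open Scope classical_set_scope.

Definition directed T (le : T -> T -> Prop) (S : set T) : Prop :=
  S !=set0 /\ forall a b, S a -> S b -> exists2 c, S c & le a c /\ le b c.

Definition ideal T (le : T -> T -> Prop) (X I : set T) : Prop :=
  [/\ I `<=` X, directed le I & forall a b, X a -> I b -> le a b -> I a].

Definition is_lub T (le : T -> T -> Prop) (X S : set T) (u : T) : Prop :=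
  [/\ X u, forall s, S s -> le s u
    & forall v, X v -> (forall s, S s -> le s v) -> le u v].

Definition is_glb T (le : T -> T -> Prop) (X S : set T) (m : T) : Prop :=
  [/\ X m, forall s, S s -> le m s
    & forall v, X v -> (forall s, S s -> le v s) -> le v m].

Definition compatible T (le : T -> T -> Prop) (X : set T) (a b : T) : Prop :=
  exists2 u, X u & le a u /\ le b u.

(* a /\ (b \/ c) = (a /\ b) \/ (a /\ c), including that the five bounds exist *)
Definition distributive_law T (le : T -> T -> Prop) (X : set T) (a b c : T) :
    Prop :=
  exists bc ab ac m,
    [/\ is_lub le X [set b; c] bc, is_glb le X [set a; b] ab,
        is_glb le X [set a; c] ac, is_glb le X [set a; bc] m
      & is_lub le X [set ab; ac] m].

Definition partial_order T (le : T -> T -> Prop) (X : set T) : Prop :=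
  [/\ forall a, X a -> le a a,
      forall a b, X a -> X b -> le a b -> le b a -> a = b
    & forall a b c, X a -> X b -> X c -> le a b -> le b c -> le a c].

Definition cpo T (le : T -> T -> Prop) (X : set T) (bot : T) : Prop :=
  [/\ partial_order le X, X bot, forall a, X a -> le bot a
    & forall S, S `<=` X -> directed le S -> exists u, is_lub le X S u].

Definition scott_continuous T U (leT : T -> T -> Prop) (X : set T)
    (leU : U -> U -> Prop) (Y : set U) (f : T -> U) : Prop :=
  (forall x, X x -> Y (f x)) /\
  forall S u, S `<=` X -> directed leT S -> is_lub leT X S u ->
    is_lub leU Y (f @` S) (f u).

Definition prod_le T (le : T -> T -> Prop) (p q : T * T) : Prop :=
  le p.1 q.1 /\ le p.2 q.2.

Definition bicpo T (X : set T) (ext st : T -> T -> Prop) (bot : T) : Prop :=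
  [/\ cpo ext X bot,
      exists meet : T -> T -> T,
        [/\ forall a b, X a -> X b -> is_glb ext X [set a; b] (meet a b),
            scott_continuous (prod_le ext) (X `*` X) ext X
              (fun p => meet p.1 p.2)
          & forall a a' b b', X a -> X a' -> X b -> X b' ->
              st a a' -> st b b' -> st (meet a b) (meet a' b')],
      [/\ cpo st X bot,
          forall a b, X a -> X b -> st a b -> ext a b
        & forall S u, S `<=` X -> directed st S ->
            is_lub st X S u -> is_lub ext X S u]
    & forall S S', S `<=` X -> S' `<=` X -> directed st S -> directed st S' ->
        (forall a a', S a -> S' a' ->
           exists b b', [/\ S b, S' b', ext a b, ext a' b' & st b b']) ->
        forall u u', is_lub ext X S u -> is_lub ext X S' u' -> st u u'].

Definition bounded_complete T (le : T -> T -> Prop) (X : set T) : Prop :=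
  forall S, S `<=` X -> (exists2 v, X v & forall s, S s -> le s v) ->
    exists u, is_lub le X S u.

Definition distributive_bicpo T (X : set T) (ext st : T -> T -> Prop) (bot : T) :
    Prop :=
  [/\ bicpo X ext st bot,
      bounded_complete st X,
      forall a b c, X a -> X b -> X c -> compatible st X b c ->
        distributive_law st X a b c
    & forall a b u, X a -> X b ->
        is_lub st X [set a; b] u -> is_lub ext X [set a; b] u].

(* Berry's stable order on maps, cf. st below; it refines the pointwise one.  *)
Definition st_map T (X : set T) (ext st : T -> T -> Prop) (f g : T -> T) :
    Prop :=
  (forall x, X x -> st (f x) (g x)) /\
  forall x y, X x -> X y -> st x y -> is_glb ext X [set f y; g x] (f x).

Definition bidomain T (X : set T) (ext st : T -> T -> Prop) (bot : T) : Prop :=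
  distributive_bicpo X ext st bot /\
  exists psi : nat -> T -> T,
    (forall i j, i <= j -> st_map X ext st (psi i) (psi j)) /\
    (forall i, [/\ scott_continuous ext X ext X (psi i),
                   scott_continuous st X st X (psi i),
                   st_map X ext st (psi i) id,
                   forall x, X x -> psi i (psi i x) = psi i x
                 & finite_set (psi i @` X)]) /\
    (forall x, X x -> is_lub st X (range (fun i => psi i x)) x).

Inductive ty : Type := Iota | Arr of ty & ty.

(* arrs [:: s1; ...; sn] is s1 -> ... -> sn -> iota *)
Definition arrs (ss : seq ty) : ty := foldr Arr Iota ss.

(* De Bruijn indices; If tests its first argument for 0. *)
Inductive tm : Type :=
| Var of nat
| Cst of nat
| Succ
| Pred
| If
| Omega of ty
| Y of ty
| Lam of ty & tm
| App of tm & tm.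

Inductive typed : seq ty -> tm -> ty -> Prop :=
| ty_var G k s : onth G k = Some s -> typed G (Var k) s
| ty_num G n : typed G (Cst n) Iota
| ty_succ G : typed G Succ (Arr Iota Iota)
| ty_pred G : typed G Pred (Arr Iota Iota)
| ty_if G : typed G If (Arr Iota (Arr Iota (Arr Iota Iota)))
| ty_omega G s : typed G (Omega s) s
| ty_Y G s : typed G (Y s) (Arr (Arr s s) s)
| ty_lam G s t M : typed (s :: G) M t -> typed G (Lam s M) (Arr s t)
| ty_app G s t M N :
    typed G M (Arr s t) -> typed G N s -> typed G (App M N) t.

Definition closed_tm (s : ty) (M : tm) : Prop := typed [::] M s.

Fixpoint rename (r : nat -> nat) (M : tm) : tm :=
  match M with
  | Var k => Var (r k)
  | Lam s M1 => Lam s (rename (fun k => if k is k'.+1 then (r k').+1 else 0) M1)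
  | App M1 M2 => App (rename r M1) (rename r M2)
  | _ => M
  end.

Definition scons (M : tm) (e : nat -> tm) (k : nat) : tm :=
  if k is k'.+1 then e k' else M.

Fixpoint subst (e : nat -> tm) (M : tm) : tm :=
  match M with
  | Var k => e k
  | Lam s M1 => Lam s (subst (scons (Var 0) (fun k => rename S (e k))) M1)
  | App M1 M2 => App (subst e M1) (subst e M2)
  | _ => M
  end.

(* One-hole contexts; plugging may capture free variables. *)
Inductive ctx : Type :=
| Hole
| CLam of ty & ctx
| CAppL of ctx & tm
| CAppR of tm & ctx.

Fixpoint plug (P : ctx) (M : tm) : tm :=
  match P with
  | Hole => M
  | CLam s P1 => Lam s (plug P1 M)
  | CAppL P1 N => App (plug P1 M) N
  | CAppR N P1 => App N (plug P1 M)
  end.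

Definition tif (M N1 N2 : tm) : tm := App (App (App If M) N1) N2.

(* The integers are the natural numbers; pred 0 has no reduct. *)
Inductive redex : tm -> tm -> Prop :=
| r_beta s M N : redex (App (Lam s M) N) (subst (scons N Var) M)
| r_Y s M : redex (App (Y s) M) (App M (App (Y s) M))
| r_succ n : redex (App Succ (Cst n)) (Cst n.+1)
| r_pred n : redex (App Pred (Cst n.+1)) (Cst n)
| r_if0 M N : redex (tif (Cst 0) M N) M
| r_ifS n M N : redex (tif (Cst n.+1) M N) N.

Inductive red : tm -> tm -> Prop :=
| red_refl M : red M M
| red_step P M N K : redex M N -> red (plug P N) K -> red (plug P M) K.

Definition obs_le (M N : tm) : Prop :=
  forall (P : ctx) (n : nat),
    closed_tm Iota (plug P M) -> closed_tm Iota (plug P N) ->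
    red (plug P M) (Cst n) -> red (plug P N) (Cst n).

Definition eqclass (s : ty) (M : tm) : set tm :=
  [set N | [/\ closed_tm s N, obs_le M N & obs_le N M]].

(* if M then N_0 else if pred M then N_1 else ... if pred^i M then N_i        *)
(* else Omega                                                                *)
Fixpoint tcase (M : tm) (Ns : seq tm) : tm :=
  if Ns is N :: Ns' then tif M N (tcase (App Pred M) Ns') else Omega Iota.

Fixpoint FP (s : ty) (i : nat) : tm :=
  match s with
  | Iota => Lam Iota (tcase (Var 0) [seq Cst k | k <- iota 0 i.+1])
  | Arr s1 s2 =>
      Lam (Arr s1 s2)
        (Lam s1 (App (FP s2 i) (App (Var 1) (App (FP s1 i) (Var 0)))))
  end.

Definition fin_at (s : ty) (i : nat) : set (set tm) :=
  [set eqclass s (App (FP s i) M) | M in closed_tm s].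

Definition fin (s : ty) : set (set tm) := \bigcup_i fin_at s i.

Definition class_le (C C' : set tm) : Prop :=
  forall M N, C M -> C' N -> obs_le M N.

(* Elements of the domains are sets of finite elements, which in turn are     *)
(* equivalence classes of closed terms.                                       *)
Definition dom : Type := set (set tm).

Definition ext (f g : dom) : Prop := f `<=` g.

Definition down (s : ty) (A : set (set tm)) : dom :=
  [set C | fin s C /\ exists2 C', A C' & class_le C C'].

(* f' d' = [M N] for M in f' and N in d', at result type t *)
Definition class_app (t : ty) (F A : set tm) : set tm :=
  [set K | exists M N, [/\ F M, A N & eqclass t (App M N) K]].

Definition iapp (t : ty) (f d : dom) : dom :=
  down t [set class_app t f' d' | f' in f & d' in d].

Fixpoint iapps (ss : seq ty) (f : dom) (xs : seq dom) : dom :=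
  match ss, xs with
  | _ :: ss', x :: xs' => iapps ss' (iapp (arrs ss') f x) xs'
  | _, _ => f
  end.

Definition den (s : ty) (M : tm) : dom :=
  down s (range (fun i => eqclass s (App (FP s i) M))).

Definition bot (s : ty) : dom := den s (Omega s).

Definition fmodel (D : ty -> set dom) : Prop :=
  [/\ forall s, D s `<=` ideal class_le (fin s),
      forall s t f d, D (Arr s t) f -> D s d -> D t (iapp t f d)
    & forall s M, closed_tm s M -> D s (den s M)].

Definition greatest_fmodel (s : ty) : set dom := ideal class_le (fin s).

(* Finite elements, identified with the principal ideals they generate. *)
Definition fin_elt (s : ty) : set dom := [set down s [set C] | C in fin s].

(* Berry's stable order: f x is stably below g x, and f x is the extensional   *)
(* meet of f y and g x whenever x is stably below y.  The first clause follows *)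
(* from the second when s2 is Iota, but not for curried functions: with the    *)
(* second clause alone, \x y. if y then 0 else Omega would be below \x y. 0,   *)
(* although their traces are disjoint.                                        *)
Fixpoint st (D : ty -> set dom) (s : ty) (f g : dom) : Prop :=
  match s with
  | Iota => ext f g
  | Arr s1 s2 =>
      forall x y, fin_elt s1 x -> fin_elt s1 y -> st D s1 x y ->
        st D s2 (iapp s2 f x) (iapp s2 g x) /\
        is_glb ext (D s2) [set iapp s2 f y; iapp s2 g x] (iapp s2 f x)
  end.

Fixpoint st_vec (D : ty -> set dom) (ss : seq ty) (xs ys : seq dom) : Prop :=
  match ss, xs, ys with
  | [::], [::], [::] => True
  | s :: ss', x :: xs', y :: ys' => st D s x y /\ st_vec D ss' xs' ys'
  | _, _, _ => False
  end.

Definition is_vec (A : ty -> set dom) (ss : seq ty) (xs : seq dom) : Prop :=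
  List.Forall2 (fun s x => A s x) ss xs.

(* (ys, j) stands for the token y_1 |-> ... |-> y_n |-> j. *)
Definition trace (D : ty -> set dom) (ss : seq ty) (f : dom) :
    set (seq dom * nat) :=
  [set yj | let ys := yj.1 in let fin_below := fun xs zs =>
       [/\ is_vec fin_elt ss zs, st_vec D ss zs xs
         & iapps ss f zs = den Iota (Cst yj.2)] in
     exists xs,
       [/\ is_vec D ss xs, iapps ss f xs = den Iota (Cst yj.2),
           fin_below xs ys
         & forall zs, fin_below xs zs -> st_vec D ss ys zs]].

(* GNum ss m           is  lambda x_1 ... x_n. m                              *)
(* GCase ss y Ms Ns    is  lambda x_1 ... x_n. case_i (y M_1 ... M_m) N_0 ... N_i *)
(* where ss lists the types of x_1, ..., x_n and i + 1 is the length of Ns.   *)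
Inductive gtm : Type :=
| GOmega of ty
| GNum of seq ty & nat
| GCase of seq ty & nat & seq gtm & seq gtm.

(* x_n is the innermost binder, hence the context catrev ss G. *)
Inductive game_typed : seq ty -> gtm -> ty -> Prop :=
| gty_omega G s : game_typed G (GOmega s) s
| gty_num G ss m : game_typed G (GNum ss m) (arrs ss)
| gty_case G ss y us Ms Ns :
    onth (catrev ss G) y = Some (arrs us) ->
    List.Forall2 (game_typed (catrev ss G)) Ms us ->
    Ns <> [::] ->
    List.Forall (fun N => game_typed (catrev ss G) N Iota) Ns ->
    game_typed G (GCase ss y Ms Ns) (arrs ss).

Definition game_term (s : ty) : set gtm := [set g | game_typed [::] g s].

Inductive syn_le : gtm -> gtm -> Prop :=
| syn_omega s g : syn_le (GOmega s) g
| syn_num ss m : syn_le (GNum ss m) (GNum ss m)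
| syn_case ss y Ms Ms' Ns Ns' Ns'' :
    List.Forall2 syn_le Ms Ms' -> List.Forall2 syn_le Ns Ns' ->
    syn_le (GCase ss y Ms Ns) (GCase ss y Ms' (Ns' ++ Ns'')).

Fixpoint tm_of_game (g : gtm) : tm :=
  match g with
  | GOmega s => Omega s
  | GNum ss m => foldr Lam (Cst m) ss
  | GCase ss y Ms Ns =>
      foldr Lam
        (tcase (foldl App (Var y) (map tm_of_game Ms)) (map tm_of_game Ns)) ss
  end.

Definition infinite_game_term (s : ty) (G : set gtm) : Prop :=
  ideal syn_le (game_term s) G.

Definition game_denotation (D : ty -> set dom) (s : ty) (G : set gtm) (d : dom) :
    Prop :=
  is_lub ext (D s) [set den s (tm_of_game g) | g in G] d.

Definition st_glbs_by_trace (D : ty -> set dom) (ss : seq ty) (A : set dom) :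
    Prop :=
  let s := arrs ss in
  forall a b, A a -> A b ->
    exists2 m, is_glb (st D s) (D s) [set a; b] m
             & trace D ss m = trace D ss a `&` trace D ss b.

Definition st_lubs_by_trace (D : ty -> set dom) (ss : seq ty) (A : set dom) :
    Prop :=
  let s := arrs ss in
  forall a b, A a -> A b -> compatible (st D s) (D s) a b ->
    exists u,
      [/\ is_lub (st D s) (D s) [set a; b] u,
          trace D ss u = trace D ss a `|` trace D ss b,
          forall xs, is_vec D ss xs ->
            is_lub ext (D Iota) [set iapps ss a xs; iapps ss b xs]
              (iapps ss u xs)
        & is_lub ext (D s) [set a; b] u].

Definition st_distributive (D : ty -> set dom) (ss : seq ty) (A : set dom) :
    Prop :=
  let s := arrs ss in
  forall a b c, A a -> A b -> A c -> compatible (st D s) (D s) b c ->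
    distributive_law (st D s) (D s) a b c.

(* Main.v *)
(* A closed term of first-order type is determined, up to observational
   equivalence, by its values at numerals and [Omega] (context lemma, by a
   step-indexed logical relation).  Running it on free variables shows that this
   function is sequential: where it is undefined, some fixed argument has to be
   supplied before it can become defined.  Conversely, the finite truncations of
   a sequential function are defined by decision trees, which are game terms.
   So the ideals of finite elements are the sequential functions.  The
   extensional order is pointwise, and the stable order is inclusion of traces,
   a token being a leaf of the decision tree.  Replacing leaves by [Omega] gives
   again a decision tree, so every part of a trace is a trace; hence stable
   meets and bounded joins are intersections and unions of traces.
   For the last part, let [u] be the lub in [D] of the finite approximations of
   a sequential [F].  If [u] were defined at some [x] where [F] is not, a term
   that follows the decision tree of [F] along [x] before it consults [u] would
   produce a smaller upper bound. *)

From Pilot Require (* [classical_sets] has its own [down]. *)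
Import Defs.
From mathcomp Require Import all_boot.
From mathcomp Require Import boolp classical_sets cardinality.
From mathcomp Require Import zify.
Import Defs.

Set Implicit Arguments.
Unset Strict Implicit.
Unset Printing Implicit Defensive.

(** [obs_le] speaks of full reduction, while sequentiality is read off a deterministic strategy and
    the place where it gets stuck. The proof therefore works with head reduction. That full
    reduction to a numeral implies head convergence is obtained from the same logical relation as
    the context lemma, in place of a standardisation argument. The obstacle in the last part is that
    an arbitrary [D] is only known to contain the denotations of closed terms and to be closed under
    application. Its lubs need not be pointwise, and a competitor for the lub [u] has to be produced
    inside [D]. It is the denotation of a closed term of type [sg n] to [sg n], applied to [u]. This
    type is beyond the context lemma proved for [sg n], so the approximations of that term are
    compared only after application to terms of type [sg n]. *)

(** * Substitution and typing *)

Definition up_ren (r : nat -> nat) (k : nat) : nat :=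
  if k is k'.+1 then (r k').+1 else 0.

Definition up_sub (e : nat -> tm) : nat -> tm :=
  scons (Var 0) (fun k => rename S (e k)).

Lemma up_ren_comp r r' : up_ren r \o up_ren r' = up_ren (r \o r').
Proof. by apply/funext => -[|k]. Qed.

Lemma rename_rename r r' M : rename r (rename r' M) = rename (r \o r') M.
Proof.
elim: M r r' => //= [s M IH|M IHM N IHN] r r'; last by rewrite IHM IHN.
by rewrite -/(up_ren r) -/(up_ren r') IH up_ren_comp.
Qed.

Lemma subst_rename e r M : subst e (rename r M) = subst (e \o r) M.
Proof.
elim: M e r => //= [s M IH|M IHM N IHN] e r; last by rewrite IHM IHN.
rewrite IH; congr (Lam s (subst _ M)).
by apply/funext => -[|k].
Qed.

Lemma rename_subst r e M : rename r (subst e M) = subst (fun k => rename r (e k)) M.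
Proof.
elim: M e r => //= [s M IH|M IHM N IHN] e r; last by rewrite IHM IHN.
rewrite IH; congr (Lam s (subst _ M)).
by apply/funext => -[|k] //=; rewrite !rename_rename.
Qed.

Lemma subst_subst e e' M : subst e (subst e' M) = subst (fun k => subst e (e' k)) M.
Proof.
elim: M e e' => //= [s M IH|M IHM N IHN] e e'; last by rewrite IHM IHN.
rewrite IH; congr (Lam s (subst _ M)).
apply/funext => -[|k] //=; rewrite subst_rename rename_subst.
by congr subst; apply/funext.
Qed.

Lemma subst_Var M : subst Var M = M.
Proof.
elim: M => //= [s M IH|M IHM N IHN]; last by rewrite IHM IHN.
rewrite -[in RHS]IH; congr (Lam s (subst _ M)).
by apply/funext => -[|k].
Qed.

Lemma subst_scons_up N e M :
  subst (scons N Var) (subst (up_sub e) M) = subst (scons N e) M.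
Proof.
rewrite subst_subst; congr subst; apply/funext => -[|k] //=.
by rewrite subst_rename -[RHS]subst_Var; congr subst; apply/funext.
Qed.

Lemma subst_beta e N M :
  subst e (subst (scons N Var) M) =
  subst (scons (subst e N) Var) (subst (up_sub e) M).
Proof.
by rewrite subst_scons_up subst_subst; congr subst; apply/funext => -[|k].
Qed.

Lemma onth_ltn T (G : seq T) k s : onth G k = Some s -> k < size G.
Proof. by elim: G k => [|a G IH] [|k] //= /IH. Qed.

Lemma typed_subst_id G M s e :
  typed G M s -> (forall k, k < size G -> e k = Var k) -> subst e M = M.
Proof.
move=> tM; elim: tM e => //=.
- by move=> {}G k {}s Hk e He; apply: He; apply: onth_ltn Hk.
- move=> {}G {}s t {}M _ IH e He; rewrite IH // => -[|k] //= lk.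
  by rewrite He.
- by move=> {}G {}s t {}M N _ IHM _ IHN e He; rewrite IHM // IHN.
Qed.

Lemma subst_closed M s e : closed_tm s M -> subst e M = M.
Proof. by move=> /typed_subst_id; apply. Qed.

Lemma typed_rename G G' M s r : typed G M s ->
  (forall k t, onth G k = Some t -> onth G' (r k) = Some t) ->
  typed G' (rename r M) s.
Proof.
move=> tM; elim: tM G' r => /=; try by move=> *; constructor; eauto.
- move=> {}G {}s t {}M _ IH G' r Hr; constructor; apply: IH.
  by case=> [|k] u //=; apply: Hr.
- move=> {}G {}s t {}M N _ IHM _ IHN G' r Hr.
  by apply: ty_app (IHM _ _ Hr) (IHN _ _ Hr).
Qed.

Lemma rename_id M : rename id M = M.
Proof.
elim: M => //= [s M IH|M IHM N IHN]; last by rewrite IHM IHN.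
by rewrite -[in RHS]IH; congr (Lam s (rename _ M)); apply/funext => -[|k].
Qed.

Lemma closed_typed G M s : closed_tm s M -> typed G M s.
Proof. by move=> tM; rewrite -[M]rename_id; apply: typed_rename tM _; case. Qed.

Lemma typed_subst G G' M s e : typed G M s ->
  (forall k t, onth G k = Some t -> typed G' (e k) t) ->
  typed G' (subst e M) s.
Proof.
move=> tM; elim: tM G' e => /=; try by move=> *; constructor; eauto.
- by move=> {}G k {}s Hk G' e; apply.
- move=> {}G {}s t {}M _ IH G' e He; constructor; apply: IH.
  case=> [|k] u /= Hu; first by constructor.
  by apply: typed_rename (He _ _ Hu) _.
- move=> {}G {}s t {}M N _ IHM _ IHN G' e He.
  by apply: ty_app (IHM _ _ He) (IHN _ _ He).
Qed.

Lemma typed_uniq G M s t : typed G M s -> typed G M t -> s = t.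
Proof.
move=> tM; elim: tM t.
- by move=> {}G k {}s Hk t Ht; inversion Ht; subst; congruence.
- by move=> {}G n t Ht; inversion Ht.
- by move=> {}G t Ht; inversion Ht.
- by move=> {}G t Ht; inversion Ht.
- by move=> {}G t Ht; inversion Ht.
- by move=> {}G {}s t Ht; inversion Ht.
- by move=> {}G {}s t Ht; inversion Ht.
- by move=> {}G {}s t {}M _ IH u Hu; inversion Hu; subst; congr Arr; apply: IH.
- move=> {}G {}s t {}M N _ IHM _ IHN u Hu; inversion Hu; subst.
  by have [] : Arr s t = Arr s0 u by apply: IHM.
Qed.

Lemma typed_App_inv G M N t : typed G (App M N) t ->
  exists2 s, typed G M (Arr s t) & typed G N s.
Proof. by move=> H; inversion H; subst; exists s. Qed.

Lemma typed_Lam_inv G s M u : typed G (Lam s M) u ->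
  exists2 t, u = Arr s t & typed (s :: G) M t.
Proof. by move=> H; inversion H; subst; exists t. Qed.

Lemma redex_typed G M N s : redex M N -> typed G M s -> typed G N s.
Proof.
case=> {M N} [u M N|u M|n|n|M N|n M N].
- move=> /typed_App_inv[t /typed_Lam_inv[t' [-> <-]] tM tN].
  apply: typed_subst tM _ => -[|k] v /= Hk; first by case: Hk => <-.
  by constructor.
- move=> /typed_App_inv[t tY tM]; inversion tY; subst.
  by apply: ty_app (tM) _; apply: ty_app tY tM.
- by move=> /typed_App_inv[t tY _]; inversion tY; constructor.
- by move=> /typed_App_inv[t tY _]; inversion tY; constructor.
- move=> /typed_App_inv[a /typed_App_inv[b /typed_App_inv[c tI _] tM] _].
  by inversion tI; subst.
- move=> /typed_App_inv[a /typed_App_inv[b /typed_App_inv[c tI _] _] tN].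
  by inversion tI; subst.
Qed.

Lemma plug_typed P G M N s :
  (forall G t, typed G M t -> typed G N t) ->
  typed G (plug P M) s -> typed G (plug P N) s.
Proof.
move=> H; elim: P G s => /= [|u P IH|P IH K|K P IH] G s; first exact: H.
- by move=> /typed_Lam_inv[t -> /IH]; constructor.
- by move=> /typed_App_inv[t /IH tP tK]; apply: ty_app tP tK.
- by move=> /typed_App_inv[t tK /IH tP]; apply: ty_app tK tP.
Qed.

(** * Head reduction *)

Definition strict (M : tm) : Prop := M = Succ \/ M = Pred \/ M = If.

(** Call by name, with evaluation of the argument of a strict constant. The test of a conditional is
    reached by two uses of [h_fun] followed by [h_arg]. *)
Inductive hstep : tm -> tm -> Prop :=
| h_redex M N : redex M N -> hstep M N
| h_fun M M' N : hstep M M' -> hstep (App M N) (App M' N)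
| h_arg c M M' : strict c -> hstep M M' -> hstep (App c M) (App c M').

Inductive nsteps : nat -> tm -> tm -> Prop :=
| ns0 M : nsteps 0 M M
| nsS k M N K : hstep M N -> nsteps k N K -> nsteps k.+1 M K.

Definition ev k M n := nsteps k M (Cst n).
Definition conv M n := exists k, ev k M n.

Lemma hstep_App_inv M N K : hstep (App M N) K ->
  [\/ redex (App M N) K,
      exists2 M', hstep M M' & K = App M' N
    | strict M /\ exists2 N', hstep N N' & K = App M N'].
Proof.
move=> H; inversion H; subst.
- by constructor 1.
- by constructor 2; exists M'.
- by constructor 3; split=> //; exists M'.
Qed.

Lemma hstep_atom M N : hstep M N -> match M with App _ _ => True | _ => False end.
Proof. by case=> // {}M {}N []. Qed.

Lemma redex_fun_stuck M N K L : redex (App M N) K -> ~ hstep M L.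
Proof.
have tif1 (m : nat) P : ~ hstep (App (App If (Cst m)) P) L.
  case/hstep_App_inv=> [r|[M' H _]|[[|[|]] //]]; first by inversion r.
  case/hstep_App_inv: H => [r|[M'' /hstep_atom //]|[_ [N' /hstep_atom //]]].
  by inversion r.
by move=> r H; inversion r; subst; try (by have := hstep_atom H); apply: tif1 H.
Qed.

Lemma redex_arg_stuck M N K L : redex (App M N) K -> strict M -> ~ hstep N L.
Proof.
by move=> r [|[|]] E; subst M; inversion r => /hstep_atom.
Qed.

Lemma hstep_det M N N' : hstep M N -> hstep M N' -> N = N'.
Proof.
elim: M N N' => [k|n||||s|s|s M IH|M IHM K IHK] N N' HN HN';
  try by have := hstep_atom HN.
case/hstep_App_inv: HN => [r|[M1 H1 ->]|[sM [K1 H1 ->]]];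
case/hstep_App_inv: HN' => [r'|[M2 H2 ->]|[sM' [K2 H2 ->]]].
- by inversion r; subst; inversion r'; subst.
- by case: (redex_fun_stuck r H2).
- by case: (redex_arg_stuck r sM' H2).
- by case: (redex_fun_stuck r' H1).
- by rewrite (IHM _ _ H1 H2).
- by case: sM' H1 => [|[|]] -> /hstep_atom.
- by case: (redex_arg_stuck r' sM H1).
- by case: sM H2 => [|[|]] -> /hstep_atom.
- by rewrite (IHK _ _ H1 H2).
Qed.

Lemma conv_step M N n : hstep M N -> conv M n <-> conv N n.
Proof.
move=> H; split=> -[k Hk]; last by exists k.+1; apply: nsS H Hk.
inversion Hk; subst; first by have := hstep_atom H.
by exists k0; rewrite (hstep_det H H0).
Qed.

Lemma nsteps_conv k M N n : nsteps k M N -> conv M n <-> conv N n.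
Proof. by elim=> // {}k {}M {}N K /conv_step-> _ ->. Qed.

Lemma conv_Cst m n : conv (Cst m) n <-> m = n.
Proof.
split=> [[k H]|->]; last by exists 0; constructor.
by inversion H; subst => //; have := hstep_atom H0.
Qed.

Lemma conv_fun M n m : conv M n -> conv M m -> n = m.
Proof. by case=> k /nsteps_conv -> /conv_Cst. Qed.

Lemma ev_App_strict c M n k : strict c -> ev k (App c M) n ->
  exists i m, [/\ i < k, ev i M m & hstep (App c (Cst m)) (Cst n) ].
Proof.
move=> sc; elim: k M => [|k IH] M H; inversion H; subst.
case/hstep_App_inv: (H1) => [r|[M' H' _]|[_ [M' H' E]]].
- exists 0; case: sc => [|[|]] E; subst c; inversion r; subst.
  + by exists n0; split=> //; [constructor | inversion H2; subst=> //; have := hstep_atom H0].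
  + by exists n0.+1; split=> //; [constructor | inversion H2; subst=> //; have := hstep_atom H0].
- by case: sc H' => [|[|]] -> /hstep_atom.
- subst; case: (IH _ H2) => i [m [li Hm Hs]].
  by exists i.+1, m; split=> //; apply: nsS H' Hm.
Qed.

Lemma nsteps_arg k c M M' : strict c -> nsteps k M M' -> nsteps k (App c M) (App c M').
Proof.
move=> sc; elim=> [N|{}k N N' K H _ IH]; first by constructor.
by apply: nsS IH; apply: h_arg.
Qed.

Lemma conv_Succ M n : conv (App Succ M) n <-> exists2 m, conv M m & n = m.+1.
Proof.
have sS : strict Succ by left.
split=> [[k /(ev_App_strict sS)[i [m [_ Hm Hs]]]]|[m [k Hk] ->]].
  exists m; first by exists i.
  case/hstep_App_inv: Hs => [r|[M' /hstep_atom //]|[_ [M' /hstep_atom //]]].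
  by inversion r.
apply/(nsteps_conv _ (nsteps_arg sS Hk)).
by apply/(conv_step _ (h_redex (r_succ m)))/conv_Cst.
Qed.

Lemma conv_Pred M n : conv (App Pred M) n <-> conv M n.+1.
Proof.
have sS : strict Pred by right; left.
split=> [[k /(ev_App_strict sS)[i [m [_ Hm Hs]]]]|[k Hk]].
  exists i; case/hstep_App_inv: Hs => [r|[M' /hstep_atom //]|[_ [M' /hstep_atom //]]].
  by inversion r; subst.
apply/(nsteps_conv _ (nsteps_arg sS Hk)).
by apply/(conv_step _ (h_redex (r_pred n)))/conv_Cst.
Qed.

(** The bounds on [i] and [j] let [lrel_if] stay within its step index. *)
Lemma ev_tif k M N K n : ev k (tif M N K) n ->
  exists i j, [/\ i <= k, j <= k &
   (ev i M 0 /\ ev j N n) \/ exists2 m, ev i M m.+1 & ev j K n].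
Proof.
elim: k M => [|k IH] M H; inversion H; subst.
have sS : strict If by right; right.
case/hstep_App_inv: (H1) => [r|[M1 H' E1]|[[|[|]] //]].
  inversion r; subst; exists 0, k; split=> //.
    by left; split=> //; constructor.
  by right; exists n0 => //; constructor.
case/hstep_App_inv: (H') => [r|[M2 H'' E2]|[[|[|]] //]]; first by inversion r.
case/hstep_App_inv: (H'') => [r|[M3 /hstep_atom//]|[_ [M' HM E]]]; first by inversion r.
subst; case: (IH _ H2) => i [j [li lj Hij]].
exists i.+1, j; split=> //; first exact: leqW.
case: Hij => [[Hi Hj]|[m Hi Hj]]; [left; split=> // | right; exists m => //];
  exact: nsS HM Hi.
Qed.

Lemma nsteps_tif k M M' N K : nsteps k M M' -> nsteps k (tif M N K) (tif M' N K).
Proof.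
elim=> [A|{}k A B C H _ IH]; first by constructor.
by apply: nsS IH; do 2 apply: h_fun; apply: h_arg H; right; right.
Qed.

Lemma conv_tif M N K n : conv (tif M N K) n <->
  (conv M 0 /\ conv N n) \/ exists2 m, conv M m.+1 & conv K n.
Proof.
split.
  case=> k /ev_tif[i [j [_ _ [[Hi Hj]|[m Hi Hj]]]]].
    by left; split; [exists i | exists j].
  by right; exists m; [exists i | exists j].
case=> [[[i Hi] HN]|[m [i Hi] HK]].
- apply/(nsteps_conv _ (nsteps_tif N K Hi)).
  by apply/(conv_step _ (h_redex (r_if0 N K))).
- apply/(nsteps_conv _ (nsteps_tif N K Hi)).
  by apply/(conv_step _ (h_redex (r_ifS m N K))).
Qed.

Lemma not_conv_Omega s n : ~ conv (Omega s) n.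
Proof. by case=> k H; inversion H; subst; have := hstep_atom H0. Qed.

Lemma conv_red M n : conv M n -> red M (Cst n).
Proof.
have hs A B : hstep A B -> exists P A' B', [/\ redex A' B', A = plug P A' & B = plug P B'].
  elim=> {A B} [A B r|A B N _ [P [A' [B' [r -> ->]]]]|c A B _ _ [P [A' [B' [r -> ->]]]]].
  - by exists Hole, A, B.
  - by exists (CAppL P N), A', B'.
  - by exists (CAppR c P), A', B'.
case=> k; rewrite /ev; elim=> [A|{}k A B C /hs[P [A' [B' [r -> ->]]]] _ IH].
  exact: red_refl.
by apply: red_step r IH.
Qed.

(** * Step-indexed logical relation *)

(** Only the steps of the left term are counted; the right one may take any number. The index
    replaces a fixed-point argument for [Y]. *)
Fixpoint lrel (s : ty) (k : nat) (M N : tm) : Prop :=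
  match s with
  | Iota => forall i n, i <= k -> ev i M n -> conv N n
  | Arr s t => forall j A B, j <= k -> lrel s j A B ->
      lrel t j (App M A) (App N B)
  end.

Lemma lrel_le s j k M N : j <= k -> lrel s k M N -> lrel s j M N.
Proof.
case: s => [|s t] /= ljk H.
  by move=> i n lij; apply: H; apply: leq_trans lij ljk.
by move=> i A B lij; apply: H; apply: leq_trans lij ljk.
Qed.

(** A head step on the left pays for one unit of the index. At index 0 there is nothing to show,
    since a term that can step is not yet a numeral. This gain drives the induction in [lrel_Y]. *)
Lemma lrel_expL s k M M' N : hstep M M' ->
  (forall k', k = k'.+1 -> lrel s k' M' N) -> lrel s k M N.
Proof.
elim: s k M M' N => [|s _ t IH] k M M' N st H /=.
  move=> i n li Hi; inversion Hi; subst; first by have := hstep_atom st.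
  rewrite -(hstep_det st H0) in H1.
  by case: k li H => // k li /(_ k erefl)/(_ k0 n li H1).
move=> j A B lj HA; apply: IH (h_fun A st) _ => j' Ej; subst.
case: k lj H => // k lj /(_ k erefl) H; apply: H => //.
by apply: lrel_le HA.
Qed.

Lemma lrel_expR s k M N N' : hstep N N' -> lrel s k M N' -> lrel s k M N.
Proof.
elim: s k M N N' => [|s _ t IH] k M N N' st H /=.
  by move=> i n li Hi; apply/(conv_step _ st)/(H i).
by move=> j A B lj HA; apply: IH (h_fun B st) _; apply: H.
Qed.

(** Closed under application, so that [lrel_dead] goes through by induction on the type. *)
Inductive dead : tm -> Prop :=
| dead_Omega s : dead (Omega s)
| dead_App M N : dead M -> dead (App M N).

Lemma dead_nstep M N : dead M -> ~ hstep M N.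
Proof.
move=> dM; elim: dM N => [s|{}M K dM IH] N /=; first by move/hstep_atom.
case/hstep_App_inv => [r|[M' /IH //]|[[|[|]] E]]; try by subst M; inversion dM.
inversion r; subst; try by inversion dM.
  by inversion dM; subst; inversion H0; subst; inversion H1.
by inversion dM; subst; inversion H0; subst; inversion H1.
Qed.

Lemma not_conv_dead M j : dead M -> ~ conv M j.
Proof.
move=> dM [[|k] H].
  have E : M = Cst j by inversion H.
  by rewrite E in dM; inversion dM.
have [K HK] : exists K, hstep M K by inversion H; eexists; eassumption.
exact: dead_nstep dM HK.
Qed.

Lemma lrel_dead s k M N : dead M -> lrel s k M N.
Proof.
elim: s k M N => [|s _ t IH] k M N dM /=.
  by move=> i n _ H; case: (not_conv_dead (j := n) dM); exists i.
by move=> j A B _ _; apply: IH; constructor.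
Qed.

Definition env_rel (G : seq ty) k (e e' : nat -> tm) : Prop :=
  forall x t, onth G x = Some t -> lrel t k (e x) (e' x).

Definition open_rel (G : seq ty) (s : ty) (M N : tm) : Prop :=
  forall k e e', env_rel G k e e' -> lrel s k (subst e M) (subst e' N).

Lemma open_rel_Lam G s t M N :
  open_rel (s :: G) t M N -> open_rel G (Arr s t) (Lam s M) (Lam s N).
Proof.
move=> H k e e' He j A B lj HA /=.
apply: lrel_expL (h_redex (r_beta _ _ _)) _ => j' Ej.
apply: lrel_expR (h_redex (r_beta _ _ _)) _.
rewrite -!/(up_sub _) !subst_scons_up; apply: H => -[|x] u /=.
  by case=> <-; apply: lrel_le HA; rewrite Ej.
by move/He; apply: lrel_le; rewrite Ej in lj; apply: ltnW.
Qed.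

Lemma open_rel_App G s t M N K L : open_rel G (Arr s t) M N ->
  open_rel G s K L -> open_rel G t (App M K) (App N L).
Proof. by move=> H H' k e e' He /=; apply: (H k e e' He k) => //; apply: H'. Qed.

Lemma lrel_Y s k M N : lrel (Arr s s) k M N ->
  lrel s k (App (Y s) M) (App (Y s) N).
Proof.
elim: k M N => [|k IH] M N H; first by apply: lrel_expL (h_redex (r_Y _ _)) _.
apply: lrel_expL (h_redex (r_Y _ _)) _ => k' [<-].
apply: lrel_expR (h_redex (r_Y _ _)) _.
by apply: (H) => //; apply: IH; apply: lrel_le H.
Qed.

Lemma lrel_if k : lrel (Arr Iota (Arr Iota (Arr Iota Iota))) k If If.
Proof.
move=> j A A' lj HA j1 B B' lj1 HB j2 C C' lj2 HC i n li /ev_tif[a [b [la lb H]]].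
apply/conv_tif; case: H => [[Ha Hb]|[m Ha Hb]]; [left|right].
  split; [apply: HA Ha | apply: HB Hb]; lia.
exists m; [apply: HA Ha | apply: HC Hb]; lia.
Qed.

Lemma fundamental G M s : typed G M s -> open_rel G s M M.
Proof.
elim=> {G M s} /=.
- by move=> G k s Hk j e e' He; apply: He.
- by move=> G n k e e' _ i m _ Hm; exists i.
- move=> G k e e' _ j A B lj HA i n li Hi.
  have sS : strict Succ by left.
  case: (ev_App_strict sS Hi) => i' [m' [li' Hm' Hs]].
  have/conv_Succ[m2 /conv_Cst E1 E2] : conv (App Succ (Cst m')) n.
    by apply/(conv_step _ Hs)/conv_Cst.
  by apply/conv_Succ; exists m2 => //; apply: HA; rewrite -?E1; last exact: Hm'; lia.
- move=> G k e e' _ j A B lj HA i n li Hi.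
  have sS : strict Pred by right; left.
  case: (ev_App_strict sS Hi) => i' [m' [li' Hm' Hs]].
  have/conv_Pred/conv_Cst E : conv (App Pred (Cst m')) n.
    by apply/(conv_step _ Hs)/conv_Cst.
  by apply/conv_Pred; apply: HA; rewrite -?E; last exact: Hm'; lia.
- by move=> G k e e' _; apply: lrel_if.
- by move=> G s k e e' _; apply: lrel_dead; constructor.
- by move=> G s k e e' _ j A B _; apply: lrel_Y.
- by move=> G s t M _ IH; apply: open_rel_Lam.
- by move=> G s t M N _ IHM _ IHN; apply: open_rel_App IHN.
Qed.

Lemma env_rel_nil k e e' : env_rel [::] k e e'.
Proof. by case. Qed.

Lemma open_rel_plug P G M N L s : typed G (plug P M) s ->
  (forall G t, typed G M t -> open_rel G t N L) ->
  open_rel G s (plug P N) (plug P L).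
Proof.
move=> tP H; elim: P G s tP => /= [|u P IH|P IH K|K P IH] G s; first exact: H.
- by move=> /typed_Lam_inv[t -> /IH]; apply: open_rel_Lam.
- by move=> /typed_App_inv[t /IH tP /fundamental]; apply: open_rel_App tP.
- by move=> /typed_App_inv[t /fundamental tK /IH tP]; apply: open_rel_App tK tP.
Qed.

Lemma open_rel_conv M N n : open_rel [::] Iota M N ->
  subst Var M = M -> subst Var N = N -> conv M n -> conv N n.
Proof.
move=> H EM EN [k Hk].
by have := H k Var Var (@env_rel_nil _ _ _) k n (leqnn _); rewrite EM EN; apply.
Qed.

(** The contractum stands on the left because expansion on the right costs no index. This is the
    direction in which [red_conv] carries convergence back from the numeral. *)
Lemma redex_open_rel M N G t : redex M N -> typed G M t -> open_rel G t N M.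
Proof.
move=> r tM k e e' He.
have tN := redex_typed r tM.
have st : hstep (subst e' M) (subst e' N).
  apply: h_redex; case: r {tM tN} => {M N} [u M N|u M|n|n|M N|n M N] /=;
    try by constructor.
  by rewrite subst_beta; constructor.
by apply: lrel_expR st _; apply: fundamental tN _ _ _ He.
Qed.

(* Full reduction is sound for head reduction because contracting a redex
   anywhere yields a logically related term. *)
Lemma red_conv M n : closed_tm Iota M -> red M (Cst n) -> conv M n.
Proof.
move=> tM H; remember (Cst n) as K eqn:E; elim: H tM E => {M K}.
  by move=> M _ ->; apply/conv_Cst.
move=> P M N K r _ IH tM EK; have tN : closed_tm Iota (plug P N).
  by apply: plug_typed tM => G t; apply: redex_typed.
move: (IH tN EK); apply: open_rel_conv; rewrite ?subst_Var //.
by apply: open_rel_plug (tM) _ => G t; apply: redex_open_rel r.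
Qed.

Lemma obs_le_conv P M N n : obs_le M N ->
  closed_tm Iota (plug P M) -> closed_tm Iota (plug P N) ->
  conv (plug P M) n -> conv (plug P N) n.
Proof. by move=> H tM tN /conv_red Hn; apply: red_conv (tN) _; apply: H. Qed.

Lemma lrel_obs_le s M N : closed_tm s M -> closed_tm s N ->
  (forall k, lrel s k M N) -> obs_le M N.
Proof.
move=> tM tN H P n tPM tPN /(red_conv tPM) Hn; apply: conv_red; move: Hn.
apply: open_rel_conv; rewrite ?subst_Var //.
apply: open_rel_plug (tPM) _ => G t tM' k e e' _.
by rewrite (subst_closed _ tM) (subst_closed _ tN) -(typed_uniq (closed_typed G tM) tM').
Qed.

(** * First-order behaviour *)

Definition sg n : ty := arrs (nseq n Iota).
Definition apps (M : tm) (Ns : seq tm) : tm := foldl App M Ns.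
Definition q (v : option nat) : tm := if v is Some m then Cst m else Omega Iota.

Lemma closed_q v : closed_tm Iota (q v).
Proof. by case: v => [m|]; constructor. Qed.

Lemma dead_apps M Ns : dead M -> dead (apps M Ns).
Proof. by elim: Ns M => //= N Ns IH M dM; apply: IH; constructor. Qed.

Lemma typed_apps G ss M Ns t : typed G M (foldr Arr t ss) ->
  List.Forall2 (fun s N => typed G N s) ss Ns -> typed G (apps M Ns) t.
Proof.
move=> tM H; elim: H M tM => {ss Ns} [|s N ss Ns tN _ IH] M tM //=.
by apply: IH; apply: ty_app tM tN.
Qed.

Lemma subst_apps e M Ns : subst e (apps M Ns) = apps (subst e M) (map (subst e) Ns).
Proof. by elim: Ns M => //= N Ns IH M; rewrite -/(apps _ _) IH. Qed.

Lemma lrel_sg n k M N : lrel (sg n) k M N <->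
  forall j As Bs, j <= k -> size As = n -> size Bs = n ->
    (forall i, i < n -> lrel Iota j (nth (Cst 0) As i) (nth (Cst 0) Bs i)) ->
    lrel Iota j (apps M As) (apps N Bs).
Proof.
elim: n k M N => [|n IH] k M N; split => H.
- by move=> j [] // [] // lj _ _ _; apply: lrel_le lj H.
- by apply: (H k [::] [::]).
- move=> j [|A As] [|B Bs] // lj [sA] [sB] HAB.
  have := H j A B lj (HAB 0 isT) => /IH; apply => // i li.
  exact: (HAB i.+1).
- move=> j A B lj HA; apply/IH => j' As Bs lj' sA sB HAB.
  apply: (H j' (A :: As) (B :: Bs)); rewrite /= ?sA ?sB //.
    exact: leq_trans lj' lj.
  by case=> [|i] li; [apply: lrel_le HA | apply: HAB].
Qed.

(* [F x j] stands for [F x = j]; [None] is the undefined argument. *)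
Definition pfun : Type := seq (option nat) -> nat -> Prop.

Definition beh n (M : tm) : pfun :=
  fun x j => size x = n /\ conv (apps M (map q x)) j.

Definition fle (F G : pfun) : Prop := forall x j, F x j -> G x j.

(* An argument that has a value within [j] steps is replaced by this value, any
   other argument by [Omega]; up to index [j] nothing is lost. *)
Lemma context_lemma n M N : closed_tm (sg n) M -> closed_tm (sg n) N ->
  fle (beh n M) (beh n N) -> forall k, lrel (sg n) k M N.
Proof.
have refl K j : closed_tm (sg n) K -> lrel (sg n) j K K.
  move=> tK; have := fundamental tK (@env_rel_nil j Var Var).
  by rewrite (subst_closed _ tK).
move=> tM tN H k; apply/lrel_sg => j As Bs lj sA sB HAB i m li Hm.
have /choice[c Hc] (A : tm) : exists v : option nat, lrel Iota j A (q v) /\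
    (forall B, lrel Iota j A B -> forall l, lrel Iota l (q v) B).
  have [[v [a [la Ha]]]|np] := pselect (exists v a, a <= j /\ ev a A v).
    exists (Some v); split=> [b w lb Hb|B HA l b w lb Hb].
      by apply/conv_Cst; apply: (@conv_fun A); [exists a | exists b].
    by have/conv_Cst <- : conv (Cst v) w; [exists b | apply: HA Ha].
  exists None; split=> [b w lb Hb|B _ l]; last by apply: lrel_dead; constructor.
  by case: np; exists w, b.
have Hm1 : conv (apps M (map q (map c As))) m.
  have /lrel_sg HM := refl M j tM.
  apply: (HM j As _ (leqnn _) sA) li Hm; first by rewrite !size_map.
  by move=> a la; rewrite -map_comp (nth_map (Cst 0)) ?sA //; case: (Hc (nth (Cst 0) As a)).
have [_ [l Hl]] : beh n N (map c As) m by apply: H; split; rewrite ?size_map.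
have /lrel_sg HN := refl N l tN.
apply: (HN l _ Bs (leqnn _) _ sB) (leqnn _) Hl; first by rewrite !size_map.
move=> a la; rewrite -map_comp (nth_map (Cst 0)) ?sA //.
by case: (Hc (nth (Cst 0) As a)) => _; apply; apply: HAB.
Qed.

Lemma Forall2_nseq T (A : T -> Prop) (f : ty -> T -> Prop) s n xs :
  (forall x, f s x <-> A x) ->
  List.Forall2 f (nseq n s) xs <-> size xs = n /\ forall x, List.In x xs -> A x.
Proof.
move=> Hf; split.
  elim: n xs => [|n IH] xs H; inversion H; subst => //=.
  by case: (IH _ H4) => -> HA; split=> // x [<-|]; [apply/Hf | apply: HA].
elim: n xs => [|n IH] [|x xs] //= [] // [sx] H; constructor.
  by apply/Hf; apply: H; left.
by apply: IH; split=> // y Hy; apply: H; right.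
Qed.

Lemma In_map T U (f : T -> U) y s :
  List.In y (map f s) <-> exists2 x, List.In x s & y = f x.
Proof.
elim: s => [|x s IH] /=; first by split=> // -[].
rewrite IH; split=> [[<-|[z Hz ->]]|[z [<-|Hz] ->]]; try by left.
- by exists x => //; left.
- by exists z => //; right.
- by right; exists z.
Qed.

Lemma closed_apps_q G n M x : typed G M (sg n) -> size x = n ->
  typed G (apps M (map q x)) Iota.
Proof.
move=> tM sx; apply: (typed_apps (ss := nseq n Iota)) => //.
apply/(Forall2_nseq (A := fun N => typed G N Iota)) => //.
rewrite size_map; split=> // N /In_map[v _ ->].
by apply: closed_typed; apply: closed_q.
Qed.

Fixpoint capps (P : ctx) (Ns : seq tm) : ctx :=
  if Ns is N :: Ns' then capps (CAppL P N) Ns' else P.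

Lemma plug_capps P Ns M : plug (capps P Ns) M = apps (plug P M) Ns.
Proof. by elim: Ns P => //= N Ns IH P; rewrite IH. Qed.

Lemma obs_le_beh n M N : closed_tm (sg n) M -> closed_tm (sg n) N ->
  obs_le M N <-> fle (beh n M) (beh n N).
Proof.
move=> tM tN; split=> [H x j [sx Hj]|H].
  split=> //; move: Hj; rewrite -!(plug_capps Hole).
  by apply: (obs_le_conv H); rewrite plug_capps; apply: closed_apps_q sx.
by apply: lrel_obs_le (tM) (tN) _; apply: context_lemma.
Qed.

Fixpoint ctx_comp (P Q : ctx) : ctx :=
  match P with
  | Hole => Q
  | CLam s P1 => CLam s (ctx_comp P1 Q)
  | CAppL P1 N => CAppL (ctx_comp P1 Q) N
  | CAppR N P1 => CAppR N (ctx_comp P1 Q)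
  end.

Lemma plug_comp P Q M : plug (ctx_comp P Q) M = plug P (plug Q M).
Proof. by elim: P => //= [s P ->|P -> N|N P ->]. Qed.

Lemma obs_le_plug Q M N : obs_le M N -> obs_le (plug Q M) (plug Q N).
Proof. by move=> H P n; rewrite -!plug_comp; apply: H. Qed.

Lemma obs_le_trans s M N K : closed_tm s M -> closed_tm s N ->
  obs_le M N -> obs_le N K -> obs_le M K.
Proof.
move=> tM tN MN NK P n tPM tPK HM.
have tPN : closed_tm Iota (plug P N).
  apply: plug_typed tPM => G t tM'.
  by rewrite -(typed_uniq (closed_typed G tM) tM'); apply: closed_typed.
by apply: NK => //; apply: MN.
Qed.

(** * Sequentiality *)

(** The subterm on which the next head step depends: a strict constant waits for its argument, so
    the search continues there. *)
Fixpoint hd (M : tm) : tm :=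
  match M with
  | App ((Succ | Pred | If)) N => hd N
  | App M N => hd M
  | _ => M
  end.

Lemma hstep_subst e M N : hstep M N -> hstep (subst e M) (subst e N).
Proof.
elim=> {M N} [M N r|M M' N _ IH|c M M' sc _ IH] /=.
- apply: h_redex; case: r => {M N} [u M N|u M|n|n|M N|n M N] /=;
    try by constructor.
  by rewrite subst_beta; constructor.
- exact: h_fun.
- have -> : subst e c = c by case: sc => [|[|]] ->.
  exact: h_arg.
Qed.

Lemma hd_App M N : hd (App M N) = if pselect (strict M) is left _ then hd N else hd M.
Proof.
by case: pselect => [[|[|]] -> //|]; case: M => //= nS; case: nS; rewrite /strict; auto.
Qed.

Definition normal (M : tm) : Prop := forall N, ~ hstep M N.

Lemma subst_Cst_inv e M n : (forall k, hd M = Var k -> dead (e k)) ->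
  subst e M = Cst n -> M = Cst n.
Proof.
by case: M => //= k /(_ k erefl) H E; rewrite E in H; inversion H.
Qed.

Lemma subst_strict_inv e M : (forall k, M = Var k -> dead (e k)) ->
  strict (subst e M) -> strict M.
Proof.
case: M => [k|n||||s|s|s M|M N] /= H; rewrite /strict; auto;
  last by case=> [|[|]].
all: try by case=> [|[|]].
by have := H k erefl; case=> [s|M N _]; case=> [|[|]].
Qed.

(* A head-normal term can only be unblocked by substituting for its head
   variable. *)
Lemma normal_subst e M : (forall k, hd M = Var k -> dead (e k)) ->
  normal M -> normal (subst e M).
Proof.
elim: M => [k|n||||s|s|s M _|M IHM N IHN] hdM nM K;
  try by move/hstep_atom.
  exact: dead_nstep (hdM k erefl).
case/hstep_App_inv => [r|[M' HM _]|[sM [N' HN _]]].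
- have red1 L : ~ redex (App M N) L by move=> r'; apply: (nM L); apply: h_redex.
  case: M {IHM} hdM nM r red1 => [k|n||||s|s|s M|M1 M2] /= hdM nM r red1;
    try by inversion r.
  + by apply: (dead_nstep _ (h_redex r)); apply/dead_App/hdM.
  + have [m /(subst_Cst_inv hdM) EN] : exists m, subst e N = Cst m.
      by inversion r; eexists; symmetry; eassumption.
    by rewrite EN in red1; apply: (red1 (Cst m.+1)); constructor.
  + have [m /(subst_Cst_inv hdM) EN] : exists m, subst e N = Cst m.+1.
      by inversion r; eexists; symmetry; eassumption.
    by rewrite EN in red1; apply: (red1 (Cst m)); constructor.
  + by apply: (red1 (App N (App (Y s) N))); constructor.
  + by apply: (red1 (subst (scons N Var) M)); constructor.
  + case: M1 hdM nM r red1 => [k|n||||s|s|s M|M3 M4] /= hdM nM r red1;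
      try by inversion r.
      by apply: (dead_nstep _ (h_redex r)); do 2 apply/dead_App; apply/hdM.
    case: M3 hdM nM r red1 => [k|n||||s|s|s M|M5 M6] /= hdM nM r red1;
      try by inversion r.
      by apply: (dead_nstep _ (h_redex r)); do 3 apply/dead_App; apply/hdM.
    have [m /(subst_Cst_inv hdM) EN] : exists m, subst e M4 = Cst m.
      by inversion r; eexists; symmetry; eassumption.
    by rewrite EN in red1; case: m {EN} red1 => [|m] red1;
      [apply: (red1 M2) | apply: (red1 N)]; constructor.
- apply: (IHM _ _ _ HM) => [k hM|L HL].
    apply: hdM; rewrite hd_App; case: pselect => // -[|[|]] E; subst M;
    by have := hstep_atom HM.
  by apply: (nM (App L N)); apply: h_fun.
- have sM' : strict M.
    by apply: subst_strict_inv sM => k E; apply: hdM; rewrite E.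
  apply: (IHN _ _ _ HN) => [k hN|L HL].
    by apply: hdM; rewrite hd_App; case: pselect.
  by apply: (nM (App M L)); apply: h_arg.
Qed.

(** Each head step of [M] is matched by one of [subst e M], and reduction is deterministic, so [M]
    cannot make more than [k] steps. *)
Lemma ev_subst_normal e k M j : ev k (subst e M) j ->
  exists i N, nsteps i M N /\ normal N.
Proof.
elim: k M => [|k IH] M H.
all: have [[N HN]|nN] := pselect (exists N, hstep M N); last first.
all: try by exists 0, M; split; [constructor | move=> N HN; apply: nN; exists N].
  have := hstep_subst e HN; have -> : subst e M = Cst j by inversion H.
  by move/hstep_atom.
have := hstep_subst e HN; inversion H; subst => /(hstep_det H1) E; subst.
by case: (IH _ H2) => i [L [HL nL]]; exists i.+1, L; split=> //; apply: nsS HN HL.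
Qed.

Lemma nsteps_subst e k M N : nsteps k M N -> nsteps k (subst e M) (subst e N).
Proof.
elim=> [L|{}k A B C H _ IH]; first by constructor.
by apply: nsS IH; apply: hstep_subst.
Qed.

Definition levec (x y : seq (option nat)) : Prop :=
  size x = size y /\ forall k j, nth None x k = Some j -> nth None y k = Some j.

(* Run [M] on the known entries of [x] and on free variables for the unknown
   ones: if this gets stuck on [Var k], the entry [k] is needed.  An index
   [k >= n] tells that no vector above [x] gives a value. *)
Lemma beh_sequential n M x : closed_tm (sg n) M -> size x = n ->
  (exists j, beh n M x j) \/
  exists k, nth None x k = None /\
    forall y j, levec x y -> beh n M y j -> nth None y k <> None.
Proof.
move=> tM sx.
pose T := apps M [seq if nth None x k is Some v then Cst v else Var k | k <- iota 0 n].
(* The variables of known entries do not occur in [T]. Sending them to [Omega] avoids tracking this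
   along the reduction: such a head variable would simply be dead. *)
pose e y k := if nth None x k is Some _ then Omega Iota else q (nth None y k).
have ET y : levec x y -> subst (e y) T = apps M (map q y).
  case=> sy H; rewrite subst_apps (subst_closed _ tM); congr apps.
  apply: (@eq_from_nth _ (Cst 0)); rewrite !size_map size_iota -?sy ?sx // => k lk.
  rewrite -map_comp (nth_map 0) ?size_iota // nth_iota // (nth_map None) -?sy ?sx //=.
  case E: (nth None x k) => [v|]; first by rewrite (H _ _ E).
  by rewrite /= /e E.
have le_refl : levec x x by [].
have none : (forall y j, levec x y -> ~ beh n M y j) ->
    exists k, nth None x k = None /\
    forall y j, levec x y -> beh n M y j -> nth None y k <> None.
  by move=> H; exists n; split=> [|y j lxy /(H _ _ lxy) //]; rewrite nth_default ?sx.
have [[i [N [HN nN]]]|np] := pselect (exists i N, nsteps i T N /\ normal N); last first.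
  right; apply: none => y j lxy [_]; rewrite -(ET _ lxy) => -[k].
  by move/ev_subst_normal => H; case: np; move: H => [i [N H]]; exists i, N.
have HC y j : levec x y -> beh n M y j -> conv (subst (e y) N) j.
  by move=> lxy [_]; rewrite -(ET _ lxy) => /(nsteps_conv _ (nsteps_subst _ HN)).
have nconv y j : levec x y -> conv (subst (e y) N) j ->
    (forall k, hd N = Var k -> dead (e y k)) -> N = Cst j.
  move=> lxy [[|l] Hl] hdN.
    by apply: subst_Cst_inv hdN _; inversion Hl.
  have [K HK] : exists K, hstep (subst (e y) N) K by inversion Hl; eexists; eassumption.
  by case: (normal_subst hdN nN HK).
have [[j EN]|nC] := pselect (exists j, N = Cst j).
  left; exists j; split=> //; rewrite -(ET x le_refl).
  by apply/(nsteps_conv _ (nsteps_subst _ HN)); rewrite EN; apply/conv_Cst.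
right; have [[k [hk xk]]|nk] := pselect (exists k, hd N = Var k /\ nth None x k = None).
  exists k; split=> // y j lxy /(HC _ _ lxy) Hj yk; apply: nC; exists j.
  apply: nconv lxy Hj _ => k'; rewrite hk => -[<-].
  by rewrite /e xk yk; constructor.
apply: none => y j lxy /(HC _ _ lxy) Hj; apply: nC; exists j.
apply: nconv lxy Hj _ => k hk; rewrite /e.
by case E: (nth None x k) => [v|]; [constructor | case: nk; exists k].
Qed.

Lemma conv_apps_mono n M As Bs j : closed_tm (sg n) M ->
  size As = n -> size Bs = n ->
  (forall i, i < n -> forall m, conv (nth (Cst 0) As i) m -> conv (nth (Cst 0) Bs i) m) ->
  conv (apps M As) j -> conv (apps M Bs) j.
Proof.
move=> tM sA sB H [k Hk].
have := fundamental tM (@env_rel_nil k Var Var).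
rewrite (subst_closed _ tM) => /lrel_sg HM.
apply: (HM k As Bs) Hk => // i li a m _ Ha.
by apply: H => //; exists a.
Qed.

Lemma conv_q v j : conv (q v) j <-> v = Some j.
Proof.
case: v => [m|] /=; last by split=> [/not_conv_Omega|].
by rewrite conv_Cst; split=> [->|[]].
Qed.

Lemma levec_trans y x z : levec x y -> levec y z -> levec x z.
Proof. by move=> [s H] [s' H']; split=> [|k j /H /H' //]; rewrite s. Qed.

Lemma levec_anti x y : levec x y -> levec y x -> x = y.
Proof.
move=> [s H] [_ H']; apply: (@eq_from_nth _ None _ _ s) => k _.
case E: (nth None x k) => [j|]; first by rewrite (H _ _ E).
by case E': (nth None y k) => [j|] //; rewrite -E (H' _ _ E').
Qed.

Lemma levec_cons u v x y : levec (u :: x) (v :: y) <->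
  (forall j, u = Some j -> v = Some j) /\ levec x y.
Proof.
split=> [[[s] H]|[Huv [s H]]].
  by split; [exact: (H 0) | split=> // k; apply: (H k.+1)].
by split=> [|[|k]] /=; [rewrite s | exact: Huv | exact: H].
Qed.

Lemma beh_mono n M x y j : closed_tm (sg n) M ->
  levec x y -> beh n M x j -> beh n M y j.
Proof.
move=> tM [s H] [sx Hj]; split; first by rewrite -s.
apply: conv_apps_mono tM _ _ _ Hj; rewrite ?size_map -?s // => i li m.
by rewrite !(nth_map None) -?s ?sx // !conv_q; apply: H.
Qed.

Lemma beh_fun n M x j j' : beh n M x j -> beh n M x j' -> j = j'.
Proof. by move=> [_ H] [_]; apply: conv_fun H. Qed.

(** * Finite projections *)

Lemma subst_tcase e M Ns : subst e (tcase M Ns) = tcase (subst e M) (map (subst e) Ns).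
Proof. by elim: Ns M => //= N Ns IH M; rewrite IH. Qed.

Lemma typed_tcase G M Ns : typed G M Iota ->
  (forall N, List.In N Ns -> typed G N Iota) -> typed G (tcase M Ns) Iota.
Proof.
elim: Ns M => [|N Ns IH] M tM H /=; first by constructor.
apply: ty_app (ty_app (ty_app (ty_if _) tM) _) _.
- by apply: H; left.
- apply: IH => [|K HK]; last by apply: H; right.
  by apply: ty_app (ty_pred _) tM.
Qed.

Lemma conv_tcase M Ns j : conv (tcase M Ns) j <->
  exists2 v, v < size Ns & conv M v /\ conv (nth (Omega Iota) Ns v) j.
Proof.
elim: Ns M => [|N Ns IH] M /=.
  by split=> [/not_conv_Omega|[]].
rewrite conv_tif; split.
  case=> [[HM HN]|[m HM /IH[v lv [/conv_Pred Hv HN]]]]; first by exists 0.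
  by exists v.+1.
case=> -[|v] lv [HM HN]; first by left.
by right; exists v => //; apply/IH; exists v => //; split=> //; apply/conv_Pred.
Qed.

Lemma FP_typed G s i : typed G (FP s i) (Arr s s).
Proof.
elim: s G => [|s IHs t IHt] G.
  apply: ty_lam; apply: typed_tcase; first by constructor.
  by move=> N /In_map[k _ ->]; constructor.
do 2 constructor.
apply: ty_app (IHt _) _; apply: (@ty_app _ s); first by constructor.
by apply: ty_app (IHs _) _; constructor.
Qed.

Lemma subst_FP e s i : subst e (FP s i) = FP s i.
Proof. exact: (subst_closed _ (FP_typed _ _ _)). Qed.

Lemma hstep_apps M N Ks : hstep M N -> hstep (apps M Ks) (apps N Ks).
Proof. by elim: Ks M N => //= K Ks IH M N H; apply: IH; apply: h_fun. Qed.

Lemma conv_FP_iota i T j : conv (App (FP Iota i) T) j <-> j <= i /\ conv T j.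
Proof.
rewrite (conv_step _ (h_redex (r_beta _ _ _))) subst_tcase conv_tcase.
rewrite -map_comp size_map size_iota.
have E v : v < i.+1 ->
    nth (Omega Iota) [seq (subst (scons T Var) \o Cst) k | k <- iota 0 i.+1] v = Cst v.
  by move=> lv; rewrite (nth_map 0) ?size_iota // nth_iota.
split=> [[v lv [Hv]]|[lj Hj]]; first by rewrite E // conv_Cst => <-.
by exists j => //; rewrite E // conv_Cst.
Qed.

Lemma conv_FP_arr s t i M N Ks j :
  conv (apps (App (App (FP (Arr s t) i) M) N) Ks) j <->
  conv (apps (App (FP t i) (App M (App (FP s i) N))) Ks) j.
Proof.
rewrite (conv_step _ (hstep_apps _ (h_fun _ (h_redex (r_beta _ _ _))))) /=.
rewrite (conv_step _ (hstep_apps _ (h_redex (r_beta _ _ _)))) /=.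
rewrite !subst_FP subst_rename.
by have -> : scons N Var \o S = Var by []; rewrite subst_Var.
Qed.

Lemma conv_FP n i M Ns j : size Ns = n ->
  conv (apps (App (FP (sg n) i) M) Ns) j <->
  j <= i /\ conv (apps M (map (App (FP Iota i)) Ns)) j.
Proof.
elim: n M Ns => [|n IH] M [|N Ns] //; first by move=> _; apply: conv_FP_iota.
move=> [sN].
apply: (iff_trans (conv_FP_arr Iota (sg n) i M N Ns j)).
exact: (IH (App M (App (FP Iota i) N)) Ns sN).
Qed.

Definition trunc i (x : seq (option nat)) : seq (option nat) :=
  [seq if v is Some m then if m <= i then Some m else None else None | v <- x].

Lemma size_trunc i x : size (trunc i x) = size x.
Proof. exact: size_map. Qed.

Lemma nth_trunc i x k j :
  nth None (trunc i x) k = Some j <-> nth None x k = Some j /\ j <= i.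
Proof.
have [lk|lk] := ltnP k (size x); last by rewrite !nth_default ?size_trunc //; split=> [|[]].
rewrite (nth_map None) //; case: (nth None x k) => [m|]; last by split=> [|[]].
by case: ifP => lm; split=> [|[]] // [<-]; rewrite ?lm.
Qed.

Lemma trunc_le i x : levec (trunc i x) x.
Proof. by split=> [|k j /nth_trunc[]//]; rewrite size_trunc. Qed.

Lemma trunc_le_trunc i j x : i <= j -> levec (trunc i x) (trunc j x).
Proof.
move=> lij; split=> [|k m /nth_trunc[H lm]]; first by rewrite !size_trunc.
by apply/nth_trunc; split=> //; apply: leq_trans lij.
Qed.

Lemma trunc_mono i x y : levec x y -> levec (trunc i x) (trunc i y).
Proof.
move=> [s H]; split=> [|k m /nth_trunc[/H Hk lm]]; first by rewrite !size_trunc.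
by apply/nth_trunc.
Qed.

Lemma trunc_trunc i j x : trunc i (trunc j x) = trunc (minn i j) x.
Proof.
rewrite /trunc -map_comp; apply: eq_map => -[m|] //=; rewrite leq_min.
by case: (m <= j); rewrite ?andbT ?andbF.
Qed.

Lemma trunc_large x : exists i, forall j, i <= j -> trunc j x = x.
Proof.
elim: x => [|v x [i IH]]; first by exists 0.
exists (maxn i (odflt 0 v)) => j; rewrite geq_max => /andP[/IH /= -> lv].
by case: v lv => [m|] //= ->.
Qed.

Lemma nth_map_q x k : k < size x -> nth (Cst 0) (map q x) k = q (nth None x k).
Proof. exact: nth_map. Qed.

Lemma beh_FP n i M x j : closed_tm (sg n) M ->
  beh n (App (FP (sg n) i) M) x j <-> j <= i /\ beh n M (trunc i x) j.
Proof.
move=> tM.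
have E k m : k < size x ->
    conv (nth (Cst 0) (map (App (FP Iota i)) (map q x)) k) m <->
    conv (nth (Cst 0) (map q (trunc i x)) k) m.
  move=> lk; rewrite nth_map_q ?size_trunc // (nth_map (Cst 0)) ?size_map //.
  by rewrite nth_map_q // conv_FP_iota !conv_q nth_trunc and_comm.
rewrite /beh size_trunc; split=> [[sx]|[lj [sx Hj]]].
  rewrite conv_FP ?size_map // => -[lj Hj]; split=> //; split=> //.
  apply: conv_apps_mono tM _ _ _ Hj; rewrite ?size_map // => k lk m.
  by rewrite E ?sx.
split=> //; rewrite conv_FP ?size_map //; split=> //.
apply: conv_apps_mono tM _ _ _ Hj; rewrite ?size_map // => k lk m.
by rewrite E ?sx.
Qed.

(** * Sequential functions *)

(* A partial function of [n] arguments in the flat domain of naturals.  The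
   last clause also covers functions that are undefined everywhere above [x]:
   the index [k] may be [n], as [nth] is [None] there. *)
Record seqfun (n : nat) (F : pfun) : Prop := Seqfun {
  sf_size : forall x j, F x j -> size x = n;
  sf_fun : forall x j j', F x j -> F x j' -> j = j';
  sf_mono : forall x y j, levec x y -> F x j -> F y j;
  sf_seq : forall x, size x = n -> (exists j, F x j) \/
    exists k, nth None x k = None /\
      forall y j, levec x y -> F y j -> nth None y k <> None }.

Lemma beh_seqfun n M : closed_tm (sg n) M -> seqfun n (beh n M).
Proof.
move=> tM; split.
- by move=> x j [].
- by move=> x j j'; apply: beh_fun.
- by move=> x y j; apply: beh_mono.
- by move=> x; apply: beh_sequential.
Qed.

Lemma fle_anti F G : fle F G -> fle G F -> F = G.
Proof. by move=> H H'; do 2 (apply/funext => ?); apply/propext; split; auto. Qed.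

Definition meetv (x y : seq (option nat)) : seq (option nat) :=
  [seq if p.1 == p.2 then p.1 else None | p <- zip x y].

Lemma size_meetv x y : size x = size y -> size (meetv x y) = size x.
Proof. by move=> s; rewrite size_map size1_zip // s. Qed.

Lemma nth_meetv x y k j : size x = size y ->
  nth None (meetv x y) k = Some j <-> nth None x k = Some j /\ nth None y k = Some j.
Proof.
move=> s; have [lk|lk] := ltnP k (size x); last first.
  by rewrite !nth_default ?size_meetv -?s //; split=> // -[].
rewrite (nth_map (None, None)) ?size1_zip -?s // nth_zip //=.
by case: eqP => [->|ne]; split=> [|[]] // E E'; case: ne; rewrite E.
Qed.

Lemma meetv_lel x y : size x = size y -> levec (meetv x y) x.
Proof. by move=> s; split=> [|k j /(nth_meetv _ _ s)[]//]; rewrite size_meetv. Qed.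

Lemma meetv_ler x y : size x = size y -> levec (meetv x y) y.
Proof. by move=> s; split=> [|k j /(nth_meetv _ _ s)[]//]; rewrite size_meetv. Qed.

Section Seqfun.
Variables (n : nat) (F : pfun).
Hypothesis sF : seqfun n F.

(** Sequential functions are stable. If [F] were undefined at the meet, the entry needed there would
    be present in [x] and in [y]. Both entries agree because [w] is a common upper bound, so the
    meet would have the entry too. *)
Lemma sf_stable x y w j j' : levec x w -> levec y w -> F x j -> F y j' ->
  F (meetv x y) j.
Proof.
move=> [s H] [s' H'] Fx Fy; have sxy : size x = size y by rewrite s s'.
have sm : size (meetv x y) = n by rewrite size_meetv // (sf_size sF Fx).
case: (sf_seq sF sm) => [[i Fm]|[k [mk Hk]]].
  by rewrite (sf_fun sF Fx (sf_mono sF (meetv_lel sxy) Fm)).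
have := Hk _ _ (meetv_lel sxy) Fx; have := Hk _ _ (meetv_ler sxy) Fy.
case Ey: (nth None y k) => [b|] // _; case Ex: (nth None x k) => [a|] // _.
have E : a = b by have := H' _ _ Ey; rewrite (H _ _ Ex) => -[].
have : nth None (meetv x y) k = Some a by apply/nth_meetv; rewrite // Ex Ey E.
by rewrite mk.
Qed.

(* The tokens of the trace of [F]: its minimal points. *)
Definition tr (F : pfun) x j : Prop :=
  F x j /\ forall z, levec z x -> F z j -> z = x.

Lemma count_levec x y : levec x y -> count isSome x <= count isSome y /\
  (count isSome x = count isSome y -> x = y).
Proof.
elim: x y => [|u x IH] [|v y]; try by case.
move=> /levec_cons[Huv /IH[le eqc]] /=; split.
  by case: u Huv => [j|] Huv /=; rewrite ?(Huv j) //=; lia.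
case: u Huv => [j /(_ _ erefl) ->|_] /=; first by move=> [/eqc ->].
case: v => [j|] /= E; last by rewrite eqc.
by exfalso; move: E le; lia.
Qed.

Lemma tr_below x j : F x j -> exists2 z, levec z x & tr F z j.
Proof.
have [m] := ubnP (count isSome x); elim: m x => // m IH x lm Fx.
have [H|/existsNP[z /not_implyP[lz /not_implyP[Fz ne]]]] :=
  pselect (forall z, levec z x -> F z j -> z = x); first by exists x.
have [lc ec] := count_levec lz.
have [|w lw tw] := IH z _ Fz; first by rewrite ltnS in lm; apply: leq_trans (lm); rewrite ltn_neqAle lc andbT; apply/eqP => /ec.
by exists w => //; apply: levec_trans lz.
Qed.

(** By stability [F] is already defined at the meet of [x] and [y], and both are minimal. Hence at
    most one token lies below any given [w]. *)
Lemma tr_least x y w j j' : levec x w -> levec y w -> tr F x j -> tr F y j' -> x = y.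
Proof.
move=> lx ly [Fx mx] [Fy my].
have Em : j = j' by apply: (sf_fun sF) (sf_mono sF lx Fx) (sf_mono sF ly Fy).
have sxy : size x = size y by case: lx ly => [-> _] [-> _].
have Fm := sf_stable lx ly Fx Fy.
rewrite -(mx _ (meetv_lel sxy) Fm); apply: my (meetv_ler sxy) _.
by rewrite -Em.
Qed.

End Seqfun.

(** Berry's order for uncurried functions; [st_ap] identifies it with [st]. *)
Definition sst (F G : pfun) : Prop := fle F G /\
  forall x y j, levec x y -> F y j -> G x j -> F x j.

Lemma sst_refl F : sst F F.
Proof. by split. Qed.

Lemma sst_trans G F H : sst F G -> sst G H -> sst F H.
Proof.
move=> [FG sFG] [GH sGH]; split=> [x j /FG /GH //|x y j lxy Fy Hx].
by apply: (sFG x y) => //; apply: (sGH x y) => //; apply: FG.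
Qed.

(** From right to left, the token of [F] below [y] and the token of [G] below [x] are both tokens of
    [G] below [y], so they coincide. *)
Lemma sst_tr n F G : seqfun n F -> seqfun n G ->
  sst F G <-> fle (tr F) (tr G).
Proof.
move=> sF sG; split=> [[FG sFG] x j [Fx mx]|H].
  split=> [|z lz Gz]; first exact: FG.
  by apply: mx => //; apply: (sFG z x).
split=> [x j /(tr_below (F := F))[z lz /H[Gz _]]|x y j lxy].
  exact: (sf_mono sG lz Gz).
move=> /(tr_below (F := F))[z lz tz] /(tr_below (F := G))[w lw tw].
have E : w = z by apply: (tr_least sG (levec_trans lw lxy) lz tw (H _ _ tz)).
by rewrite E in lw; case: tz => Fz _; apply: (sf_mono sF lw Fz).
Qed.

Lemma sf_never n (F : pfun) x : size x = n -> (forall y j, levec x y -> ~ F y j) ->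
  exists k, nth None x k = None /\
    forall y j, levec x y -> F y j -> nth None y k <> None.
Proof.
by move=> sx H; exists n; split=> [|y j lxy /(H _ _ lxy)//]; rewrite nth_default ?sx.
Qed.

(* Every part of the trace of a sequential function is the trace of a
   sequential function: in a decision tree for [F], replace the unwanted leaves
   by [Omega]. *)
Definition restrict (F P : pfun) : pfun :=
  fun x j => exists z, [/\ levec z x, tr F z j & P z j].

Lemma restrict_seqfun n F P : seqfun n F -> seqfun n (restrict F P).
Proof.
move=> sF; split.
- by move=> x j [z [[<- _] [Fz _] _]]; apply: (sf_size sF Fz).
- move=> x j j' [z [lz [Fz _] _]] [w [lw [Fw _] _]].
  by apply: (sf_fun sF); [apply: (sf_mono sF lz Fz) | apply: (sf_mono sF lw Fw)].
- move=> x y j lxy [z [lz tz Pz]]; exists z; split=> //.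
  exact: levec_trans lxy.
- move=> x sx; case: (sf_seq sF sx) => [[j /(tr_below (F := F))[z lz tz]]|[k [xk Hk]]].
    have [Pz|nP] := pselect (P z j); first by left; exists j, z.
    (* The unwanted token [z] is also the only token of [F] below any [y] above [x], so the
       restriction stays undefined there. *)
    right; apply: sf_never sx _ => y j' lxy [w [lw tw Pw]]; apply: nP.
    have E := tr_least sF (levec_trans lz lxy) lw tz tw; subst w.
    by rewrite (sf_fun sF (proj1 tz) (proj1 tw)).
  right; exists k; split=> // y j lxy [z [lz [Fz _] _]].
  by apply: (Hk y j lxy); apply: (sf_mono sF lz Fz).
Qed.

Lemma tr_restrict F P x j : tr (restrict F P) x j <-> tr F x j /\ P x j.
Proof.
split=> [[[z [lz tz Pz]] mx]|[tx Px]].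
  by have <- : z = x by apply: mx => //; exists z.
split; first by exists x.
move=> z lz [w [lw [Fw _] _]]; case: tx => Fx mx.
have E : w = x by apply: mx => //; apply: levec_trans lz.
by apply: levec_anti => //; rewrite -E.
Qed.

Definition meetf (F G : pfun) : pfun := fun x j => F x j /\ G x j.

Lemma meetf_seqfun n F G : seqfun n F -> seqfun n G -> seqfun n (meetf F G).
Proof.
move=> sF sG; split.
- by move=> x j [Fx _]; apply: (sf_size sF Fx).
- by move=> x j j' [Fx _] [Fx' _]; apply: (sf_fun sF Fx Fx').
- by move=> x y j lxy [Fx Gx]; split; [apply: (sf_mono sF lxy Fx) | apply: (sf_mono sG lxy Gx)].
- move=> x sx; case: (sf_seq sF sx) => [[j Fx]|[k [xk Hk]]]; last first.
    by right; exists k; split=> // y j lxy [Fy _]; apply: Hk lxy Fy.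
  case: (sf_seq sG sx) => [[j' Gx]|[k [xk Hk]]]; last first.
    by right; exists k; split=> // y i lxy [_ Gy]; apply: Hk lxy Gy.
  have [E|ne] := eqVneq j j'; first by left; exists j; split=> //; rewrite E.
  right; apply: sf_never sx _ => y i lxy [Fy Gy]; case/eqP: ne.
  rewrite (sf_fun sF (sf_mono sF lxy Fx) Fy).
  exact: (sf_fun sG Gy (sf_mono sG lxy Gx)).
Qed.

(** What the finite projection does to a behaviour, see [beh_FP_truncf]. *)
Definition truncf i (F : pfun) : pfun := fun x j => j <= i /\ F (trunc i x) j.

Lemma truncf_le n i F : seqfun n F -> fle (truncf i F) F.
Proof. by move=> sF x j [_ Fx]; apply: (sf_mono sF (trunc_le i x) Fx). Qed.

Lemma truncf_seqfun n i F : seqfun n F -> seqfun n (truncf i F).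
Proof.
move=> sF; split.
- by move=> x j [_ /(sf_size sF)]; rewrite size_trunc.
- by move=> x j j' [_ Fx] [_ Fx']; apply: (sf_fun sF Fx Fx').
- by move=> x y j lxy [lj Fx]; split=> //; apply: (sf_mono sF (trunc_mono i lxy) Fx).
- move=> x sx; have sT : size (trunc i x) = n by rewrite size_trunc.
  case: (sf_seq sF sT) => [[j Fx]|[k [xk Hk]]].
    have [lj|lj] := leqP j i; first by left; exists j.
    right; apply: sf_never sx _ => y j' lxy [lj' Fy].
    by move: lj; rewrite (sf_fun sF (sf_mono sF (trunc_mono i lxy) Fx) Fy) ltnNge lj'.
  case E: (nth None x k) => [m|]; last first.
    right; exists k; split=> // y j lxy [_ Fy] yk.
    apply: (Hk _ _ (trunc_mono i lxy) Fy).
    by case E': (nth None _ k) => [m|] //; case/nth_trunc: E'; rewrite yk.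
  (* The needed entry is present in [x] but exceeds [i], so truncation erases it from every vector
     above [x]. *)
  right; apply: sf_never sx _ => y j lxy [_ Fy].
  apply: (Hk _ _ (trunc_mono i lxy) Fy).
  case E': (nth None _ k) => [m'|] //; case/nth_trunc: E' => yk lm'.
  case: lxy => _ /(_ k m E); rewrite yk => -[Em]; subst m'.
  by have /nth_trunc := conj E lm'; rewrite xk.
Qed.

Lemma truncf_ub n F x j : seqfun n F -> F x j ->
  exists i, forall i', i <= i' -> truncf i' F x j.
Proof.
move=> sF Fx; have [i Hi] := trunc_large x.
exists (maxn i j) => i'; rewrite geq_max => /andP[li lj].
by split=> //; rewrite Hi.
Qed.

Lemma truncf_truncf i j F : truncf i (truncf j F) = truncf (minn i j) F.
Proof.
apply: fle_anti => x m; rewrite /truncf leq_min trunc_trunc [minn j i]minnC.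
  by move=> [li [lj Fx]]; rewrite li lj.
by move=> [/andP[li lj] Fx].
Qed.

(* If [x <= y] then [trunc i x] is the meet of [trunc i y] and [trunc j x], so
   stability of [F] applies. *)
Lemma truncf_sst n i j F G : i <= j -> seqfun n F -> sst F G ->
  sst (truncf i F) (truncf j G).
Proof.
move=> lij sF [FG sFG]; split=> [x m [lm Fx]|x y m lxy [lm Fy] [lm' Gx]].
  split; [exact: leq_trans lij | apply: FG].
  exact: (sf_mono sF (trunc_le_trunc x lij) Fx).
split=> //.
have lTx : levec (trunc j x) y by apply: levec_trans (trunc_le j x) lxy.
have Fjx : F (trunc j x) m.
  by apply: sFG lTx _ Gx; apply: (sf_mono sF (trunc_le i y) Fy).
apply: (sf_mono sF _ (sf_stable sF (trunc_le i y) lTx Fy Fjx)).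
have s : size (trunc i y) = size (trunc j x) by rewrite !size_trunc; case: lxy.
split=> [|k a /(nth_meetv _ _ s)[/nth_trunc[_ la] /nth_trunc[xk _]]].
  by rewrite size_meetv // s !size_trunc.
exact/nth_trunc.
Qed.

Definition stepf z j : pfun := fun x j' => levec z x /\ j' = j.

Lemma stepf_seqfun z j : seqfun (size z) (stepf z j).
Proof.
split.
- by move=> x j' [[-> _] _].
- by move=> x j1 j2 [_ ->] [_ ->].
- by move=> x y j' lxy [lz ->]; split=> //; apply: levec_trans lxy.
- move=> x sx; have [lz|nl] := pselect (levec z x); first by left; exists j.
  have /existsNP[k /existsNP[m /not_implyP[zk xk]]] :
      ~ forall k m, nth None z k = Some m -> nth None x k = Some m.
    by move=> H; apply: nl.
  right; case E: (nth None x k) => [m'|]; last first.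
    by exists k; split=> // y j' _ [[_ Hz] _]; rewrite (Hz _ _ zk).
  apply: sf_never sx _ => y j' [_ Hx] [[_ Hz] _]; apply: xk.
  by rewrite E -(Hx _ _ E) (Hz _ _ zk).
Qed.

(** Splits off the first argument and thereby reproduces the two clauses of [st] at an arrow
    type. *)
Lemma sst_cons n F G : seqfun n.+1 F -> seqfun n.+1 G -> sst F G <->
  forall u v, (forall j, u = Some j -> v = Some j) ->
    sst (fun x => F (u :: x)) (fun x => G (u :: x)) /\
    forall x j, F (u :: x) j <-> F (v :: x) j /\ G (u :: x) j.
Proof.
move=> sF sG; split=> [[FG sFG] u v luv|H].
  split; first split.
  - by move=> x j; apply: FG.
  - by move=> x y j lxy; apply: sFG; apply/levec_cons.
  - move=> x j; have lux : levec (u :: x) (v :: x) by apply/levec_cons.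
    split=> [Fx|[Fv Gu]]; last exact: sFG lux Fv Gu.
    by split; [apply: (sf_mono sF lux Fx) | apply: FG].
split=> [[|u x] j Fx|[|u x] [|v y] j lxy Fy Gx].
- by have := sf_size sF Fx.
- by case: (H u u (fun _ => id)) => -[+ _] _; apply.
- by have := sf_size sG Gx.
- by have := sf_size sG Gx.
- by have := sf_size sF Fy.
- move/levec_cons: lxy => [luv lxy]; have [[_ sH] eH] := H u v luv.
  apply: (sH x y) => //; apply/eH; split=> //.
  by apply: (sf_mono sG _ Gx); apply/levec_cons.
Qed.

(** * Game terms *)

Definition extend (Ns : seq tm) (e : nat -> tm) : nat -> tm :=
  foldl (fun e N => scons N e) e Ns.

Lemma extend_shift Ns e m : extend Ns e (size Ns + m) = e m.
Proof.
elim: Ns e m => //= N Ns IH e m.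
by rewrite -/(extend _ _) addSnnS IH.
Qed.

(** The last argument belongs to the innermost binder, so argument [k] of [n] has De Bruijn index
    [n - k.+1]. The trees and guards below use the same indexing. *)
Lemma extend_nth Ns e k : k < size Ns ->
  extend Ns e (size Ns - k.+1) = nth (Cst 0) Ns k.
Proof.
elim: Ns e k => //= N Ns IH e [|k] lk; last exact: IH.
by rewrite subn1 /= -/(extend _ _) -[X in extend _ _ X]addn0 extend_shift.
Qed.

Lemma conv_lams e B ss Ns j : size Ns = size ss ->
  conv (apps (subst e (foldr Lam B ss)) Ns) j <-> conv (subst (extend Ns e) B) j.
Proof.
elim: ss Ns e => [|s ss IH] [|N Ns] //= e [sN].
rewrite (conv_step _ (hstep_apps _ (h_redex (r_beta _ _ _)))) -/(up_sub e).
by rewrite subst_scons_up; apply: IH.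
Qed.

(** The generated induction principle gives no hypotheses for the game terms inside the lists. *)
Section GtmInd.
Variable P : gtm -> Prop.
Hypothesis P_omega : forall s, P (GOmega s).
Hypothesis P_num : forall ss m, P (GNum ss m).
Hypothesis P_case : forall ss y Ms Ns,
  (forall M, List.In M Ms -> P M) -> (forall N, List.In N Ns -> P N) ->
  P (GCase ss y Ms Ns).

Fixpoint gtm_nested_ind (g : gtm) : P g :=
  let fix all_P (Ms : seq gtm) : forall M, List.In M Ms -> P M :=
    match Ms with
    | [::] => fun M (H : False) => match H with end
    | M0 :: Ms' => fun M H => match H with
        | or_introl E => eq_ind M0 P (gtm_nested_ind M0) M E
        | or_intror H' => all_P Ms' M H'
        end
    end in
  match g with
  | GOmega s => P_omega s
  | GNum ss m => P_num ss m
  | GCase ss y Ms Ns => P_case ss y (all_P Ms) (all_P Ns)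
  end.

End GtmInd.

Lemma typed_lams G ss B t : typed (catrev ss G) B t ->
  typed G (foldr Lam B ss) (foldr Arr t ss).
Proof. by elim: ss G => //= s ss IH G tB; constructor; apply: IH. Qed.

Lemma game_typed_tm G g s : game_typed G g s -> typed G (tm_of_game g) s.
Proof.
elim/gtm_nested_ind: g G s => [s|ss m|ss y Ms Ns IHM IHN] G t H; inversion H; subst.
- by constructor.
- by apply: typed_lams; constructor.
- apply: typed_lams; apply: typed_tcase.
    apply: (typed_apps (ss := us)); first by constructor.
    elim: H7 IHM => {H H5 Ms us} [|M u Ms us tM _ IH] IHM; constructor.
      by apply: IHM; first left.
    by apply: IH => N HN; apply: IHM; right.
  move=> N /In_map[g Hg ->]; apply: IHN => //.
  by move/List.Forall_forall: H9; apply.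
Qed.

Lemma Forall2_refl T (R : T -> T -> Prop) s :
  (forall x, List.In x s -> R x x) -> List.Forall2 R s s.
Proof.
elim: s => [|x s IH] H; constructor; first by apply: H; left.
by apply: IH => y Hy; apply: H; right.
Qed.

Lemma Forall2_map T U (R : T -> T -> Prop) (S : U -> U -> Prop) (f : T -> U) s s' :
  List.Forall2 R s s' -> (forall x y, List.In x s -> R x y -> S (f x) (f y)) ->
  List.Forall2 S (map f s) (map f s').
Proof.
elim=> [|x y {}s {}s' Rxy _ IH] H /=; constructor; first by apply: H => //; left.
by apply: IH => z w Hz; apply: H; right.
Qed.

Lemma Forall2_trans T (R : T -> T -> Prop) s1 s2 s3 :
  (forall x y z, List.In x s1 -> R x y -> R y z -> R x z) ->
  List.Forall2 R s1 s2 -> List.Forall2 R s2 s3 -> List.Forall2 R s1 s3.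
Proof.
move=> H H12; elim: H12 s3 H => [|x y {}s1 {}s2 Rxy _ IH] s3 H H23;
  inversion H23; subst; constructor.
  by apply: H Rxy _ => //; left.
by apply: IH => // a b c Ha; apply: H; right.
Qed.

Lemma syn_le_refl g : syn_le g g.
Proof.
elim/gtm_nested_ind: g => [s|ss m|ss y Ms Ns IHM IHN]; try by constructor.
by rewrite -[Ns in X in syn_le _ X]cats0; constructor; apply: Forall2_refl.
Qed.

Lemma syn_le_trans g2 g1 g3 : syn_le g1 g2 -> syn_le g2 g3 -> syn_le g1 g3.
Proof.
elim/gtm_nested_ind: g1 g2 g3 => [s|ss m|ss y Ms Ns IHM IHN] g2 g3 H12 H23.
- by constructor.
- by inversion H12; subst.
- inversion H12; subst; inversion H23; subst.
  have [A [B [NA [_ ->]]]] := List.Forall2_app_inv_l _ _ H7.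
  rewrite -catA; constructor.
    by apply: Forall2_trans H4 H6 => a b c Ha; apply: IHM.
  by apply: Forall2_trans H5 NA => a b c Ha; apply: IHN.
Qed.

(** * Syntactic approximation of terms *)

(** An untyped image of [syn_le] on terms. It is a simulation for head reduction, so a syntactically
    larger game term has at least the same values. *)
Inductive apx : tm -> tm -> Prop :=
| apx_Omega s N : apx (Omega s) N
| apx_refl M : apx M M
| apx_Lam s M N : apx M N -> apx (Lam s M) (Lam s N)
| apx_App M N K L : apx M N -> apx K L -> apx (App M K) (App N L).

Lemma apx_rename r M N : apx M N -> apx (rename r M) (rename r N).
Proof. by move=> H; elim: H r => *; constructor; auto. Qed.

Lemma apx_subst e e' M N : (forall k, apx (e k) (e' k)) -> apx M N ->
  apx (subst e M) (subst e' N).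
Proof.
have up f f' : (forall k, apx (f k) (f' k)) -> forall k, apx (up_sub f k) (up_sub f' k).
  by move=> H [|k]; [apply: apx_refl | apply: apx_rename].
move=> He H; elim: H e e' He => {M N} [s N|M|s M N _ IH|M N K L _ IH _ IH'] e e' He.
- by constructor.
- elim: M e e' He => [k|n||||s|s|s M IH|M IHM K IHK] e e' He /=; try by constructor.
  + exact: He.
  + by constructor; apply: IH; apply: up.
  + by constructor; [apply: IHM | apply: IHK].
- by constructor; apply: IH; apply: up.
- by constructor; [apply: IH | apply: IH'].
Qed.

Lemma apx_inv M N : apx M N ->
  match M with
  | Omega _ => True
  | Lam s M1 => exists2 M2, N = Lam s M2 & apx M1 M2
  | App M1 K1 => exists M2 K2, [/\ N = App M2 K2, apx M1 M2 & apx K1 K2]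
  | _ => N = M
  end.
Proof.
case=> {M N} [s N|[k|n||||s|s|s M|M K]|s M N a|M N K L a b] //.
- by exists M => //; constructor.
- by exists M, K; split; constructor.
- by exists N.
- by exists N, L.
Qed.

Lemma apx_hstep M N K : apx M N -> hstep M K -> exists2 L, hstep N L & apx K L.
Proof.
move=> a; elim: a K => {M N} [s N|M|s M N _ _|M N K L aM IHM aK IHK] P st.
- by have := hstep_atom st.
- by exists P => //; apply: apx_refl.
- by have := hstep_atom st.
case/hstep_App_inv: st => [r|[M' /IHM[N' sN aN] ->]|[sM [K' /IHK[L' sL aL] ->]]].
- inversion r; subst; move: (apx_inv aM) aK => /=.
  + move=> [M2 -> a] aK; exists (subst (scons L Var) M2).
      by apply: h_redex; constructor.
    by apply: apx_subst => // -[|k] //=; constructor.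
  + move=> -> aK; exists (App L (App (Y s) L)).
      by apply: h_redex; constructor.
    by repeat constructor.
  + move=> -> /apx_inv ->; exists (Cst n.+1); last by constructor.
    by apply: h_redex; constructor.
  + move=> -> /apx_inv ->; exists (Cst n); last by constructor.
    by apply: h_redex; constructor.
  + move=> [A [B [-> /apx_inv[A' [B' [-> /apx_inv -> /apx_inv ->]]] aB]]] aL.
    by exists B => //; apply: h_redex; constructor.
  + move=> [A [B [-> /apx_inv[A' [B' [-> /apx_inv -> /apx_inv ->]]] aB]]] aL.
    by exists L => //; apply: h_redex; constructor.
- by exists (App N' L); [apply: h_fun | constructor].
- have <- : M = N by case: sM aM => [|[|]] -> /apx_inv.
  by exists (App M L'); [apply: h_arg | constructor=> //; constructor].
Qed.

Lemma apx_conv M N j : apx M N -> conv M j -> conv N j.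
Proof.
move=> a [k]; elim: k M N a => [|k IH] M N a H.
  have EM : M = Cst j by inversion H.
  by move: a; rewrite EM => /apx_inv ->; apply/conv_Cst.
inversion H; subst; have [L sL aL] := apx_hstep a H1.
by apply/(conv_step _ sL)/(IH _ _ aL).
Qed.

(** The shorter case distinction ends in [Omega] where the longer one goes on with [Ns'']. *)
Lemma apx_tcase M M' Ns Ns' Ns'' : apx M M' -> List.Forall2 apx Ns Ns' ->
  apx (tcase M Ns) (tcase M' (Ns' ++ Ns'')).
Proof.
move=> a H; elim: H M M' a => {Ns Ns'} [|N N' Ns Ns' aN _ IH] M M' a /=.
  by constructor.
do !(constructor => //); apply: IH.
by constructor => //; constructor.
Qed.

Lemma apx_apps M M' Ns Ns' : apx M M' -> List.Forall2 apx Ns Ns' ->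
  apx (apps M Ns) (apps M' Ns').
Proof.
move=> aM H; elim: H M M' aM => //= K K' {}Ns {}Ns' aK _ IH M M' aM.
by apply: IH; constructor.
Qed.

Lemma syn_le_apx g g' : syn_le g g' -> apx (tm_of_game g) (tm_of_game g').
Proof.
elim/gtm_nested_ind: g g' => [s|ss m|ss y Ms Ns IHM IHN] g' H.
- by constructor.
- by inversion H; subst; constructor.
- inversion H; subst => /=; elim: ss {H} => [|s ss IH] /=; last by constructor.
  rewrite map_cat; apply: apx_tcase.
    apply: apx_apps; first by constructor.
    by apply: (Forall2_map (R := syn_le)) => // M M' HM; apply: IHM.
  by apply: (Forall2_map (R := syn_le)) => // N N' HN; apply: IHN.
Qed.

Section DecisionTree.
Variables (n : nat) (F : pfun).
Hypothesis sF : seqfun n F.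

(* What to do once the entries of [x] are known: answer, or ask for entry
   [k] (pointless if [k = n]). *)
Definition next_move (x : seq (option nat)) (a : nat + nat) : Prop :=
  match a with
  | inl j => F x j
  | inr k => nth None x k = None /\
      forall y j, levec x y -> F y j -> nth None y k <> None
  end.

Lemma next_move_ex : exists c, forall x, size x = n -> next_move x (c x).
Proof.
have /choice[c Hc] (x : seq (option nat)) : exists a, size x = n -> next_move x a.
  have [sx|] := pselect (size x = n); last by exists (inl 0).
  by case: (sf_seq sF sx) => [[j Fx]|[k Hk]]; [exists (inl j) | exists (inr k)].
by exists c.
Qed.

Definition moves : seq (option nat) -> nat + nat := projT1 (cid next_move_ex).

Lemma movesP x : size x = n -> next_move x (moves x).
Proof. by rewrite /moves; case: cid => c /= Hc; apply: Hc. Qed.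

(** [i] bounds the answers that are distinguished and [d] the number of further questions. Each
    question fills a [None] of [x], so depth [n] is enough. Only the root binds variables; inner
    nodes have [ss = [::]]. *)
Fixpoint tree (i d : nat) (ss : seq ty) (x : seq (option nat)) : gtm :=
  match moves x with
  | inl j => GNum ss j
  | inr k =>
      if d is d'.+1 then
        if k < n then
          GCase ss (n - k.+1) [::]
            [seq tree i d' [::] (set_nth None x k (Some v)) | v <- iota 0 i.+1]
        else GOmega (arrs ss)
      else GOmega (arrs ss)
  end.

Lemma tree0 i ss x : tree i 0 ss x =
  if moves x is inl j then GNum ss j else GOmega (arrs ss).
Proof. by []. Qed.

Lemma treeS i d ss x : tree i d.+1 ss x =
  match moves x with
  | inl j => GNum ss j
  | inr k => if k < n then GCase ss (n - k.+1) [::]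
        [seq tree i d [::] (set_nth None x k (Some v)) | v <- iota 0 i.+1]
      else GOmega (arrs ss)
  end.
Proof. by []. Qed.

Lemma tree_typed i d G ss x :
  (forall m, m < n -> onth (catrev ss G) m = Some Iota) ->
  game_typed G (tree i d ss x) (arrs ss).
Proof.
elim: d G ss x => [|d IH] G ss x H; rewrite ?tree0 ?treeS; case: (moves x) => [j|k]; try by constructor.
case: ifP => lk; last by constructor.
apply: (@gty_case _ _ _ [::]).
- by apply: H; lia.
- by constructor.
- by [].
- apply/List.Forall_forall => g /In_map[v _ ->].
  exact: (IH (catrev ss G) [::] _ H).
Qed.

(** The choice made by [moves] is independent of [i], so a larger [i] only appends branches to the
    nodes. The approximating trees thus form a chain. *)
Lemma tree_le i i' d ss x : i <= i' -> syn_le (tree i d ss x) (tree i' d ss x).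
Proof.
move=> li; elim: d ss x => [|d IH] ss x; rewrite ?tree0 ?treeS; case: (moves x) => [j|k]; try by constructor.
case: ifP => lk; last by constructor.
have -> : iota 0 i'.+1 = iota 0 i.+1 ++ iota i.+1 (i' - i).
  by rewrite -[X in iota X (_ - _)]add0n -iotaD; congr iota; lia.
rewrite map_cat; constructor; first by constructor.
by elim: (iota 0 i.+1) => [|v s IHs] /=; constructor.
Qed.

(** [x] records the answers received so far, and [d] is at least the number of entries still open.
    An answer above [i] finds no branch, as if it were missing; hence the truncated vector on the
    right. *)
Lemma conv_tree i d x y e j : size x = n -> size y = n ->
  count_mem None x <= d -> levec x (trunc i y) ->
  (forall k, k < n -> e (n - k.+1) = q (nth None y k)) ->
  conv (subst e (tm_of_game (tree i d [::] x))) j <-> F (trunc i y) j.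
Proof.
move=> + sy + + He; elim: d x => [|d IH] x sx cx lx; rewrite ?tree0 ?treeS;
  have := movesP sx; case: (moves x) => [j'|k].
- rewrite /= => Fx; rewrite conv_Cst; have Fy := sf_mono sF lx Fx.
  by split=> [<-//|]; apply: (sf_fun sF).
(* No entry of [x] is open any more, so the index is out of range and [F] is undefined at all
   vectors above [x]. *)
- case=> xk Hk; have lk : n <= k.
    rewrite leqNgt; apply/negP => lk; move: cx; rewrite leqn0 => /eqP cx.
    have /hasPn/(_ None) : ~~ has (pred1 None) x by rewrite has_count cx.
    by rewrite -{1}xk mem_nth ?sx // => /(_ isT)/eqP.
  split=> [/not_conv_Omega//|Fy]; case: (Hk _ _ lx Fy).
  by rewrite nth_default // size_trunc sy.
- rewrite /= => Fx; rewrite conv_Cst; have Fy := sf_mono sF lx Fx.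
  by split=> [<-//|]; apply: (sf_fun sF).
- case=> xk Hk; case: ifP => lk; last first.
    split=> [/not_conv_Omega//|Fy]; case: (Hk _ _ lx Fy).
    by rewrite nth_default // size_trunc sy leqNgt lk.
  rewrite -[tm_of_game _]/(tcase (Var (n - k.+1)) (map tm_of_game _)).
  rewrite subst_tcase conv_tcase !size_map size_iota.
  have ev v : v < i.+1 -> nth None y k = Some v ->
      conv (nth (Omega Iota) (map (subst e) (map tm_of_game
        [seq tree i d [::] (set_nth None x k (Some v)) | v <- iota 0 i.+1])) v) j <->
      F (trunc i y) j.
    move=> lv yk; rewrite -!map_comp (nth_map 0) ?size_iota // nth_iota //=.
    apply: IH.
    + by rewrite size_set_nth sx; apply/maxn_idPr.
    + rewrite count_set_nth_ltn ?sx // xk.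
      by change (count_mem None x + 0 - 1 <= d); lia.
    + case: (lx) => s H; split=> [|m a].
        by rewrite size_set_nth size_trunc sx sy; apply/maxn_idPr.
      rewrite nth_set_nth /=; case: eqP => [->|_ /H//] [<-].
      exact/nth_trunc.
  rewrite /= He //; split.
    by move=> [v lv [/conv_q yk]]; apply: (proj1 (ev v lv yk)).
  move=> Fy; have := Hk _ _ lx Fy.
  case E: (nth None _ k) => [v|] // _; case/nth_trunc: (E) => yk lv.
  by exists v => //; split; [apply/conv_q | apply/(ev v lv yk)].
Qed.

Definition approx_tree i : gtm := tree i n (nseq n Iota) (nseq n None).

Lemma approx_tree_typed i : game_term (sg n) (approx_tree i).
Proof.
apply: tree_typed => m lm; have -> : catrev (nseq n Iota) [::] = nseq n Iota.
  by rewrite catrevE rev_nseq cats0.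
by elim: n m lm => // k IH [|m] //=; apply: IH.
Qed.

Lemma beh_approx_tree i y j : size y = n ->
  beh n (tm_of_game (approx_tree i)) y j <-> F (trunc i y) j.
Proof.
move=> sy; pose e := extend (map q y) Var.
rewrite -(@conv_tree i n (nseq n None) y e j) ?size_nseq //.
- rewrite /beh; have lams B : conv (apps (foldr Lam B (nseq n Iota)) (map q y)) j <->
      conv (subst e B) j.
    by rewrite -{1}[foldr _ _ _]subst_Var conv_lams // size_map sy size_nseq.
  (* If the root is [GOmega], the term is [Omega] at the function type and not an abstraction. *)
  have E : forall x d, [\/ tm_of_game (tree i d (nseq n Iota) x) =
      foldr Lam (tm_of_game (tree i d [::] x)) (nseq n Iota) |
      exists s, tm_of_game (tree i d (nseq n Iota) x) = Omega s /\
        tm_of_game (tree i d [::] x) = Omega Iota ].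
    move=> x [|d] /=; case: (moves x) => [j'|k]; try by constructor.
      by right; exists (sg n).
    by case: ifP; [left | right; exists (sg n)].
  case: (E (nseq n None) n) => [->|[s [-> ->]]].
    by rewrite lams; split=> [[]|].
  split=> [[_]|/not_conv_Omega//].
  by move=> H; case: (not_conv_dead _ H); apply: dead_apps; constructor.
- by apply: leq_trans (count_size _ _) _; rewrite size_nseq.
- by split=> [|k a]; rewrite ?size_trunc ?size_nseq ?nth_nseq ?if_same.
- move=> k lk; have := @extend_nth (map q y) Var k.
  by rewrite size_map sy -/e => -> //; rewrite nth_map_q ?sy.
Qed.

End DecisionTree.

Local Open Scope classical_set_scope.

(** * Ideals as sequential functions *)

Lemma eqclass_self s M : closed_tm s M -> eqclass s M M.
Proof. by move=> tM; split=> // P m. Qed.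

Lemma eqclass_beh n M N : closed_tm (sg n) M -> eqclass (sg n) M N ->
  closed_tm (sg n) N /\ beh n N = beh n M.
Proof.
move=> tM [tN NM MN]; split=> //.
by apply: fle_anti; apply/(obs_le_beh (n := n)).
Qed.

Lemma eqclass_eq n M N : closed_tm (sg n) M -> closed_tm (sg n) N ->
  beh n M = beh n N -> eqclass (sg n) M = eqclass (sg n) N.
Proof.
move=> tM tN E.
have sub K L : closed_tm (sg n) K -> closed_tm (sg n) L -> beh n K = beh n L ->
    eqclass (sg n) K `<=` eqclass (sg n) L.
  move=> tK tL EKL P /(eqclass_beh tK)[tP EP].
  by split=> //; apply/(obs_le_beh (n := n)) => //; rewrite EP EKL.
by apply/seteqP; split; apply: sub.
Qed.

Lemma class_le_eqclass n M N : closed_tm (sg n) M -> closed_tm (sg n) N ->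
  class_le (eqclass (sg n) M) (eqclass (sg n) N) <-> fle (beh n M) (beh n N).
Proof.
move=> tM tN; split=> [H|H K L].
  by apply/(obs_le_beh tM tN); apply: H; apply: eqclass_self.
move=> /(eqclass_beh tM)[tK EK] /(eqclass_beh tN)[tL EL].
by apply/(obs_le_beh tK tL); rewrite EK EL.
Qed.

Definition bounded i (F : pfun) : Prop := fle F (truncf i F).

Lemma bounded_le i j F n : seqfun n F -> i <= j -> bounded i F -> bounded j F.
Proof.
move=> sF lij H x m /H[lm Fx]; split; first exact: leq_trans lij.
exact: (sf_mono sF (trunc_le_trunc x lij) Fx).
Qed.

Lemma bounded_truncf i F : bounded i (truncf i F).
Proof. by move=> x j [lj Fx]; split=> //; split=> //; rewrite trunc_trunc minnn. Qed.

Lemma truncf_bounded i F n : seqfun n F -> bounded i F -> truncf i F = F.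
Proof. by move=> sF H; apply: fle_anti H; apply: truncf_le sF. Qed.

Lemma FP_closed s i M : closed_tm s M -> closed_tm s (App (FP s i) M).
Proof. by move=> tM; apply: ty_app (FP_typed _ _ _) tM. Qed.

Lemma beh_FP_truncf n i M : closed_tm (sg n) M ->
  beh n (App (FP (sg n) i) M) = truncf i (beh n M).
Proof. by move=> tM; apply: fle_anti => x j; rewrite (beh_FP i x j tM). Qed.

Lemma fin_FP n i M : closed_tm (sg n) M ->
  fin (sg n) (eqclass (sg n) (App (FP (sg n) i) M)).
Proof. by move=> tM; exists i => //; exists M. Qed.

Lemma finP n C : fin (sg n) C -> exists i M,
  [/\ closed_tm (sg n) M, C = eqclass (sg n) M & bounded i (beh n M)].
Proof.
move=> [i _ [M tM <-]]; exists i, (App (FP (sg n) i) M); split=> //.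
  exact: FP_closed.
by rewrite beh_FP_truncf //; apply: bounded_truncf.
Qed.

Lemma class_le_refl n C : fin (sg n) C -> class_le C C.
Proof. by move=> /finP[i [M [tM -> _]]]; apply/class_le_eqclass. Qed.

Lemma class_le_trans n C1 C2 C3 : fin (sg n) C1 -> fin (sg n) C2 -> fin (sg n) C3 ->
  class_le C1 C2 -> class_le C2 C3 -> class_le C1 C3.
Proof.
move=> /finP[i [M [tM -> _]]] /finP[j [N [tN -> _]]] /finP[k [K [tK -> _]]].
rewrite !(class_le_eqclass (n := n)) // => H H' x m Hx.
by apply: H'; apply: H.
Qed.

(** The tree truncates only the arguments; applying [FP] to it also cuts off the values above [i]
    and makes the class finite. *)
Lemma fin_approx n i F : seqfun n F ->
  exists M, [/\ closed_tm (sg n) M, fin (sg n) (eqclass (sg n) M) & beh n M = truncf i F].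
Proof.
move=> sF; pose T := tm_of_game (approx_tree sF i).
have tT : closed_tm (sg n) T by apply: game_typed_tm; apply: approx_tree_typed.
exists (App (FP (sg n) i) T); split; [exact: FP_closed | exact: fin_FP |].
rewrite beh_FP_truncf //; apply: fle_anti => x j [lj Hx]; split=> //.
  have sx : size (trunc i x) = n by case: Hx.
  by move: Hx; rewrite beh_approx_tree // trunc_trunc minnn.
by rewrite beh_approx_tree ?trunc_trunc ?minnn //; apply: (sf_size sF Hx).
Qed.

(* The function denoted by an ideal, as a relation. *)
Definition ap n (d : dom) : pfun :=
  fun x j => exists C M, [/\ d C, C M & beh n M x j].

Definition idl n : set dom := ideal class_le (fin (sg n)).

Lemma idlP n d C M : idl n d -> d C -> C M ->
  [/\ closed_tm (sg n) M, C = eqclass (sg n) M & fle (beh n M) (ap n d)].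
Proof.
move=> [df _ _] dC; have /finP[i [N [tN E _]]] := df _ dC.
rewrite E => /(eqclass_beh tN)[tM EM]; split=> //.
  exact/eqclass_eq.
move=> x j Hx; exists C, M; split=> //.
by rewrite E; split=> //; apply/(obs_le_beh (n := n)); rewrite ?EM.
Qed.

Lemma idl_ub n d M N : idl n d -> closed_tm (sg n) M -> closed_tm (sg n) N ->
  d (eqclass (sg n) M) -> d (eqclass (sg n) N) ->
  exists K, [/\ closed_tm (sg n) K, d (eqclass (sg n) K),
    fle (beh n M) (beh n K) & fle (beh n N) (beh n K)].
Proof.
move=> [df [_ dd] _] tM tN dM dN; have [C dC [MC NC]] := dd _ _ dM dN.
have /finP[i [K [tK E _]]] := df _ dC; rewrite E in dC MC NC.
by exists K; split=> //; apply/(class_le_eqclass (n := n)).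
Qed.

Lemma ap_fun n d x j j' : idl n d -> ap n d x j -> ap n d x j' -> j = j'.
Proof.
move=> id [C [M [dC CM Mx]]] [C' [M' [dC' CM' Mx']]].
have [tM EC _] := idlP id dC CM; have [tM' EC' _] := idlP id dC' CM'.
rewrite EC in dC; rewrite EC' in dC'.
have [K [_ _ MK M'K]] := idl_ub id tM tM' dC dC'.
exact: beh_fun (MK _ _ Mx) (M'K _ _ Mx').
Qed.

(** Directedness gathers finitely many values of an ideal in one member, to which facts about terms
    then apply. *)
Lemma ap_points n d (L : seq (seq (option nat))) : idl n d ->
  exists M, [/\ closed_tm (sg n) M, d (eqclass (sg n) M) &
    forall x, x \in L -> forall j, ap n d x j -> beh n M x j].
Proof.
move=> id; elim: L => [|x L [M [tM dM HM]]].
  have [df [[C dC] _] _] := id; have /finP[i [M [tM E _]]] := df _ dC.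
  by exists M; split=> //; rewrite -E.
have [[j [C [N [dC CN Nx]]]]|nx] := pselect (exists j, ap n d x j); last first.
  exists M; split=> // y; rewrite inE => /orP[/eqP ->|/HM //] j Hj.
  by case: nx; exists j.
have [tN EC _] := idlP id dC CN; rewrite EC in dC.
have [K [tK dK MK NK]] := idl_ub id tM tN dM dC.
exists K; split=> // y; rewrite inE => /orP[/eqP -> i yi|/HM H j' /H /MK //].
suff -> : i = j by apply: NK.
apply: ap_fun id yi _; exists C, N; split=> //; by rewrite EC.
Qed.

(* Finitely many points above [x] suffice to refute all candidates for the
   index that is needed at [x]; a single member of the ideal is defined at all
   of them. *)
Lemma ap_seqfun n d : idl n d -> seqfun n (ap n d).
Proof.
move=> id; split.
- by move=> x j [C [M [_ _ []]]].
- by move=> x j j'; apply: ap_fun.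
- move=> x y j lxy [C [M [dC CM Mx]]]; exists C, M; split=> //.
  by have [tM _ _] := idlP id dC CM; apply: beh_mono tM lxy Mx.
- move=> x sx; have [|nx] := pselect (exists j, ap n d x j); first by left.
  right; have [//|H] := pselect (exists k, nth None x k = None /\
    forall y j, levec x y -> ap n d y j -> nth None y k <> None).
  have /choice[Y HY] k : exists y, nth None x k = None ->
      [/\ levec x y, exists j, ap n d y j & nth None y k = None].
    have [xk|] := pselect (nth None x k = None); last by exists [::].
    have /existsNP[y /existsNP[j /not_implyP[lxy /not_implyP[yj /contrapT yk]]]] :
      ~ forall y j, levec x y -> ap n d y j -> nth None y k <> None.
      by move=> Hk; apply: H; exists k.
    by exists y => _; split=> //; exists j.
  have [M [tM dM HM]] := ap_points (map Y (iota 0 n.+1)) id.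
  case: (beh_sequential tM sx) => [[j Mx]|[k [xk Hk]]].
    by case: nx; exists j, (eqclass (sg n) M), M; split=> //; apply: eqclass_self.
  (* All indices from [n] on are out of range and behave alike, so [n] stands for them in the finite
     list of candidates. *)
  have xm : nth None x (minn k n) = None.
    by case: (leqP k n) => // _; rewrite nth_default ?sx.
  have [lxy [j yj] ym] := HY _ xm.
  have My : beh n M (Y (minn k n)) j.
    by apply: HM => //; apply: map_f; rewrite mem_iota ltnS geq_minr.
  case: (Hk _ _ lxy My); case: (leqP k n) ym lxy {My} => // lk _ [s _].
  by rewrite nth_default // -s sx ltnW.
Qed.

Lemma all_vectors n i : exists L : seq (seq (option nat)), forall x, size x = n -> trunc i x \in L.
Proof.
elim: n => [|n [L HL]]; first by exists [:: [::]] => -[].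
exists [seq v :: x | v <- None :: map Some (iota 0 i.+1), x <- L] => -[//|v x] [sx].
apply: (allpairs_f (fun v x => v :: x)); last exact: HL.
case: v => [m|] //; case: ifP => // lm; rewrite inE; apply/orP; right.
by apply: map_f; rewrite mem_iota.
Qed.

(** A finite element is determined by its values at the finitely many vectors truncated at its
    level. If they are values of [d'], a single member of [d'] has them all and lies above that
    element. *)
Lemma ext_ap n d d' : idl n d -> idl n d' -> ext d d' <-> fle (ap n d) (ap n d').
Proof.
move=> id id'; split=> [H x j [C [M [dC CM Mx]]]|H C dC].
  by exists C, M; split=> //; apply: H.
have [df _ _] := id; have /finP[i [M [tM E bM]]] := df _ dC.
have [L HL] := all_vectors n i.
have [M' [tM' dM' HM']] := ap_points L id'.
have [df' _ dn'] := id'; apply: (dn' C (eqclass (sg n) M')) => //.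
  exact: df dC.
rewrite E; apply/class_le_eqclass => // x j Mx.
have sx := proj1 Mx; have [_ Mt] := bM _ _ Mx.
apply: beh_mono tM' (trunc_le i x) _; apply: HM'; first exact: HL.
by apply: H; exists C, M; split=> //; rewrite E; apply: eqclass_self.
Qed.

Lemma ap_inj n d d' : idl n d -> idl n d' -> ap n d = ap n d' -> d = d'.
Proof.
by move=> id id' E; apply/seteqP; split; apply/(ext_ap (n := n)) => //; rewrite E.
Qed.

Definition real n (F : pfun) : dom :=
  [set C | fin (sg n) C /\ forall M, C M -> fle (beh n M) F].

Lemma real_eqclass n F M : closed_tm (sg n) M -> fin (sg n) (eqclass (sg n) M) ->
  fle (beh n M) F -> real n F (eqclass (sg n) M).
Proof. by move=> tM fM H; split=> // N /(eqclass_beh tM)[_ ->]. Qed.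

Lemma real_idl n F : seqfun n F -> idl n (real n F).
Proof.
move=> sF; split; first by move=> C [].
  split.
    have [M [tM fM E]] := fin_approx 0 sF.
    exists (eqclass (sg n) M); apply: real_eqclass => //.
    by rewrite E; apply: truncf_le sF.
  move=> C C' [fC HC] [fC' HC'].
  have /finP[i [M [tM EM bM]]] := fC; have /finP[i' [M' [tM' EM' bM']]] := fC'.
  have [N [tN fN E]] := fin_approx (maxn i i') sF.
  exists (eqclass (sg n) N).
    by apply: real_eqclass => //; rewrite E; apply: truncf_le sF.
  have H K k : closed_tm (sg n) K -> k <= maxn i i' -> bounded k (beh n K) ->
      fle (beh n K) F -> fle (beh n K) (beh n N).
    move=> tK lk bK KF x j /(bounded_le (beh_seqfun tK) lk bK)[lj Kx].
    by rewrite E; split=> //; apply: KF.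
  rewrite EM EM' !(class_le_eqclass (n := n)) //.
  split; [apply: H (leq_maxl _ _) bM _ | apply: H (leq_maxr _ _) bM' _] => //.
    by apply: HC; rewrite EM; apply: eqclass_self.
  by apply: HC'; rewrite EM'; apply: eqclass_self.
move=> C C' fC [fC' HC'] le; split=> // M CM x j Mx.
have /finP[i [M' [tM' EM' _]]] := fC'; have CM' : C' M' by rewrite EM'; apply: eqclass_self.
apply: (HC' M' CM'); have /finP[i' [M0 [tM0 EM0 _]]] := fC.
have [tM _] : closed_tm (sg n) M /\ beh n M = beh n M0.
  by apply: eqclass_beh => //; rewrite -EM0.
by move: x j Mx; apply/(obs_le_beh tM tM'); apply: le.
Qed.

(** Together with [ap_seqfun], [ap_inj] and [real_idl] this makes [ap] a bijection from ideals to
    sequential functions. *)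
Lemma ap_real n F : seqfun n F -> ap n (real n F) = F.
Proof.
move=> sF; apply: fle_anti => x j; first by move=> [C [M [[_ H] CM]]]; apply: H.
move=> Fx; have [i Hi] := truncf_ub sF Fx.
have [M [tM fM E]] := fin_approx i sF.
exists (eqclass (sg n) M), M; split; last by rewrite E; apply: Hi.
  by apply: real_eqclass => //; rewrite E; apply: truncf_le sF.
exact: eqclass_self.
Qed.

Definition up (v : option nat) : dom := den Iota (q v).

Lemma conv_FP_q i v m : conv (App (FP Iota i) (q v)) m <-> m <= i /\ v = Some m.
Proof. by rewrite conv_FP_iota conv_q. Qed.

Lemma up_mem v C : up v C -> exists N, [/\ closed_tm Iota N, C = eqclass Iota N &
  forall m, conv N m -> v = Some m].
Proof.
move=> [fC [_ [i _ <-] le]]; have [k [N [tN EN _]]] := @finP 0 C fC.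
exists N; split=> // m Nm.
have : obs_le N (App (FP Iota i) (q v)).
  apply: le; first by rewrite EN; apply: eqclass_self.
  by apply: eqclass_self; apply: FP_closed; apply: closed_q.
by move/(@obs_le_conv Hole _ _ m) => /(_ tN (FP_closed i (closed_q v)) Nm) /conv_FP_q[].
Qed.

Lemma up_self v i : (forall m, v = Some m -> m <= i) ->
  up v (eqclass Iota (App (FP Iota i) (q v))).
Proof.
move=> lv; have f := @fin_FP 0 i _ (closed_q v); split; first exact: f.
by exists (eqclass Iota (App (FP Iota i) (q v))); [exists i | apply: (@class_le_refl 0)].
Qed.

Lemma ap_iapp n f v : idl n.+1 f ->
  ap n (iapp (sg n) f (up v)) = fun x => ap n.+1 f (v :: x).
Proof.
move=> id; apply: fle_anti => x j.
  move=> [C [M [[fC [_ [f' ff' [d' dd' <-]] le]] CM Mx]]].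
  have [df _ _] := id; have /finP[i [F0 [tF EF _]]] := df _ ff'.
  have [N0 [tN EN Hv]] := up_mem dd'.
  have tFN : closed_tm (sg n) (App F0 N0) by apply: ty_app tF tN.
  have tM : closed_tm (sg n) M.
    have /finP[k [M0 [tM0 EM0 _]]] := fC.
    by have [] : closed_tm (sg n) M /\ beh n M = beh n M0 by apply: eqclass_beh => //; rewrite -EM0.
  have MFN : obs_le M (App F0 N0).
    apply: le CM _; exists F0, N0; split.
    - by rewrite EF; apply: eqclass_self.
    - by rewrite EN; apply: eqclass_self.
    - exact: eqclass_self.
  have [sx Hx] := proj1 (obs_le_beh tM tFN) MFN _ _ Mx.
  exists f', F0; split=> //; first by rewrite EF; apply: eqclass_self.
  split; first by rewrite /= sx.
  apply: (@conv_apps_mono n.+1 F0 (N0 :: map q x) (q v :: map q x) j tF) Hx;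
    rewrite /= ?size_map ?sx // => -[|k] lk m //=.
  by rewrite conv_q; apply: Hv.
move=> [f' [M0 [ff' fM0 [[sx] Hx]]]].
have [tM0 Ef' _] := idlP id ff' fM0.
have [iv lv] : exists i, forall m, v = Some m -> m <= i.
  by exists (odflt 0 v) => m ->.
have tMq : closed_tm (sg n) (App M0 (q v)) by apply: ty_app tM0 (closed_q v).
have Mqx : beh n (App M0 (q v)) x j by split.
have [i Hi] := truncf_ub (beh_seqfun tMq) Mqx.
(* A member of the ideal must be a finite class, so the application is projected, at a level that
   keeps the value at [x]. *)
pose K := App (FP (sg n) i) (App M0 (q v)).
have tK : closed_tm (sg n) K by apply: FP_closed.
exists (eqclass (sg n) K), K; split; last by rewrite beh_FP_truncf //; apply: Hi.
  split; first exact: fin_FP.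
  exists (class_app (sg n) f' (eqclass Iota (App (FP Iota iv) (q v)))).
    by exists f' => //; exists (eqclass Iota (App (FP Iota iv) (q v))); [apply: up_self|].
  move=> P L /(eqclass_beh tK)[tP EP] [M1 [N1 [f'M1 N1q HL]]].
  have [tM1 EM1] : closed_tm (sg n.+1) M1 /\ beh n.+1 M1 = beh n.+1 M0.
    by apply: eqclass_beh => //; rewrite -Ef'.
  have [tN1 qN1 _] := N1q.
  have tMN : closed_tm (sg n) (App M1 N1) by apply: ty_app tM1 tN1.
  have [tL EL] := eqclass_beh tMN HL.
  apply/(obs_le_beh tP tL) => y m; rewrite EP EL beh_FP_truncf //.
  move=> /(truncf_le (beh_seqfun tMq)) [sy Hy].
  have : beh n.+1 M1 (v :: y) m by rewrite EM1; split=> //=; rewrite sy.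
  move=> [_ Hy1]; split=> //.
  apply: (@conv_apps_mono n.+1 M1 (q v :: map q y) (N1 :: map q y) m tM1) Hy1;
    rewrite /= ?size_map ?sy // => -[|k] lk a //= va.
  have : conv (App (FP Iota iv) (q v)) a.
    by apply/conv_FP_q; move/conv_q: va => va; split=> //; apply: lv.
  apply: (@obs_le_conv Hole _ _ a qN1) => //.
  by apply: FP_closed; apply: closed_q.
exact: eqclass_self.
Qed.

Lemma ap_down n A : ap n (down (sg n) A) =
  fun x j => exists C M, [/\ fin (sg n) C, exists2 C', A C' & class_le C C', C M & beh n M x j].
Proof.
by apply: fle_anti => x j; [move=> [C [M [[? ?] ? ?]]] | move=> [C [M [? ? ? ?]]]]; exists C, M.
Qed.

Lemma ap_den n M : closed_tm (sg n) M -> ap n (den (sg n) M) = beh n M.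
Proof.
move=> tM; rewrite /den ap_down; apply: fle_anti => x j.
  move=> [C [K [/finP[i' [K0 [tK0 EK _]]] [_ [i _ <-] le] CK Kx]]].
  rewrite EK in le CK; have [tK EK0] := eqclass_beh tK0 CK.
  move: le; rewrite (class_le_eqclass (n := n)) //; last exact: FP_closed.
  rewrite beh_FP_truncf // => le; rewrite EK0 in Kx.
  by apply: (truncf_le (beh_seqfun tM) (le _ _ Kx)).
move=> Mx; have [i Hi] := truncf_ub (beh_seqfun tM) Mx.
exists (eqclass (sg n) (App (FP (sg n) i) M)), (App (FP (sg n) i) M); split.
- exact: fin_FP.
- exists (eqclass (sg n) (App (FP (sg n) i) M)); first by exists i.
  by apply: (@class_le_refl n); apply: fin_FP.
- by apply: eqclass_self; apply: FP_closed.
- by rewrite beh_FP_truncf //; apply: Hi.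
Qed.

Lemma principal_idl n M : closed_tm (sg n) M -> fin (sg n) (eqclass (sg n) M) ->
  idl n (down (sg n) [set eqclass (sg n) M]) /\
  ap n (down (sg n) [set eqclass (sg n) M]) = beh n M.
Proof.
move=> tM fM; have refl := class_le_refl fM; split; last first.
  rewrite ap_down; apply: fle_anti => x j.
    move=> [_ [K [/finP[i [K0 [tK0 -> _]]] [_ -> /(class_le_eqclass tK0 tM) le]]]].
    by move=> /(eqclass_beh tK0)[_ ->]; apply: le.
  move=> Mx; exists (eqclass (sg n) M), M; split=> //; last exact: eqclass_self.
  by exists (eqclass (sg n) M).
split; first by move=> C [].
  split; first by exists (eqclass (sg n) M); split=> //; exists (eqclass (sg n) M).
  move=> C C' [_ [_ -> le]] [_ [_ -> le']]; exists (eqclass (sg n) M) => //.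
  by split=> //; exists (eqclass (sg n) M).
move=> C C' fC [fC' [_ -> le']] le; split=> //; exists (eqclass (sg n) M) => //.
exact: class_le_trans fC fC' fM le le'.
Qed.

(** * First-order types in an arbitrary f-model *)

Section Model.
Variable D : ty -> set dom.
Hypothesis hD : fmodel D.

Lemma D_idl n d : D (sg n) d -> idl n d.
Proof. by have [H _ _] := hD; apply: H. Qed.

Lemma D_den n M : closed_tm (sg n) M -> D (sg n) (den (sg n) M).
Proof. by have [_ _ H] := hD; apply: H. Qed.

Lemma D_seqfun n d : D (sg n) d -> seqfun n (ap n d).
Proof. by move/D_idl/ap_seqfun. Qed.

Lemma D_ext n d d' : D (sg n) d -> D (sg n) d' -> ext d d' <-> fle (ap n d) (ap n d').
Proof. by move=> /D_idl id /D_idl id'; apply: ext_ap. Qed.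

Lemma D_inj n d d' : D (sg n) d -> D (sg n) d' -> ap n d = ap n d' -> d = d'.
Proof. by move=> /D_idl id /D_idl; apply: ap_inj. Qed.

(** Finite elements lie in every f-model: the principal ideal of the class of [M] has the behaviour
    of [M], hence equals the denotation of [M]. *)
Lemma fin_eltP n d : fin_elt (sg n) d ->
  D (sg n) d /\ exists i, bounded i (ap n d).
Proof.
move=> [C fC <-]; have /finP[i [M [tM EM bM]]] := fC; rewrite EM in fC *.
have [id ad] := principal_idl tM fC; split; last by exists i; rewrite ad.
have -> : down (sg n) [set eqclass (sg n) M] = den (sg n) M.
  by apply: ap_inj id (D_idl (D_den tM)) _; rewrite ad ap_den.
exact: D_den.
Qed.

Lemma fin_elt_ex n i F : seqfun n F -> bounded i F ->
  exists2 d, fin_elt (sg n) d & ap n d = F.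
Proof.
move=> sF bF; have [M [tM fM E]] := fin_approx i sF.
exists (down (sg n) [set eqclass (sg n) M]).
  by exists (eqclass (sg n) M).
by rewrite (proj2 (principal_idl tM fM)) E (truncf_bounded sF bF).
Qed.

Lemma ap_up v x j : ap 0 (up v) x j <-> x = [::] /\ v = Some j.
Proof.
rewrite /up (@ap_den 0 _ (closed_q v)); split=> [[/size0nil ->]|[-> ->]].
  by rewrite /= conv_q.
by split=> //=; apply/conv_Cst.
Qed.

Lemma D_up v : D Iota (up v).
Proof. exact: (@D_den 0 _ (closed_q v)). Qed.

Lemma D_iotaP d : D Iota d -> exists v, d = up v.
Proof.
move=> Dd; have sF := @D_seqfun 0 d Dd.
have [[j dj]|nd] := pselect (exists j, ap 0 d [::] j).
  exists (Some j); apply: (@D_inj 0) (D_up _) _ => //; apply: fle_anti => x m.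
    move=> dx; apply/ap_up; have /size0nil Ex := sf_size sF dx; subst x.
    by split=> //; rewrite (sf_fun sF dj dx).
  by move=> /ap_up[-> [<-]].
exists None; apply: (@D_inj 0) (D_up _) _ => //; apply: fle_anti => x m.
  by move=> dx; have /size0nil Ex := sf_size sF dx; subst x; case: nd; exists m.
by move=> /ap_up[].
Qed.

Lemma up_inj : injective up.
Proof.
have H u v j : up u = up v -> u = Some j -> v = Some j.
  by move=> E Eu; have /ap_up[] : ap 0 (up v) [::] j by rewrite -E; apply/ap_up.
move=> u v E; case: u E => [j|] E; first by rewrite (H _ _ j E).
by case: v E => // j /esym E; have := H _ _ j E erefl.
Qed.

Lemma fin_elt_up v : fin_elt Iota (up v).
Proof.
have sF := @D_seqfun 0 _ (D_up v).
have [|d fd Ed] := @fin_elt_ex 0 (odflt 0 v) (ap 0 (up v)) sF.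
  by move=> x j /ap_up[-> ->]; split=> //; apply/ap_up.
have [Dd _] := @fin_eltP 0 d fd.
by have <- : d = up v by apply: (@D_inj 0) => //; apply: D_up.
Qed.

Lemma fin_elt_iotaP d : fin_elt Iota d <-> exists v, d = up v.
Proof.
split=> [fd|[v ->]]; last exact: fin_elt_up.
by apply: D_iotaP; have [Dd _] := @fin_eltP 0 d fd.
Qed.

Lemma ext_up u v : ext (up u) (up v) <-> forall j, u = Some j -> v = Some j.
Proof.
rewrite (@D_ext 0) //; try exact: D_up.
split=> [H j Eu|H x j /ap_up[-> /H Ev]]; last exact/ap_up.
by have /ap_up[] : ap 0 (up v) [::] j by apply/H/ap_up.
Qed.

Lemma iapp_D n f v : D (sg n.+1) f -> D (sg n) (iapp (sg n) f (up v)) /\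
  ap n (iapp (sg n) f (up v)) = fun x => ap n.+1 f (v :: x).
Proof.
move=> Df; split; last by apply: ap_iapp; apply: D_idl.
by have [_ H _] := hD; apply: (H Iota (sg n)) => //; apply: D_up.
Qed.

Lemma iapps_up n f x : D (sg n) f -> size x = n ->
  exists2 v, iapps (nseq n Iota) f (map up x) = up v &
    forall j, ap n f x j <-> v = Some j.
Proof.
elim: n f x => [|n IH] f [|v x] // Df; first last.
  move=> [sx]; have [Dfv E] := iapp_D v Df.
  by have [w Ew Hw] := IH _ _ Dfv sx; exists w => // j; rewrite -Hw E.
move=> _; have [v ->] := D_iotaP Df; exists v => // j.
by rewrite ap_up; split=> [[]|].
Qed.

Lemma is_vecP (A : ty -> set dom) n xs : (forall d, A Iota d <-> exists v, d = up v) ->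
  is_vec A (nseq n Iota) xs <-> exists2 x, size x = n & xs = map up x.
Proof.
move=> HA; rewrite /is_vec (Forall2_nseq (A := A Iota)) //; split; last first.
  move=> [x sx ->]; rewrite size_map; split=> // d /In_map[v _ ->].
  by apply/HA; exists v.
elim: xs n => [|d xs IH] n [<- H]; first by exists [::].
have [|x sx Ex] := IH (size xs).
  by split=> // d' Hd'; apply: H; right.
have /HA[v ->] : A Iota d by apply: H; left.
by exists (v :: x); rewrite /= ?sx ?Ex.
Qed.

Lemma D_iota_up d : D Iota d <-> exists v, d = up v.
Proof. by split=> [/D_iotaP//|[v ->]]; apply: D_up. Qed.

Lemma st_vec_up n x y : size x = n -> size y = n ->
  st_vec D (nseq n Iota) (map up x) (map up y) <-> levec x y.
Proof.
elim: n x y => [|n IH] [|u x] [|v y] //=.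
by move=> [sx] [sy]; rewrite levec_cons -(IH x y) // (ext_up u v).
Qed.

(** All elements of [D Iota] are finite, so a minimal point serves as its own vector [xs] in the
    definition of [trace]. *)
Lemma trace_ap n f ys j : D (sg n) f ->
  trace D (nseq n Iota) f (ys, j) <-> exists2 y, ys = map up y & tr (ap n f) y j.
Proof.
move=> Df; have sF := D_seqfun Df.
have val x : size x = n ->
    iapps (nseq n Iota) f (map up x) = den Iota (Cst j) <-> ap n f x j.
  move=> sx; have [v -> Hv] := iapps_up Df sx; rewrite Hv.
  by split=> [/(@up_inj v (Some j))|->].
split.
  move=> [xs [/(is_vecP _ _ D_iota_up)[x sx ->]] /= /(val _ sx) fx].
  move=> [/(is_vecP _ _ fin_elt_iotaP)[y sy ->] /(st_vec_up sy sx) lyx /(val _ sy) fy] min.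
  exists y => //; split=> // z lzy fz.
  have sz : size z = n by rewrite -sy; case: lzy.
  apply: levec_anti => //; apply/(st_vec_up sy sz); apply: min; split.
  - by apply/(is_vecP _ _ fin_elt_iotaP); exists z.
  - by apply/(st_vec_up sz sx); apply: levec_trans lzy lyx.
  - exact/val.
move=> [y -> [fy my]]; have sy := sf_size sF fy.
exists (map up y); split=> /=.
- by apply/(is_vecP _ _ D_iota_up); exists y.
- exact/val.
- split; [|exact/st_vec_up|exact/val].
  by apply/(is_vecP _ _ fin_elt_iotaP); exists y.
- move=> zs [/(is_vecP _ _ fin_elt_iotaP)[z sz ->] /(st_vec_up sz sy) lzy /(val _ sz) fz].
  by rewrite (my _ lzy fz); apply/st_vec_up.
Qed.

(* The step function with a single token belongs to [D], so extensional meets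
   in [D] are pointwise. *)
Lemma glb_ext n a b m : D (sg n) a -> D (sg n) b -> D (sg n) m ->
  is_glb ext (D (sg n)) [set a; b] m <->
  forall x j, ap n m x j <-> ap n a x j /\ ap n b x j.
Proof.
move=> Da Db Dm; split.
  move=> [_ lb gl] x j; split=> [mx|[ax bx]].
    split; first exact: (proj1 (D_ext Dm Da) (lb a (or_introl erefl))).
    exact: (proj1 (D_ext Dm Db) (lb b (or_intror erefl))).
  have sx := sf_size (D_seqfun Da) ax.
  have sS := stepf_seqfun x j; rewrite sx in sS.
  have [i Hi] : exists i, bounded i (stepf x j).
    have [i Hi] := trunc_large x; exists (maxn i j) => y m' [lxy ->]; split.
      exact: leq_maxr.
    by split=> //; rewrite -(Hi _ (leq_maxl i j)); apply: trunc_mono.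
  have [d fd Ed] := fin_elt_ex sS Hi; have [Dd _] := fin_eltP fd.
  have ledm : ext d m.
    apply: gl => // s [->|->]; apply/(D_ext Dd) => // y k; rewrite Ed => -[lxy ->].
      exact: (sf_mono (D_seqfun Da) lxy ax).
    exact: (sf_mono (D_seqfun Db) lxy bx).
  by apply: (proj1 (D_ext Dd Dm) ledm); rewrite Ed.
move=> H; split=> //.
  by move=> s [->|->]; apply/(D_ext Dm) => // x j /H[].
move=> v Dv Hv; apply/(D_ext Dv Dm) => x j vx; apply/H; split.
  exact: (proj1 (D_ext Dv Da) (Hv a (or_introl erefl))).
exact: (proj1 (D_ext Dv Db) (Hv b (or_intror erefl))).
Qed.

Lemma st_arr n f g : st D (sg n.+1) f g <-> forall u v,
  (forall j, u = Some j -> v = Some j) ->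
  st D (sg n) (iapp (sg n) f (up u)) (iapp (sg n) g (up u)) /\
  is_glb ext (D (sg n)) [set iapp (sg n) f (up v); iapp (sg n) g (up u)]
    (iapp (sg n) f (up u)).
Proof.
split=> [H u v /ext_up luv|H].
  exact: H (fin_elt_up u) (fin_elt_up v) luv.
by move=> x y /fin_elt_iotaP[u ->] /fin_elt_iotaP[v ->] /ext_up/H.
Qed.

(** By [glb_ext] the meet taken in [D] is pointwise, so [st] and [sst] obey the same recursion on
    the number of arguments. *)
Lemma st_ap n f g : D (sg n) f -> D (sg n) g ->
  st D (sg n) f g <-> sst (ap n f) (ap n g).
Proof.
elim: n f g => [|n IH] f g Df Dg.
  rewrite /= (@D_ext 0) //; split=> [H|[]//]; split=> // x y j lxy fy gx.
  have /size0nil Ex := sf_size (D_seqfun Dg) gx.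
  by have /size0nil Ey := sf_size (D_seqfun Df) fy; subst.
rewrite st_arr sst_cons; try exact: D_seqfun.
suff E u v : st D (sg n) (iapp (sg n) f (up u)) (iapp (sg n) g (up u)) /\
    is_glb ext (D (sg n)) [set iapp (sg n) f (up v); iapp (sg n) g (up u)]
      (iapp (sg n) f (up u)) <->
    sst (fun x => ap n.+1 f (u :: x)) (fun x => ap n.+1 g (u :: x)) /\
    forall x j, ap n.+1 f (u :: x) j <->
      ap n.+1 f (v :: x) j /\ ap n.+1 g (u :: x) j.
  by split=> H u v luv; apply/E; apply: H luv.
have [Dfu Efu] := iapp_D u Df; have [Dfv Efv] := iapp_D v Df.
have [Dgu Egu] := iapp_D u Dg.
by rewrite (IH _ _ Dfu Dgu) (glb_ext Dfv Dgu Dfu) Efu Efv Egu.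
Qed.

End Model.

(** * Stable meets and joins through traces *)

Section StableBounds.
Variables (D : ty -> set dom) (n : nat).
Hypothesis hD : fmodel D.
Let s := sg n.

Lemma st_tr f g : D s f -> D s g -> st D s f g <-> fle (tr (ap n f)) (tr (ap n g)).
Proof.
move=> Df Dg; rewrite (st_ap hD Df Dg).
by apply: sst_tr; apply: (D_seqfun hD).
Qed.

Lemma st_lub_tr S u : S `<=` D s -> D s u ->
  (forall x j, tr (ap n u) x j <-> exists2 d, S d & tr (ap n d) x j) ->
  is_lub (st D s) (D s) S u.
Proof.
move=> SD Du H; split=> //.
  by move=> d Sd; apply/(st_tr (SD _ Sd) Du) => x j dx; apply/H; exists d.
move=> v Dv Hv; apply/(st_tr Du Dv) => x j /H[d Sd].
by move: x j; apply/(st_tr (SD _ Sd) Dv); apply: Hv.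
Qed.

Lemma st_glb_tr a b m : D s a -> D s b -> D s m ->
  (forall x j, tr (ap n m) x j <-> tr (ap n a) x j /\ tr (ap n b) x j) ->
  is_glb (st D s) (D s) [set a; b] m.
Proof.
move=> Da Db Dm H; split=> //.
  by move=> d [->|->]; apply/st_tr => // x j /H[].
move=> v Dv Hv; apply/(st_tr Dv Dm) => x j vx; apply/H; split.
  exact: (proj1 (st_tr Dv Da) (Hv a (or_introl erefl))).
exact: (proj1 (st_tr Dv Db) (Hv b (or_intror erefl))).
Qed.

Lemma ap_union_tr (F G H : pfun) : seqfun n F -> seqfun n G -> seqfun n H ->
  (forall x j, tr F x j <-> tr G x j \/ tr H x j) ->
  forall x j, F x j <-> G x j \/ H x j.
Proof.
move=> sF sG sH E x j; split.
  move=> /(tr_below (F := F))[z lz /E[[Gz _]|[Hz _]]]; [left|right].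
    exact: (sf_mono sG lz Gz).
  exact: (sf_mono sH lz Hz).
by case=> /(@tr_below _)[z lz tz];
  have [Fz _] : tr F z j by [apply/E; auto];
  exact: (sf_mono sF lz Fz).
Qed.

(** [A] is instantiated with the finite elements of any f-model ([fin_elt_tr]) and with all of [D]
    when [D] has every ideal ([D_tr]), so both versions of (i) to (iii) have one proof. *)
Variable A : set dom.
Hypothesis AD : A `<=` D s.
Hypothesis A_tr : forall a b F, A a -> A b -> seqfun n F ->
  (forall x j, tr F x j -> tr (ap n a) x j \/ tr (ap n b) x j) ->
  exists2 d, A d & ap n d = F.

Lemma glb_tr_ex a b : A a -> A b -> exists2 m, A m &
  forall x j, tr (ap n m) x j <-> tr (ap n a) x j /\ tr (ap n b) x j.
Proof.
move=> Aa Ab; have sa := D_seqfun hD (AD Aa).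
have [|m Am Em] := A_tr (F := restrict (ap n a) (tr (ap n b))) Aa Ab (restrict_seqfun _ sa).
  by move=> x j /tr_restrict[]; left.
by exists m => // x j; rewrite Em tr_restrict.
Qed.

(** The trace of the upper bound [v] contains both traces; it is cut down to their union. [v] need
    not be in [A], but [A_tr] puts the result there. *)
Lemma lub_tr_ex a b : A a -> A b -> compatible (st D s) (D s) a b ->
  exists2 u, A u &
  forall x j, tr (ap n u) x j <-> tr (ap n a) x j \/ tr (ap n b) x j.
Proof.
move=> Aa Ab [v Dv [av bv]]; have sv := D_seqfun hD Dv.
pose P : pfun := fun x j => tr (ap n a) x j \/ tr (ap n b) x j.
have [|u Au Eu] := A_tr (F := restrict (ap n v) P) Aa Ab (restrict_seqfun _ sv).
  by move=> x j /tr_restrict[].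
exists u => // x j; rewrite Eu tr_restrict; split=> [[]//|Px]; split=> //.
case: Px; first exact: (proj1 (st_tr (AD Aa) Dv) av).
exact: (proj1 (st_tr (AD Ab) Dv) bv).
Qed.

Lemma st_lub2_tr a b u : D s a -> D s b -> D s u ->
  (forall x j, tr (ap n u) x j <-> tr (ap n a) x j \/ tr (ap n b) x j) ->
  is_lub (st D s) (D s) [set a; b] u.
Proof.
move=> Da Db Du H; apply: st_lub_tr => //; first by move=> d [->|->].
move=> x j; rewrite H; split=> [[ax|bx]|[d [->|->]]]; auto.
  by exists a => //; left.
by exists b => //; right.
Qed.

Lemma st_glbsP : st_glbs_by_trace D (nseq n Iota) A.
Proof.
move=> a b Aa Ab; have [m Am Hm] := glb_tr_ex Aa Ab.
exists m; first exact: st_glb_tr (AD Aa) (AD Ab) (AD Am) Hm.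
apply/seteqP; split=> -[ys j].
  move=> /(trace_ap hD _ _ (AD Am))[y -> /Hm[ay by_]].
  by split; apply/(trace_ap hD _ _); (try exact: AD); exists y.
move=> [/(trace_ap hD _ _ (AD Aa))[y -> ay] /(trace_ap hD _ _ (AD Ab))[z]].
move=> /(inj_map up_inj) <- by_; apply/(trace_ap hD _ _ (AD Am)).
by exists y => //; apply/Hm.
Qed.

Lemma st_lubsP : st_lubs_by_trace D (nseq n Iota) A.
Proof.
move=> a b Aa Ab cab; have [u Au Hu] := lub_tr_ex Aa Ab cab.
have [Da Db Du] : [/\ D s a, D s b & D s u] by split; apply: AD.
have E := ap_union_tr (D_seqfun hD Du) (D_seqfun hD Da) (D_seqfun hD Db) Hu.
exists u; split.
- exact: st_lub2_tr.
- apply/seteqP; split=> -[ys j].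
    move=> /(trace_ap hD _ _ Du)[y -> /Hu[ay|by_]]; [left|right].
      by apply/(trace_ap hD _ _ Da); exists y.
    by apply/(trace_ap hD _ _ Db); exists y.
  case=> [/(trace_ap hD _ _ Da)|/(trace_ap hD _ _ Db)] [y -> Hy];
    apply/(trace_ap hD _ _ Du); exists y => //; apply/Hu; auto.
- move=> xs /(is_vecP _ _ (D_iota_up hD))[x sx ->].
  have [ua -> Ha] := iapps_up hD Da sx; have [ub -> Hb] := iapps_up hD Db sx.
  have [uu -> Hw] := iapps_up hD Du sx.
  split; first exact: D_up.
    move=> d [->|->]; apply/(ext_up hD) => j Hj; apply/Hw/E; [left|right].
      exact/Ha.
    exact/Hb.
  move=> d /(D_iotaP hD)[v ->] Hv; apply/(ext_up hD) => j /Hw/E[/Ha|/Hb] Hj.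
    exact: (proj1 (ext_up hD ua v) (Hv _ (or_introl erefl))).
  exact: (proj1 (ext_up hD ub v) (Hv _ (or_intror erefl))).
- split=> //.
    by move=> d [->|->]; apply/(D_ext hD (n := n)) => // x j Hx; apply/E; auto.
  move=> v Dv Hv; apply/(D_ext hD Du Dv) => x j /E[].
    exact: (proj1 (D_ext hD Da Dv) (Hv _ (or_introl erefl))).
  exact: (proj1 (D_ext hD Db Dv) (Hv _ (or_intror erefl))).
Qed.

(** On traces this is distributivity of intersection over union. *)
Lemma st_distributiveP : st_distributive D (nseq n Iota) A.
Proof.
move=> a b c Aa Ab Ac cbc.
have [bc Abc Hbc] := lub_tr_ex Ab Ac cbc.
have [ab Aab Hab] := glb_tr_ex Aa Ab; have [ac Aac Hac] := glb_tr_ex Aa Ac.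
have [m Am Hm] := glb_tr_ex Aa Abc.
exists bc, ab, ac, m; split.
- exact: st_lub2_tr (AD Ab) (AD Ac) (AD Abc) Hbc.
- exact: st_glb_tr (AD Aa) (AD Ab) (AD Aab) Hab.
- exact: st_glb_tr (AD Aa) (AD Ac) (AD Aac) Hac.
- exact: st_glb_tr (AD Aa) (AD Abc) (AD Am) Hm.
- apply: st_lub2_tr (AD Aab) (AD Aac) (AD Am) _ => x j.
  by rewrite Hm Hab Hac Hbc; tauto.
Qed.

End StableBounds.

(** By minimality a token of a function bounded by [k] is fixed by truncation at [k]. As all tokens
    of [F] come from [a] or [b], the larger of the two bounds is a bound for [F]. *)
Lemma fin_elt_tr D n (hD : fmodel D) a b F : fin_elt (sg n) a -> fin_elt (sg n) b ->
  seqfun n F ->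
  (forall x j, tr F x j -> tr (ap n a) x j \/ tr (ap n b) x j) ->
  exists2 d, fin_elt (sg n) d & ap n d = F.
Proof.
move=> /(fin_eltP hD)[Da [i Hi]] /(fin_eltP hD)[Db [i' Hi']] sF HF.
have bF : bounded (maxn i i') F.
  move=> x j /(tr_below (F := F))[z lz tz].
  have H d k : bounded k (ap n d) -> k <= maxn i i' -> tr (ap n d) z j ->
      truncf (maxn i i') F x j.
    move=> bd lk [dz mz]; have [lj dkz] := bd _ _ dz.
    have E := mz _ (trunc_le k z) dkz; case: tz => Fz _.
    split; first exact: leq_trans lk.
    apply: (sf_mono sF _ Fz); rewrite -E.
    exact: levec_trans (trunc_mono k lz) (trunc_le_trunc x lk).
  by case: (HF _ _ tz); [apply: H Hi (leq_maxl _ _) | apply: H Hi' (leq_maxr _ _)].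
by have [d fd Ed] := fin_elt_ex sF bF; exists d.
Qed.

(** * Infinite game terms *)

(** An equality test with [v]. Each test for 0 precedes the next [Pred], which is stuck on 0. *)
Fixpoint iseq (v : nat) (M A B : tm) : tm :=
  if v is v'.+1 then tif M B (iseq v' (App Pred M) A B) else tif M A B.

Lemma conv_iseq v M A B j : conv (iseq v M A B) j <->
  exists2 m, conv M m & conv (if m == v then A else B) j.
Proof.
elim: v M => [|v IH] M /=; rewrite conv_tif.
  split=> [[[HM HA]|[m HM HB]]|[[|m] HM Hj]]; [by exists 0 | by exists m.+1 | by left |].
  by right; exists m.
split=> [[[HM HB]|[m HM /IH[m' /conv_Pred Hm' Hj]]]|[[|m] HM Hj]].
- by exists 0.
- by exists m'.+1.
- by left.
- by right; exists m => //; apply/IH; exists m => //; apply/conv_Pred.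
Qed.

Lemma subst_iseq e v M A B :
  subst e (iseq v M A B) = iseq v (subst e M) (subst e A) (subst e B).
Proof. by elim: v M => //= v IH M; rewrite IH. Qed.

Lemma typed_tif G M N K : typed G M Iota -> typed G N Iota -> typed G K Iota ->
  typed G (tif M N K) Iota.
Proof. by move=> tM tN tK; apply: ty_app (ty_app (ty_app (ty_if _) tM) tN) tK. Qed.

Lemma typed_iseq G v M A B : typed G M Iota -> typed G A Iota -> typed G B Iota ->
  typed G (iseq v M A B) Iota.
Proof.
elim: v M => [|v IH] M tM tA tB /=; apply: typed_tif => //.
by apply: IH => //; apply: ty_app (ty_pred _) tM.
Qed.

Lemma levec_set_nth k v z y : levec z y -> k < size y -> nth None y k = Some v ->
  levec (set_nth None z k (Some v)) y.
Proof.
move=> [s H] lk yk; split; first by rewrite size_set_nth s; apply/maxn_idPr.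
by move=> m a; rewrite nth_set_nth /=; case: eqP => [-> [<-]|_ /H].
Qed.

(* [B] follows the decision tree of [F] along [x] and asks for the entry of
   [x] that is missing there, answering [0] as soon as [x] is left. *)
Lemma guard_term n F x : seqfun n F -> size x = n -> (forall j, ~ F x j) ->
  exists B, (forall G, (forall k, k < n -> onth G k = Some Iota) -> typed G B Iota) /\
    forall y e, size y = n -> (forall k, k < n -> e (n - k.+1) = q (nth None y k)) ->
      (forall j, F y j -> exists m, conv (subst e B) m) /\
      (levec y x -> forall m, ~ conv (subst e B) m).
Proof.
move=> sF sx nFx.
suff H z : levec z x -> exists B,
    (forall G, (forall k, k < n -> onth G k = Some Iota) -> typed G B Iota) /\
    forall y e, size y = n -> (forall k, k < n -> e (n - k.+1) = q (nth None y k)) ->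
      levec z y ->
      (forall j, F y j -> exists m, conv (subst e B) m) /\
      (levec y x -> forall m, ~ conv (subst e B) m).
  have [|B [tB HB]] := H (nseq n None).
    by split=> [|k a]; rewrite ?size_nseq ?nth_nseq ?if_same.
  exists B; split=> // y e sy He; apply: HB => //.
  by split=> [|k a]; rewrite ?size_nseq ?nth_nseq ?if_same.
have [d] := ubnP (count_mem None z); elim: d z => // d IH z lz lzx.
have sz : size z = n by case: lzx => ->.
case: (sf_seq sF sz) => [[j Fz]|[k [zk Hk]]].
  by case: (nFx j); apply: (sf_mono sF lzx Fz).
have [lk|lk] := ltnP k n; last first.
  (* Here [F] has no value above [z], so nothing obliges the guard to converge. *)
  exists (Omega Iota); split=> [G _|y e sy _ lzy]; first by constructor.
  split=> [j Fy|_ m /not_conv_Omega//].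
  by case: (Hk _ _ lzy Fy); rewrite nth_default ?sy.
case xk: (nth None x k) => [v|]; last first.
  (* The needed entry is missing in [x], so the question itself is the guard: it is answered
     wherever [F] is defined above [z], and at no [y] below [x]. *)
  exists (Var (n - k.+1)); split=> [G HG|y e sy He lzy].
    by constructor; apply: HG; lia.
  rewrite /= He //; split=> [j Fy|lyx m /conv_q yk].
    have := Hk _ _ lzy Fy; case: (nth None y k) => // m _.
    by exists m; apply/conv_q.
  by case: lyx => _ /(_ _ _ yk); rewrite xk.
have [||B [tB HB]] := IH (set_nth None z k (Some v)).
- have : has (pred1 None) z.
    by apply/hasP; exists None => //; rewrite -[X in X \in _]zk mem_nth ?sz.
  rewrite has_count count_set_nth_ltn ?sz // zk => c0.
  by change (count_mem None z + 0 - 1 < d); lia.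
- by apply: levec_set_nth; rewrite ?sx.
exists (iseq v (Var (n - k.+1)) B (Cst 0)); split=> [G HG|y e sy He lzy].
  by apply: typed_iseq; [constructor; apply: HG; lia | exact: tB | constructor].
rewrite subst_iseq /= He //; split=> [j Fy|lyx m /conv_iseq[v' /conv_q yk]].
  have := Hk _ _ lzy Fy; case yk: (nth None y k) => [v'|] // _.
  have [E|ne] := eqVneq v' v.
    subst v'; have [|Hy _] := HB y e sy He; first by apply: levec_set_nth; rewrite ?sy.
    have [m Hm] := Hy _ Fy; exists m; apply/conv_iseq; exists v; rewrite ?eqxx //.
    exact/conv_Cst.
  exists 0; apply/conv_iseq; exists v'; rewrite ?(negbTE ne); exact/conv_Cst.
have E : v' = v by case: (lyx) => _ /(_ _ _ yk); rewrite xk => -[].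
subst v'; rewrite eqxx; have [|_ Hy] := HB y e sy He; last exact: Hy.
by apply: levec_set_nth; rewrite ?sy.
Qed.

Lemma onth_nseq_cat T n (a b : T) k : onth (nseq n a ++ [:: b]) k =
  if k < n then Some a else if k == n then Some b else None.
Proof.
by elim: n k => [|m IH] [|k] //=; case: k.

Qed.

Section Guard.
Variables (n : nat) (B : tm).
Hypothesis tB : forall G, (forall k, k < n -> onth G k = Some Iota) -> typed G B Iota.

(* [fun f y => f y], but undefined when [B] is. *)
Definition guarded : tm :=
  let fy := apps (Var n) [seq Var (n - k.+1) | k <- iota 0 n] in
  foldr Lam (tif B fy fy) (sg n :: nseq n Iota).

Lemma guarded_closed : closed_tm (Arr (sg n) (sg n)) guarded.
Proof.
have -> : Arr (sg n) (sg n) = foldr Arr Iota (sg n :: nseq n Iota) by [].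
apply: typed_lams; rewrite /= catrevE rev_nseq.
set G := _ ++ _; have tfy : typed G (apps (Var n) [seq Var (n - k.+1) | k <- iota 0 n]) Iota.
  apply: (typed_apps (ss := nseq n Iota)).
    by constructor; rewrite onth_nseq_cat ltnn eqxx.
  apply/(Forall2_nseq (A := fun N => typed G N Iota)) => //.
  rewrite size_map size_iota; split=> // N /In_map[k Hk ->].
  constructor; rewrite onth_nseq_cat; case: ifP => // /negbT.
  have : k \in iota 0 n by elim: (iota 0 n) Hk => //= a l IH [->|/IH H]; rewrite inE ?eqxx ?H ?orbT.
  by rewrite mem_iota => lk; lia.
apply: typed_tif => //; apply: tB => k lk.
by rewrite onth_nseq_cat lk.
Qed.

Lemma conv_guarded N y j : closed_tm (sg n) N -> size y = n ->
  conv (apps (App guarded N) (map q y)) j <->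
  (exists m, conv (subst (extend (N :: map q y) Var) B) m) /\
  conv (apps N (map q y)) j.
Proof.
move=> tN sy; set e := extend _ _.
rewrite -[apps (App _ _) _]/(apps guarded (N :: map q y)) -{1}[guarded]subst_Var.
rewrite conv_lams /= ?size_map ?sy ?size_nseq // -/(extend _ _) -/e.
rewrite -/(tif _ _ _) subst_apps.
have -> : subst e (Var n) = N.
  by rewrite /= /e /extend /= -/(extend _ _) -[n]addn0 -[in n + 0]sy -(size_map q) extend_shift.
have -> : map (subst e) [seq Var (n - k.+1) | k <- iota 0 n] = map q y.
  apply: (@eq_from_nth _ (Cst 0)); rewrite !size_map size_iota ?sy // => k lk.
  rewrite -map_comp (nth_map 0) ?size_iota // nth_iota //=.
  have <- := @extend_nth (map q y) (scons N Var) k; last by rewrite size_map sy.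
  by rewrite size_map sy.
rewrite conv_tif; split.
  by case=> [[H0 Hj]|[m Hm Hj]]; split=> //; [exists 0 | exists m.+1].
by case=> -[[|m] Hm] Hj; [left | right; exists m].
Qed.

End Guard.

Section GuardedElement.
Variables (D : ty -> set dom) (n : nat) (B : tm) (u : dom).
Hypothesis hD : fmodel D.
Hypothesis tB : forall G, (forall k, k < n -> onth G k = Some Iota) -> typed G B Iota.
Hypothesis Du : D (sg n) u.
Let s := sg n.
Let T := guarded n B.
Let tT : closed_tm (Arr s s) T := guarded_closed tB.

(** Formed by application from a denotation and [u], so that it lies in [D] whatever the f-model
    is. *)
Definition guarded_elt : dom := iapp s (den (Arr s s) T) u.

Lemma guarded_elt_D : D s guarded_elt.
Proof.
have [_ app dn] := hD; apply: (app s s) => //.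
exact: dn.
Qed.

Lemma FPT_closed i : closed_tm (Arr s s) (App (FP (Arr s s) i) T).
Proof. exact: FP_closed. Qed.

(** The projection at the arrow type wraps the application in [FP] twice, around the argument [N]
    and around the result. On behaviours both come down to truncation at [i]. *)
Lemma beh_FPT i N y j : closed_tm s N ->
  beh n (App (App (FP (Arr s s) i) T) N) y j <->
  [/\ j <= i, exists m, conv (subst (extend (App (FP s i) N :: map q (trunc i y)) Var) B) m
    & beh n N (trunc i y) j].
Proof.
move=> tN; have tN' : closed_tm s (App (FP s i) N) by apply: FP_closed.
have tTN : closed_tm s (App T (App (FP s i) N)) by apply: ty_app tT tN'.
transitivity (beh n (App (FP s i) (App T (App (FP s i) N))) y j).
  by rewrite /beh conv_FP_arr.
rewrite (beh_FP i y j tTN) /beh size_trunc; split.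
  move=> [lj [sy]]; rewrite conv_guarded ?size_trunc // => -[Hm Hj].
  split=> //; have : beh n (App (FP s i) N) (trunc i y) j by split; rewrite ?size_trunc.
  by move/(beh_FP i _ j tN) => [_]; rewrite trunc_trunc minnn => -[].
move=> [lj Hm HN]; split=> //; have [sy _] := HN.
split=> //; apply/conv_guarded => //; rewrite ?size_trunc //; split=> //.
have [] : beh n (App (FP s i) N) (trunc i y) j; last by [].
by apply/(beh_FP i _ j tN); rewrite trunc_trunc minnn /beh size_trunc.
Qed.

Lemma guarded_elt_undef x j : size x = n ->
  (forall y e, size y = n -> (forall k, k < n -> e (n - k.+1) = q (nth None y k)) ->
    levec y x -> forall m, ~ conv (subst e B) m) ->
  ~ ap n guarded_elt x j.
Proof.
move=> sx HB [C [M [[fC [_ [f' f'T [d' ud' <-]] le]] CM Mx]]].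
have /finP[k [M0 [tM0 EC _]]] := fC.
have [tM _] : closed_tm s M /\ beh n M = beh n M0 by apply: eqclass_beh => //; rewrite -EC.
have [ff' [_ [i _ <-] le']] := f'T.
have [i' _ [P0 tP0 Ef']] := ff'.
pose M1 := App (FP (Arr s s) i') P0.
have tM1 : closed_tm (Arr s s) M1 by apply: FP_closed.
have f'M1 : f' M1 by rewrite -Ef'; apply: eqclass_self.
have [df _ _] := D_idl hD Du; have /finP[i2 [N [tN Ed' _]]] := df _ ud'.
have tMN : closed_tm s (App M1 N) by apply: ty_app tM1 tN.
have tTN : closed_tm s (App (App (FP (Arr s s) i) T) N) by apply: ty_app (FPT_closed i) tN.
have leM : obs_le M (App M1 N).
  apply: le CM _; exists M1, N; split=> //; last exact: eqclass_self.
  by rewrite Ed'; apply: eqclass_self.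
have le1 : obs_le (App M1 N) (App (App (FP (Arr s s) i) T) N).
  apply: (@obs_le_plug (CAppL Hole N)); apply: le' => //.
  exact: eqclass_self (FPT_closed i).
have := proj1 (obs_le_beh tMN tTN) le1 _ _ (proj1 (obs_le_beh tM tMN) leM _ _ Mx).
(* The guard is run on [trunc i x], which is still below [x], where it diverges. *)
rewrite beh_FPT // => -[_ [m Hm] _]; apply: (HB (trunc i x) _ _ _ (trunc_le i x)) Hm.
  by rewrite size_trunc.
move=> l ll; have := @extend_nth (map q (trunc i x)) (scons (App (FP s i) N) Var) l.
by rewrite size_map size_trunc sx nth_map_q ?size_trunc ?sx // => <-.
Qed.

Lemma guarded_elt_ub y j :
  (forall e, (forall k, k < n -> e (n - k.+1) = q (nth None y k)) ->
    exists m, conv (subst e B) m) ->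
  ap n u y j -> ap n guarded_elt y j.
Proof.
move=> HB [C [N [uC CN Ny]]]; have [tN EC _] := idlP (D_idl hD Du) uC CN.
have sy : size y = n by case: Ny.
(* At this level the projection changes neither the arguments [y] nor the value [j]. *)
have [i0 Hi0] := trunc_large y; pose i := maxn i0 j.
have ty_ : trunc i y = y by apply: Hi0; apply: leq_maxl.
pose K := App (App (FP (Arr s s) i) T) N.
have tK : closed_tm s K by apply: ty_app (FPT_closed i) tN.
have Ky : beh n K y j.
  apply/beh_FPT => //; rewrite ty_; split=> //; first exact: leq_maxr.
  apply: HB => k lk.
  have := @extend_nth (map q y) (scons (App (FP s i) N) Var) k.
  by rewrite size_map sy nth_map_q ?sy // => <-.
have [i2 Hi2] := truncf_ub (beh_seqfun tK) Ky.
pose M := App (FP s i2) K; have tM : closed_tm s M by apply: FP_closed.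
have MK : beh n M = truncf i2 (beh n K) by apply: beh_FP_truncf.
exists (eqclass s M), M; split; [|exact: eqclass_self|by rewrite MK; apply: Hi2].
split; first exact: fin_FP.
exists (class_app s (eqclass (Arr s s) (App (FP (Arr s s) i) T)) C).
  exists (eqclass (Arr s s) (App (FP (Arr s s) i) T)); last by exists C.
  have f : fin (Arr s s) (eqclass (Arr s s) (App (FP (Arr s s) i) T)).
    by exists i => //; exists T.
  split=> //; exists (eqclass (Arr s s) (App (FP (Arr s s) i) T)); first by exists i.
  move=> P Q [tP TP PT] [tQ TQ QT].
  exact: obs_le_trans tP (FPT_closed i) PT TQ.
move=> P L /(eqclass_beh tM)[tP EP] [M1 [N1 [[tM1 TM1 _]]]].
rewrite EC => -[tN1 NN1 _] HL.
have tMN : closed_tm s (App M1 N) by apply: ty_app tM1 tN.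
have tMN1 : closed_tm s (App M1 N1) by apply: ty_app tM1 tN1.
have [tL EL] := eqclass_beh tMN1 HL.
apply/(obs_le_beh tP tL) => z m; rewrite EP EL MK => /(truncf_le (beh_seqfun tK)) Kz.
apply: (proj1 (obs_le_beh tMN tMN1)).
  exact: (@obs_le_plug (CAppR M1 Hole)).
apply: (proj1 (obs_le_beh tK tMN)) Kz.
exact: (@obs_le_plug (CAppL Hole N)).
Qed.

End GuardedElement.

Section Greatest.
Variables (D : ty -> set dom) (n : nat).
Hypothesis hD : fmodel D.
Let s := sg n.

Definition tree_ideal F (sF : seqfun n F) : set gtm :=
  [set g | game_term s g /\ exists i, syn_le g (approx_tree sF i)].

Lemma tree_ideal_inf F (sF : seqfun n F) : infinite_game_term s (tree_ideal sF).
Proof.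
have mem i : tree_ideal sF (approx_tree sF i).
  by split; [apply: approx_tree_typed | exists i; apply: syn_le_refl].
split; first by move=> g [].
  split; first by exists (approx_tree sF 0).
  move=> g g' [_ [i Hi]] [_ [i' Hi']]; exists (approx_tree sF (maxn i i')) => //.
  split; [apply: syn_le_trans Hi _ | apply: syn_le_trans Hi' _]; apply: tree_le.
    exact: leq_maxl.
  exact: leq_maxr.
move=> g g' tg [_ [i Hi]] le; split=> //; exists i; exact: syn_le_trans le Hi.
Qed.

(* The lub [u] in [D] of the approximations of [F] is no larger than [F]:
   where [F] is undefined, so is a guarded version of [u], which is still an
   upper bound. *)
Lemma greatest :
  (forall G, infinite_game_term s G -> exists d, game_denotation D s G d) ->
  D s = greatest_fmodel s.
Proof.
move=> H; apply/seteqP; split=> [d /(D_idl hD)//|d id].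
have sF := ap_seqfun id.
have [u [Du ub lst]] := H _ (tree_ideal_inf sF).
have closed g : game_term s g -> closed_tm s (tm_of_game g) by apply: game_typed_tm.
have leF g y m : tree_ideal sF g -> beh n (tm_of_game g) y m -> ap n d y m.
  move=> [tg [i /syn_le_apx ag]] [sy gy].
  have : beh n (tm_of_game (approx_tree sF i)) y m.
    split=> //; apply: apx_conv gy; apply: apx_apps => //.
    by apply: Forall2_refl => N _; constructor.
  by rewrite beh_approx_tree //; apply: (sf_mono sF (trunc_le i y)).
have Fu : fle (ap n d) (ap n u).
  move=> x j dx; have [i Hi] := trunc_large x.
  have sx := sf_size sF dx.
  have tg := approx_tree_typed sF i.
  have le : ext (den s (tm_of_game (approx_tree sF i))) u.
    apply: ub; exists (approx_tree sF i) => //.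
    by split=> //; exists i; apply: syn_le_refl.
  apply: (proj1 (D_ext hD (D_den hD (closed _ tg)) Du) le).
  by rewrite ap_den ?beh_approx_tree ?Hi //; apply: closed.
suff E : ap n d = ap n u by rewrite (ap_inj id (D_idl hD Du) E).
apply: fle_anti => // x j ux; apply: contrapT => ndx.
have sx := sf_size (D_seqfun hD Du) ux.
have [|B [tB HB]] := guard_term sF sx.
  move=> j' dx; apply: ndx.
  by rewrite (sf_fun (D_seqfun hD Du) ux (Fu _ _ dx)).
have Dv := guarded_elt_D hD tB Du.
have : ext u (guarded_elt n B u).
  apply: lst => // _ [g Gg <-]; have [tg _] := Gg.
  apply/(D_ext hD (D_den hD (closed _ tg)) Dv) => y m.
  rewrite ap_den => [gy|]; last exact: closed.
  have dy := leF _ _ _ Gg gy.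
  apply: (guarded_elt_ub hD tB Du) => [e He|]; last exact: Fu.
  by have [Hy _] := HB y e (sf_size sF dy) He; apply: Hy dy.
move/(D_ext hD Du Dv)/(_ x j ux); apply: (guarded_elt_undef hD tB Du) => // y e sy He.
by have [_] := HB y e sy He.
Qed.

End Greatest.

(** * Bidomain structure *)

Lemma lub_unique T (le : T -> T -> Prop) X S u u' : partial_order le X ->
  is_lub le X S u -> is_lub le X S u' -> u = u'.
Proof. by move=> [_ anti _] [Xu ub l] [Xu' ub' l']; apply: anti; auto. Qed.

Lemma directed_image T U (leT : T -> T -> Prop) (leU : U -> U -> Prop)
    (f : T -> U) S :
  (forall a b, S a -> S b -> leT a b -> leU (f a) (f b)) ->
  directed leT S -> directed leU (f @` S).
Proof.
move=> mono [[a Sa] dir]; split; first by exists (f a), a.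
move=> _ _ [b Sb <-] [c Sc <-]; have [e Se [be ce]] := dir _ _ Sb Sc.
by exists (f e); [exists e | split; apply: mono].
Qed.

Section Bidomain.
Variables (D : ty -> set dom) (n : nat).
Hypothesis hD : fmodel D.
Hypothesis D_max : D (sg n) = greatest_fmodel (sg n).
Let s := sg n.
Let X := D s.
Let S_ := st D s.

Lemma D_realP F : seqfun n F -> X (real n F) /\ ap n (real n F) = F.
Proof.
by move=> sF; split; [rewrite /X D_max; apply: real_idl | apply: ap_real].
Qed.

Lemma ext_po : partial_order ext X.
Proof.
split=> [a _ //|a b _ _ ab ba|a b c _ _ _ ab bc]; first exact/seteqP.
exact: subset_trans bc.
Qed.

Lemma st_ext a b : X a -> X b -> S_ a b -> ext a b.
Proof. by move=> Xa Xb /(st_ap hD Xa Xb)[H _]; apply/(D_ext hD Xa Xb). Qed.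

Lemma st_po : partial_order S_ X.
Proof.
split=> [a Xa|a b Xa Xb ab ba|a b c Xa Xb Xc].
- by apply/(st_ap hD Xa Xa); apply: sst_refl.
- by have [_ anti _] := ext_po; apply: anti => //; apply: st_ext.
- move=> /(st_ap hD Xa Xb) ab /(st_ap hD Xb Xc) bc; apply/(st_ap hD Xa Xc).
  exact: sst_trans ab bc.
Qed.

Definition sup_of (S : set dom) (u : dom) : Prop :=
  forall x j, ap n u x j <-> exists2 d, S d & ap n d x j.

Lemma ext_lub_sup S u : S `<=` X -> X u -> sup_of S u -> is_lub ext X S u.
Proof.
move=> SX Xu Hu; split=> // [d Sd|v Xv Hv].
  by apply/(D_ext hD (SX _ Sd) Xu) => x j dx; apply/Hu; exists d.
apply/(D_ext hD Xu Xv) => x j /Hu[d Sd].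
by move: x j; apply/(D_ext hD (SX _ Sd) Xv); apply: Hv.
Qed.

Lemma st_lub_sup S u : S `<=` X -> directed S_ S -> X u -> sup_of S u ->
  is_lub S_ X S u.
Proof.
move=> SX [S0 dS] Xu Hu; split=> // [d Sd|v Xv Hv].
  have Xd := SX _ Sd; apply/(st_ap hD Xd Xu); split.
    by move=> x j dx; apply/Hu; exists d.
  move=> x y j lxy dy /Hu[d' Sd' dx']; have Xd' := SX _ Sd'.
  have [c Sc [dc d'c]] := dS _ _ Sd Sd'; have Xc := SX _ Sc.
  have [_ dcs] := proj1 (st_ap hD Xd Xc) dc.
  by apply: dcs lxy dy _; apply: (proj1 (proj1 (st_ap hD Xd' Xc) d'c)).
have sst_v d : S d -> sst (ap n d) (ap n v).
  by move=> Sd; apply/(st_ap hD (SX _ Sd) Xv); apply: Hv.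
apply/(st_ap hD Xu Xv); split.
  by move=> x j /Hu[d /sst_v[dv _]]; apply: dv.
move=> x y j lxy /Hu[d Sd dy] vx; apply/Hu; exists d => //.
by have [_ dv] := sst_v _ Sd; apply: dv lxy dy vx.
Qed.

(** A directed union of ideals is an ideal, and it lies in [D] because [D] has all ideals. *)
Lemma directed_sup S : S `<=` X -> directed ext S -> exists2 u, X u & sup_of S u.
Proof.
move=> SX [[d0 Sd0] dS]; exists (\bigcup_(d in S) d); last first.
  move=> x j; split.
    by move=> [C [M [[d Sd dC] CM Mx]]]; exists d => //; exists C, M.
  by move=> [d Sd [C [M [dC CM Mx]]]]; exists C, M; split=> //; exists d.
have id d : S d -> idl n d by move/SX/(D_idl hD).
rewrite /X D_max; split.
- by move=> C [d /id[df _ _]]; apply: df.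
- split.
    by have [_ [[C dC] _] _] := id _ Sd0; exists C, d0.
  move=> C C' [d Sd dC] [d' Sd' dC'].
  have [e Se [de d'e]] := dS _ _ Sd Sd'; have [_ [_ dir] _] := id _ Se.
  have [C2 eC2 H] := dir C C' (de _ dC) (d'e _ dC').
  by exists C2 => //; exists e.
- move=> C C' fC [d Sd dC'] le; exists d => //.
  by have [_ _ dn] := id _ Sd; apply: dn le.
Qed.

(** The bicpo and continuity clauses quantify over arbitrary lubs; by uniqueness these are the
    pointwise ones. *)
Lemma ext_lubP S u : S `<=` X -> directed ext S -> is_lub ext X S u ->
  X u /\ sup_of S u.
Proof.
move=> SX dS lu; have [v Xv Hv] := directed_sup SX dS.
by rewrite (lub_unique ext_po lu (ext_lub_sup SX Xv Hv)).
Qed.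

Lemma st_directed_ext S : S `<=` X -> directed S_ S -> directed ext S.
Proof.
move=> SX [S0 dS]; split=> // a b Sa Sb; have [c Sc [ac bc]] := dS _ _ Sa Sb.
by exists c => //; split; apply: st_ext => //; apply: SX.
Qed.

Lemma st_lubP S u : S `<=` X -> directed S_ S -> is_lub S_ X S u ->
  X u /\ sup_of S u.
Proof.
move=> SX dS lu; have [v Xv Hv] := directed_sup SX (st_directed_ext SX dS).
by rewrite (lub_unique st_po lu (st_lub_sup SX dS Xv Hv)).
Qed.

Lemma ap_bot : X (bot s) /\ forall x j, ~ ap n (bot s) x j.
Proof.
have tO : closed_tm s (Omega s) by constructor.
split; first exact: D_den.
move=> x j; rewrite ap_den // => -[_ H]; apply: not_conv_dead H.
by apply: dead_apps; constructor.
Qed.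

Definition meet (a b : dom) : dom := real n (meetf (ap n a) (ap n b)).

Lemma meetP a b : X a -> X b -> X (meet a b) /\ ap n (meet a b) = meetf (ap n a) (ap n b).
Proof. by move=> Xa Xb; apply: D_realP; apply: meetf_seqfun; apply: (D_seqfun hD). Qed.

Lemma meet_continuous :
  scott_continuous (prod_le ext) (X `*` X) ext X (fun p => meet p.1 p.2).
Proof.
split=> [p [X1 X2]|S u SX dS [[Xu1 Xu2] ub lu]]; first by case: (meetP X1 X2).
have S1X : fst @` S `<=` X by move=> _ [p /SX[Xp _] <-].
have S2X : snd @` S `<=` X by move=> _ [p /SX[_ Xp] <-].
have [v1 Xv1 Hv1] := directed_sup S1X (directed_image (leU := ext) (fun p p' _ _ l => proj1 l) dS).
have [v2 Xv2 Hv2] := directed_sup S2X (directed_image (leU := ext) (fun p p' _ _ l => proj2 l) dS).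
have [_ ub1 _] := ext_lub_sup S1X Xv1 Hv1; have [_ ub2 _] := ext_lub_sup S2X Xv2 Hv2.
(* [u] is a lub of pairs and not known to be componentwise; comparison with the pair of
   componentwise sups bounds its components by pointwise unions. *)
have [le1 le2] : prod_le ext u (v1, v2).
  by apply: lu => // p Sp; split; [apply: ub1 | apply: ub2]; exists p.
have [Xm Em] := meetP Xu1 Xu2.
apply: ext_lub_sup => //.
  by move=> _ [p /SX[Xp1 Xp2] <-]; case: (meetP Xp1 Xp2).
move=> x j; rewrite Em; split.
  move=> [/(proj1 (D_ext hD Xu1 Xv1) le1)/Hv1[_ [p Sp <-] px]].
  move=> /(proj1 (D_ext hD Xu2 Xv2) le2)/Hv2[_ [p' Sp' <-] px'].
  have [_ dir] := dS; have [r Sr [[pr _] [_ pr']]] := dir _ _ Sp Sp'.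
  have [[Xp1 Xp2] [Xp1' Xp2']] := (SX _ Sp, SX _ Sp'); have [Xr1 Xr2] := SX _ Sr.
  exists (meet r.1 r.2); first by exists r.
  have [_ ->] := meetP Xr1 Xr2; split.
    exact: (proj1 (D_ext hD Xp1 Xr1) pr).
  exact: (proj1 (D_ext hD Xp2' Xr2) pr').
move=> [_ [p Sp <-]]; have [Xp1 Xp2] := SX _ Sp.
have [_ ->] := meetP Xp1 Xp2; have [l1 l2] := ub _ Sp => -[x1 x2]; split.
  exact: (proj1 (D_ext hD Xp1 Xu1) l1).
exact: (proj1 (D_ext hD Xp2 Xu2) l2).
Qed.

Lemma sg_bicpo : bicpo X ext S_ (bot s).
Proof.
have [Xb bE] := ap_bot; split.
- split=> //; first exact: ext_po.
    by move=> a Xa; apply/(D_ext hD Xb Xa) => x j /bE.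
  move=> S SX dS; have [u Xu Hu] := directed_sup SX dS.
  by exists u; apply: ext_lub_sup.
- exists meet; split; last 1 first.
  + move=> a a' b b' Xa Xa' Xb_ Xb' /(st_ap hD Xa Xa')[aa saa] /(st_ap hD Xb_ Xb')[bb sbb].
    have [Xm Em] := meetP Xa Xb_; have [Xm' Em'] := meetP Xa' Xb'.
    apply/(st_ap hD Xm Xm'); rewrite Em Em'; split.
      by move=> x j [/aa ax /bb bx].
    by move=> x y j lxy [ay by_] [ax bx]; split; [apply: saa ay ax | apply: sbb by_ bx].
  + move=> a b Xa Xb_; have [Xm Em] := meetP Xa Xb_.
    by apply/(glb_ext hD Xa Xb_ Xm) => x j; rewrite Em.
  + exact: meet_continuous.
- split.
  + split=> //; first exact: st_po.
      by move=> a Xa; apply/(st_ap hD Xb Xa); split=> [x j /bE //|x y j _ /bE].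
    move=> S SX dS; have [u Xu Hu] := directed_sup SX (st_directed_ext SX dS).
    by exists u; apply: st_lub_sup.
  + exact: st_ext.
  + by move=> S u SX dS /(st_lubP SX dS)[Xu Hu]; apply: ext_lub_sup.
- move=> S S' SX SX' dS dS' H u u'.
  move=> /(ext_lubP SX (st_directed_ext SX dS))[Xu Hu].
  move=> /(ext_lubP SX' (st_directed_ext SX' dS'))[Xu' Hu'].
  have HH a a' : S a -> S' a' -> exists b b', [/\ S b, S' b', fle (ap n a) (ap n b),
      fle (ap n a') (ap n b') & sst (ap n b) (ap n b')].
    move=> Sa Sa'; have [b [b' [Sb Sb' ab ab' bb]]] := H _ _ Sa Sa'.
    have [Xa Xa' Xb_ Xb'] : [/\ X a, X a', X b & X b'] by split; auto.
    exists b, b'; split=> //; [exact/(D_ext hD Xa Xb_)|exact/(D_ext hD Xa' Xb')|].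
    exact/(st_ap hD Xb_ Xb').
  apply/(st_ap hD Xu Xu'); split.
    move=> x j /Hu[a Sa ax]; have [[a' Sa'] _] := dS'.
    have [b [b' [_ Sb' ab _ [bb _]]]] := HH _ _ Sa Sa'.
    by apply/Hu'; exists b' => //; apply: bb; apply: ab.
  move=> x y j lxy /Hu[a Sa ay] /Hu'[a' Sa' ax].
  have [b [b' [Sb _ ab ab' [_ bb]]]] := HH _ _ Sa Sa'.
  by apply/Hu; exists b => //; apply: bb lxy (ab _ _ ay) (ab' _ _ ax).
Qed.

Lemma D_tr a b F : X a -> X b -> seqfun n F ->
  (forall x j, tr F x j -> tr (ap n a) x j \/ tr (ap n b) x j) ->
  exists2 d, X d & ap n d = F.
Proof. by move=> _ _ sF _; exists (real n F); case: (D_realP sF). Qed.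

Lemma sg_distributive_bicpo : distributive_bicpo X ext S_ (bot s).
Proof.
have sX : X `<=` D s by [].
split.
- exact: sg_bicpo.
- move=> S SX [v Xv Sv].
  (* As for pairs, the upper bound [v] is cut down to the union of the traces. *)
  pose P : pfun := fun x j => exists2 d, S d & tr (ap n d) x j.
  have [Xu Eu] := D_realP (restrict_seqfun P (D_seqfun hD Xv)).
  exists (real n (restrict (ap n v) P)); apply: (st_lub_tr hD SX Xu) => x j.
  rewrite Eu tr_restrict; split=> [[]//|[d Sd dx]]; split; last by exists d.
  exact: (proj1 (st_tr hD (SX _ Sd) Xv) (Sv _ Sd)).
- exact: (st_distributiveP hD sX D_tr).
- move=> a b u Xa Xb lu; have [Xu ub _] := lu.
  have cab : compatible S_ X a b.
    by exists u => //; split; apply: ub; [left | right].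
  have [u' [lu' _ _ eu']] := st_lubsP hD sX D_tr Xa Xb cab.
  by rewrite (lub_unique st_po lu lu').
Qed.

Definition proj i (d : dom) : dom := real n (truncf i (ap n d)).

Lemma projP i d : X d -> X (proj i d) /\ ap n (proj i d) = truncf i (ap n d).
Proof. by move=> Xd; apply: D_realP; apply: truncf_seqfun; apply: (D_seqfun hD). Qed.

Lemma proj_sup i S u : S `<=` X -> sup_of S u -> X u ->
  [/\ proj i @` S `<=` X, X (proj i u) & sup_of (proj i @` S) (proj i u)].
Proof.
move=> SX Hu Xu; have [Xp Ep] := projP i Xu; split=> //.
  by move=> _ [d /SX Xd <-]; case: (projP i Xd).
move=> x j; rewrite Ep; split.
  move=> [lj /Hu[d Sd dx]]; exists (proj i d); first by exists d.
  by have [_ ->] := projP i (SX _ Sd).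
move=> [_ [d Sd <-]]; have [_ ->] := projP i (SX _ Sd).
by move=> [lj dx]; split=> //; apply/Hu; exists d.
Qed.

Lemma proj_st i j a b : i <= j -> X a -> X b -> S_ a b -> S_ (proj i a) (proj j b).
Proof.
move=> lij Xa Xb /(st_ap hD Xa Xb) ab.
have [Xpa Ea] := projP i Xa; have [Xpb Eb] := projP j Xb.
apply/(st_ap hD Xpa Xpb); rewrite Ea Eb.
exact: truncf_sst lij (D_seqfun hD Xa) ab.
Qed.

(** The case of an infinite upper level in [truncf_sst]: a value of [d] at [x] is already a value of
    some truncation beyond [i], to which the finite case applies. *)
Lemma proj_le_id i d : X d -> S_ (proj i d) d.
Proof.
move=> Xd; have sd := D_seqfun hD Xd; have [Xp Ep] := projP i Xd.
apply/(st_ap hD Xp Xd); rewrite Ep; split; first exact: truncf_le sd.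
move=> x y j lxy py dx; have [i' Hi'] := truncf_ub sd dx.
have [_ H] := truncf_sst (leq_maxl i i') sd (sst_refl (ap n d)).
by apply: H lxy py _; apply: Hi'; apply: leq_maxr.
Qed.

Lemma proj_lub d : X d -> is_lub S_ X (range (fun i => proj i d)) d.
Proof.
move=> Xd; have refl : S_ d d by have [r _ _] := st_po; apply: r.
apply: st_lub_sup => //.
- by move=> _ [i _ <-]; case: (projP i Xd).
- split; first by exists (proj 0 d), 0.
  move=> _ _ [i _ <-] [j _ <-]; exists (proj (maxn i j) d); first by exists (maxn i j).
  by split; apply: proj_st; rewrite ?leq_maxl ?leq_maxr.
- move=> x j; split.
    move=> dx; have [i Hi] := truncf_ub (D_seqfun hD Xd) dx.
    exists (proj i d); first by exists i.
    by have [_ ->] := projP i Xd; apply: Hi.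
  move=> [_ [i _ <-]]; have [_ ->] := projP i Xd.
  exact: (truncf_le (i := i) (D_seqfun hD Xd) (x := x)).
Qed.

(* [proj i d] is determined by the part of the graph of [d] in a finite set. *)
Lemma proj_finite i : finite_set (proj i @` X).
Proof.
have [L HL] := all_vectors n i.
pose P := [seq (x, m) | x <- L, m <- iota 0 i.+1].
pose g (t : {ffun 'I_(size P) -> bool}) : dom := real n (fun x m =>
  [/\ m <= i, size x = n & exists2 k, t k & tnth (in_tuple P) k = (trunc i x, m)]).
apply: (@sub_finite_set _ _ (g @` setT)); last exact/finite_image/finite_finset.
move=> _ [d Xd <-]; have sd := D_seqfun hD Xd.
exists [ffun k => `[< let p := tnth (in_tuple P) k in ap n d p.1 p.2 >]] => //.
rewrite /g /proj; congr (real n _); apply: fle_anti => x m.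
  move=> [lm sx [k]]; rewrite ffunE => /asboolP/= H E.
  by rewrite E in H.
move=> [lm dx]; have sx : size x = n by rewrite -(size_trunc i) (sf_size sd dx).
split=> //; have Pxm : (trunc i x, m) \in P.
  by apply: (allpairs_f (fun x m => (x, m))); [apply: HL | rewrite mem_iota].
have /tnthP[k Ek] : (trunc i x, m) \in in_tuple P by [].
by exists k => //; rewrite ffunE -Ek; apply/asboolP.
Qed.

Lemma sg_bidomain : bidomain X ext S_ (bot s).
Proof.
split; first exact: sg_distributive_bicpo.
have refl a : X a -> S_ a a by have [r _ _] := st_po; apply: r.
exists proj; split; [|split; last exact: proj_lub].
  move=> i j lij; split=> [x Xx|x y Xx Xy xy]; first by apply: proj_st => //; apply: refl.
  have [[Xpx Epx] [Xpy Epy]] := (projP i Xx, projP i Xy); have [Xqx Eqx] := projP j Xx.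
  apply/(glb_ext hD Xpy Xqx Xpx) => z m; rewrite Epx Epy Eqx.
  have [xy1 xy2] := proj1 (st_ap hD Xx Xy) xy; have sx := D_seqfun hD Xx.
  split=> [[lm xz]|[[lm yz] [_ xz]]].
    split; first by split=> //; apply: xy1.
    split; [exact: leq_trans lij | exact: (sf_mono sx (trunc_le_trunc z lij) xz)].
  (* Stability is used between [trunc i z] and [trunc j z]: [x] has the value at the larger vector
     and [y] at the smaller one. *)
  by split=> //; apply: xy2 (trunc_le_trunc z lij) xz yz.
move=> i; split.
- split=> [x Xx|S u SX dS lu]; first by case: (projP i Xx).
  have [Xu Hu] := ext_lubP SX dS lu; have [pSX Xp Hp] := proj_sup i SX Hu Xu.
  exact: ext_lub_sup.
- split=> [x Xx|S u SX dS lu]; first by case: (projP i Xx).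
  have [Xu Hu] := st_lubP SX dS lu; have [pSX Xp Hp] := proj_sup i SX Hu Xu.
  apply: st_lub_sup => //; apply: directed_image dS => a b Sa Sb.
  by apply: proj_st => //; apply: SX.
- split=> [x Xx|x y Xx Xy xy]; first exact: proj_le_id.
  have [[Xpx Epx] [Xpy Epy]] := (projP i Xx, projP i Xy).
  apply/(glb_ext hD Xpy Xx Xpx) => z m; rewrite Epx Epy.
  have [xy1 xy2] := proj1 (st_ap hD Xx Xy) xy; have sx := D_seqfun hD Xx.
  split=> [[lm xz]|[[lm yz] xz]]; last by split=> //; apply: xy2 (trunc_le i z) xz yz.
  by split; [split=> //; apply: xy1 | exact: (sf_mono sx (trunc_le i z) xz)].
- move=> x Xx; have [Xp Ep] := projP i Xx.
  by rewrite {1}/proj Ep truncf_truncf minnn.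
- exact: proj_finite.
Qed.

End Bidomain.

Theorem theorem6p6 (D : ty -> set dom) (hD : fmodel D) (n : nat) :
  let ss := nseq n Iota in
  let s := arrs ss in
  [/\ st_glbs_by_trace D ss (fin_elt s),
      st_lubs_by_trace D ss (fin_elt s),
      st_distributive D ss (fin_elt s)
    & (forall G : set gtm, infinite_game_term s G ->
         exists d : dom, game_denotation D s G d) ->
      [/\ D s = greatest_fmodel s,
          st_glbs_by_trace D ss (D s),
          st_lubs_by_trace D ss (D s),
          st_distributive D ss (D s)
        & bidomain (D s) ext (st D s) (bot s)]].
Proof.
move=> ss s.
have fD : fin_elt s `<=` D s by move=> d /(fin_eltP hD)[].
have fT := @fin_elt_tr D n hD.
split; [exact: (st_glbsP hD fD fT) | exact: (st_lubsP hD fD fT)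
  | exact: (st_distributiveP hD fD fT) |].
move=> /(greatest hD) Dmax; have DD : D s `<=` D s by [].
have DT := D_tr Dmax.
split=> //; [exact: (st_glbsP hD DD DT) | exact: (st_lubsP hD DD DT)
  | exact: (st_distributiveP hD DD DT) | exact: sg_bidomain].
Qed.
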